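(* Let $K$ be a Legendrian knot in $\mathcal{H}$. Then \begin{equation} E(K)=E(T(K)) \end{equation} for any $T\in\mathrm{PU}(2,1)$ satisfying $T(K)\subset\mathcal{H}$.
   Context: $\mathcal{H}=\mathbb{C}\times\mathbb{R}$ is the 3-dimensional Heisenberg group with coordinates $(z,u)=(x,y,u)$, group law $(z,u)\cdot(z',u')=(z+z',u+u'-\tfrac{1}{2}\Im(z\overline{z'}))$, horizontal distribution spanned by $X=\partial_x-\tfrac12 y\,\partial_u$, $Y=\partial_y+\tfrac12 x\,\partial_u$ (orthonormal, norm $|\cdot|$). The Korányi distance is $d_{\mathcal{H}}(p,q)=\|p^{-1}q\|_{\mathcal{H}}$ with $\|(x,y,u)\|_{\mathcal{H}}=\sqrt[4]{(x^2+y^2)^2+16u^2}$. For a smooth Legendrian knot $K$ (closed embedded curve with horizontal velocity, arc-length measure $dp$), the beta function $B_K(\zeta)=\iint_{K\times K}d_{\mathcal{H}}(p,q)^\zeta\,dp\,dq$, defined for $\Re\zeta>-1$, extends meromorphically to $\mathbb{C}$ with at most simple poles at $-1,-3,-5,\dots$, and the energy is $E(K)=B_K(-2)$. $\mathrm{PU}(2,1)$ is the group of CR automorphisms of the one-point compactification $\mathcal{H}\cup\{\infty\}\cong S^3$ (Möbius transformations); it is generated by the dilations $(x,y,u)\mapsto(\lambda x,\lambda y,\lambda^2u)$, left translations, rotations $(z,u)\mapsto(e^{i\theta}z,u)$, and the inversion $\iota(z,u)=\bigl(z/(|z|^2+4iu),\,-u/(|z|^4+16u^2)\bigr)$. *)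

(* Defs.v *)
From Stdlib Require Import Reals ClassicalEpsilon.
From mathcomp Require Import all_boot all_algebra.
From mathcomp Require Import all_classical all_reals all_analysis.
From mathcomp Require Import Rstruct Rstruct_topology.
From Coquelicot Require Complex Derive Hierarchy.

Set Implicit Arguments.
Unset Strict Implicit.
Unset Printing Implicit Defensive.

(* ---------- The Heisenberg group H = C x R, points ((x, y), u) ---------- *)
Definition pt := (R * R * R)%type.

Local Open Scope R_scope.

Definition px (p : pt) : R := fst (fst p).
Definition py (p : pt) : R := snd (fst p).
Definition pu (p : pt) : R := snd p.

(* (z,u).(z',u') = (z+z', u+u' - 1/2 Im(z conj z')),  Im(z conj z') = y x' - x y' *)
Definition hmul (p q : pt) : pt :=
  ((px p + px q, py p + py q),
   pu p + pu q - / 2 * (py p * px q - px p * py q)).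

Definition hinv (p : pt) : pt := ((- px p, - py p), - pu p).

Definition hnorm (p : pt) : R :=
  sqrt (sqrt ((px p ^ 2 + py p ^ 2) ^ 2 + 16 * pu p ^ 2)).

Definition kdist (p q : pt) : R := hnorm (hmul (hinv p) q).

(* ---------- PU(2,1) acting on H u {oo}  (None = oo) ---------- *)
Definition dilation (l : R) (P : option pt) : option pt :=
  match P with
  | Some p => Some ((l * px p, l * py p), l ^ 2 * pu p)
  | None => None
  end.

Definition ltranslation (a : pt) (P : option pt) : option pt :=
  match P with
  | Some p => Some (hmul a p)
  | None => None
  end.

Definition rotation (th : R) (P : option pt) : option pt :=
  match P with
  | Some p => Some ((cos th * px p - sin th * py p, sin th * px p + cos th * py p), pu p)
  | None => None
  end.

(* iota(z,u) = (z/(|z|^2+4iu), -u/(|z|^4+16u^2)); written in real coordinates: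
   with r2 = x^2+y^2, D = r2^2+16u^2 = | |z|^2+4iu |^2,
   z/(r2+4iu) = z (r2-4iu)/D = ((x r2 + 4 u y)/D, (y r2 - 4 u x)/D).
   iota(0) = oo and iota(oo) = 0. *)
Definition inversion (P : option pt) : option pt :=
  match P with
  | None => Some ((0, 0), 0)
  | Some p =>
      let r2 := px p ^ 2 + py p ^ 2 in
      let D := r2 ^ 2 + 16 * pu p ^ 2 in
      if Req_EM_T D 0 then None
      else Some (((px p * r2 + 4 * pu p * py p) / D,
                  (py p * r2 - 4 * pu p * px p) / D),
                 - pu p / D)
  end.

(* PU(2,1): the group generated by dilations, left translations, rotations and
   the inversion (closed under inverses already, since the generating set is). *)
Inductive PU21 : (option pt -> option pt) -> Prop :=
  | PU21_dil l : 0 < l -> PU21 (dilation l)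
  | PU21_trans a : PU21 (ltranslation a)
  | PU21_rot th : PU21 (rotation th)
  | PU21_inv : PU21 inversion
  | PU21_comp f g : PU21 f -> PU21 g -> PU21 (fun P => f (g P)).

Definition smooth (f : R -> R) : Prop :=
  forall (n : nat) (t : R), Derive.ex_derive_n f n t.

(* gamma : R -> H is an L-periodic smooth regular parametrization of a closed
   embedded curve whose velocity is horizontal: gamma' = x' X + y' Y, i.e.
   u' = (x y' - y x')/2. *)
Definition legendrian_knot (gamma : R -> pt) (L : R) : Prop :=
  0 < L /\
  (forall t, gamma (t + L) = gamma t) /\
  (forall s t, 0 <= s < L -> 0 <= t < L -> gamma s = gamma t -> s = t) /\
  smooth (fun t => px (gamma t)) /\
  smooth (fun t => py (gamma t)) /\
  smooth (fun t => pu (gamma t)) /\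
  (forall t, 0 < Derive.Derive (fun s => px (gamma s)) t ^ 2
                 + Derive.Derive (fun s => py (gamma s)) t ^ 2) /\
  (forall t, Derive.Derive (fun s => pu (gamma s)) t =
     / 2 * (px (gamma t) * Derive.Derive (fun s => py (gamma s)) t
            - py (gamma t) * Derive.Derive (fun s => px (gamma s)) t)).

(* horizontal speed |gamma'(t)| = sqrt(x'^2 + y'^2): density of arc length dp *)
Definition speed (gamma : R -> pt) (t : R) : R :=
  sqrt (Derive.Derive (fun s => px (gamma s)) t ^ 2
        + Derive.Derive (fun s => py (gamma s)) t ^ 2).

Notation C := Complex.C.

(* d^zeta = exp(zeta ln d) for d > 0 (set to 0 when d = 0, a null set). *)
Definition cpow (d : R) (zeta : C) : C :=
  if Rlt_dec 0 d then
    (exp (fst zeta * ln d) * cos (snd zeta * ln d),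
     exp (fst zeta * ln d) * sin (snd zeta * ln d))
  else (0, 0).

Local Close Scope R_scope.

Definition leb2 := ((@lebesgue_measure R) \x (@lebesgue_measure R))%E.

Definition square (L : R) : set (R * R) := (`[0%R, L] `*` `[0%R, L])%classic.

(* B_K(zeta) = \iint_{K x K} d_H(p,q)^zeta dp dq  (meaningful for Re zeta > -1),
   computed through the arc-length parametrization density. *)
Definition beta (gamma : R -> pt) (L : R) (zeta : C) : C :=
  (Rintegral leb2 (square L)
     (fun st => (fst (cpow (kdist (gamma st.1) (gamma st.2)) zeta)
                 * speed gamma st.1 * speed gamma st.2)%R),
   Rintegral leb2 (square L)
     (fun st => (snd (cpow (kdist (gamma st.1) (gamma st.2)) zeta)
                 * speed gamma st.1 * speed gamma st.2)%R)).

Local Open Scope R_scope.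

Definition not_pole (z : C) : Prop :=
  forall k : nat, z <> (- (2 * INR k + 1), 0).

(* e is the value at -2 of the meromorphic continuation of B_K: a function F
   holomorphic on C \ {-1,-3,-5,...} (connected, so F is unique there) that
   agrees with B_K on Re zeta > -1. *)
Definition is_energy (gamma : R -> pt) (L : R) (e : C) : Prop :=
  exists F : C -> C,
    (forall z, not_pole z ->
       @Derive.ex_derive Complex.C_AbsRing Complex.C_NormedModule F z) /\
    (forall z, -1 < fst z -> F z = beta gamma L z) /\
    F (-2, 0) = e.

Definition energy (gamma : R -> pt) (L : R) : C :=
  epsilon (inhabits (0, 0)) (is_energy gamma L).

(* Main.v *)
(* Along a Legendrian curve the fourth power of the Koranyi distance between the points of
   parameters t + s/2 and t - s/2 is s^4 Q(t, s), with Q positive and even in s.  A Moebius map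
   multiplies the squared distance by the inverse of a product of conformal factors
   sqrt(h(p) h(q)), and speeds by 1 / sqrt(h); this is read off from the Hermitian form of
   signature (2,1).  Hence both beta functions are of the form
   2 \int_0^L \int_0^{L/2} (s e^l)^z f ds dt with l and f even in s, and integrating by parts in s
   repeatedly continues such integrals to C minus the poles, the parity of l and f confining the
   poles to -1, -3, -5, ...  One integration by parts reaches z = -2, and the resulting expression
   involves l and f only through e^(-2l) f, from which the conformal factors cancel. *)

Require Import Defs.
From Stdlib Require Import Reals ZArith Lra Lia ClassicalEpsilon FunctionalExtensionality PropExtensionality.
From mathcomp Require Import ssreflect ssrbool ssrfun ssrnat.
From HB Require Import structures.
From mathcomp Require all_boot all_order all_algebra all_classical all_reals all_analysis.
From mathcomp Require measurable_realfun Rstruct Rstruct_topology lra ring.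
From Coquelicot Require Coquelicot.
Set Implicit Arguments.
Unset Strict Implicit.
Unset Printing Implicit Defensive.

(** * Cosine and sine as solutions of a differential equation *)

Section TrigoUniqueness.
Import Coquelicot.
Local Open Scope R_scope.

(** The integrand $d^{-2}\,dp\,dq$ is pointwise invariant, but its integral diverges along the
    diagonal; only the continuation has a value at $-2$, and it is built from exponents at which
    nothing cancels. Invariance could thus fail by a finite anomaly. It does not, for two reasons:
    $-2$ is not a pole, and $T(K)$ is integrated in the parameters of $K$, not in its own arc
    length, so that both continuations use the same midpoint $t$, difference $s$ and end point
    $s=L/2$. Horizontality is what makes $Q$ exist: the vertical coordinate of
    $\gamma(t-s/2)^{-1}\gamma(t+s/2)$ vanishes to third order in $s$, so its contribution to $d^4$
    is of order $s^6$. Evenness is not expressed by an equation between values at $s$ and $-s$, but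
    by the possibility of applying $s^{-1}\partial_s$ repeatedly, which is exactly what integration
    by parts consumes. No asymptotic expansion at the diagonal is then required. Regularity in $t$
    is reduced to a Lipschitz bound, which suffices for the Lebesgue integral over $(t,s)$, while
    derivatives are taken in $s$ alone. *)

Lemma is_derive_zero_const (f : R -> R) :
  (forall x, is_derive f x 0) -> forall x y, f x = f y.
Proof.
move=> df x y.
have [||d [_ Hd]] := MVT_gen f x y (fun _ => 0).
- by move=> z _; exact: df.
- move=> z _; apply continuity_pt_filterlim; apply: ex_derive_continuous.
  by exists 0; exact: df.
lra.
Qed.

(** The squared distance between the two solutions has derivative 0 and vanishes at 0. *)
Lemma trigo_ode_unique (c s : R -> R) :
  (forall x, derivable_pt_lim c x (- s x)) -> (forall x, derivable_pt_lim s x (c x)) ->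
  c 0 = 1 -> s 0 = 0 -> forall x, c x = cos x /\ s x = sin x.
Proof.
move=> /(_ _)/is_derive_Reals dc /(_ _)/is_derive_Reals ds c0 s0 x.
have H : (c x - cos x) ^ 2 + (s x - sin x) ^ 2 = (c 0 - cos 0) ^ 2 + (s 0 - sin 0) ^ 2.
  apply: (is_derive_zero_const (f := fun x => (c x - cos x) ^ 2 + (s x - sin x) ^ 2)) => y.
  auto_derive; first by repeat split; eexists; eauto.
  rewrite (is_derive_unique _ _ _ (dc y)) (is_derive_unique _ _ _ (ds y)); ring.
rewrite cos_0 sin_0 c0 s0 in H.
have := pow2_ge_0 (c x - cos x); have := pow2_ge_0 (s x - sin x) => h1 h2.
by split; apply: Rminus_diag_uniq; apply: Rsqr_0_uniq; rewrite /Rsqr; nra.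
Qed.

End TrigoUniqueness.

(** * Integration on the plane *)

Module PlaneIntegration.
Import all_boot all_order all_algebra all_classical all_reals all_analysis.
Import measurable_realfun Rstruct Rstruct_topology.

(** * Agreement of the two notions of derivative, and of the two cosines and sines *)

Section Bridge.
Import Order.TTheory GRing.Theory Num.Theory numFieldNormedType.Exports.
Local Open Scope classical_set_scope.
Local Open Scope ring_scope.

(** The epsilon-delta form is the common ground on which this derivative meets
    [derivable_pt_lim]. *)
Lemma is_derive_epsP (K : realType) (f : K -> K) (x l : K) :
  is_derive x 1 f l <->
  (forall e : K, 0 < e -> exists2 d : K, 0 < d &
    forall h, h != 0 -> `|h| < d -> `|(f (x + h) - f x) / h - l| < e).
Proof.
split=> [[/cvg_ex[l' cl'] dl] e e0|H].
  have ? : l' = l by rewrite -dl; apply/esym/cvg_lim.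
  subst l'; move/cvgrPdist_lt: cl' => /(_ e e0)[d /= d0 Hd].
  exists d => // h h0 hd; have := Hd h; rewrite /= sub0r normrN => /(_ hd h0).
  by rewrite /GRing.scale /= mulr1 [h + x]addrC distrC mulrC.
have cl : (fun h : K => h^-1 *: (f (h *: (1 : K) + x) - f x)) @ 0^' --> l.
  apply/cvgrPdist_lt => e e0; have [d d0 Hd] := H e e0.
  exists d => //= h /= hd h0; rewrite sub0r normrN in hd.
  by have := Hd h h0 hd; rewrite distrC /GRing.scale /= mulr1 [h + x]addrC mulrC.
by split; [apply/cvg_ex; exists l|exact: cvg_lim].
Qed.

Lemma derivable_pt_lim_is_derive (f : R -> R) (x l : R) :
  derivable_pt_lim f x l <-> is_derive (x : (R : realType)) 1 (f : (R : realType) -> (R : realType)) l.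
Proof.
rewrite (@is_derive_epsP (R : realType) f x l); split=> H e.
  move=> /RltP e0; have [d Hd] := H e e0.
  exists (pos d); first by apply/RltP; case: d {Hd}.
  move=> h h0 /RltP; rewrite -RabsE => hd; apply/RltP; rewrite -RabsE.
  exact: (Hd h (elimN eqP h0) hd).
move=> /RltP e0; have [d /RltP d0 Hd] := H e e0.
exists (mkposreal d d0) => h /eqP h0 /= /RltP; rewrite RabsE => hd.
by have /RltP := Hd h h0 hd; rewrite -RabsE.
Qed.

(** [cpow] is written with the MathComp cosine and sine, while the calculus below differentiates
    those of Stdlib. The differential equation identifies them without a comparison of series. *)
Lemma trigo_RE (x : R) :
  (@trigo.cos R x = Rtrigo_def.cos x) /\ (@trigo.sin R x = Rtrigo_def.sin x).
Proof.
have dc : forall y : R, derivable_pt_lim (@trigo.cos R) y (Ropp (@trigo.sin R y)).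
  move=> y; apply/derivable_pt_lim_is_derive.
have ds : forall y : R, derivable_pt_lim (@trigo.sin R) y (@trigo.cos R y).
  move=> y; apply/derivable_pt_lim_is_derive.
apply: (trigo_ode_unique dc ds); [exact: (@cos0 (R : realType))|exact: (@sin0 (R : realType))].
Qed.

End Bridge.

(** * Translations, reflections and periods of integrals on the line *)

Section LebesgueUnfolding.
Import Order.TTheory GRing.Theory Num.Theory numFieldNormedType.Exports.
Local Open Scope classical_set_scope.
Local Open Scope ring_scope.
Context {R : realType}.
Local Notation mu := (@lebesgue_measure R).
Local Open Scope ereal_scope.

Lemma lebesgue_measure_shift (c : R) (A : set R) : measurable A ->
  pushforward mu ((fun x => x + c)%R : _ -> measurableTypeR R) A = mu A.
Proof.
move=> mA; apply/esym; have mf : measurable_fun setT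
   ((fun x => x + c)%R : measurableTypeR R -> measurableTypeR R).
  exact: measurable_funD.
pose mixin := isMeasurableFun.Build _ _ _ _ _ mf.
pose f : {mfun measurableTypeR R >-> measurableTypeR R} :=
  HB.pack ((fun x => x + c)%R : measurableTypeR R -> measurableTypeR R) mixin.
apply: (@lebesgue_measure_unique _ (pushforward mu f)) => // _ [[a b]] _ <-.
rewrite /pushforward /f /=.
rewrite [X in _ = lebesgue_measure X](_ : _ = `](a - c)%R, (b - c)%R]%classic); last first.
  by apply/seteqP; split=> x /=; rewrite !in_itv/= ltrBlDr lerBrDr.
rewrite !lebesgue_measure_itv/= !lte_fin ltrD2r.
by rewrite -!EFinB opprB addrA subrK.
Qed.

(** By uniqueness of Lebesgue measure only the intervals []a, b]] have to be compared; their
    preimages are closed on the left instead, but have the same length. *)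
Lemma lebesgue_measure_reflect (c : R) (A : set R) : measurable A ->
  pushforward mu ((fun x => c - x)%R : _ -> measurableTypeR R) A = mu A.
Proof.
move=> mA; apply/esym; have mf : measurable_fun setT
   ((fun x => c - x)%R : measurableTypeR R -> measurableTypeR R).
  exact: measurable_funB.
pose mixin := isMeasurableFun.Build _ _ _ _ _ mf.
pose f : {mfun measurableTypeR R >-> measurableTypeR R} :=
  HB.pack ((fun x => c - x)%R : measurableTypeR R -> measurableTypeR R) mixin.
apply: (@lebesgue_measure_unique _ (pushforward mu f)) => // _ [[a b]] _ <-.
rewrite /pushforward /f /=.
rewrite [X in _ = lebesgue_measure X](_ : _ = `[(c - b)%R, (c - a)%R[%classic); last first.
  apply/seteqP; split=> x /=; rewrite !in_itv/= => /andP[h1 h2]; apply/andP; split.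
  - by rewrite lerBlDr addrC -lerBlDr.
  - by rewrite ltrBrDr addrC -ltrBrDr.
  - by rewrite ltrBrDr addrC -ltrBrDr.
  - by rewrite lerBlDr addrC -lerBlDr.
rewrite !lebesgue_measure_itv/= !lte_fin ltrD2l ltrN2 -!EFinB.
by rewrite opprB [in RHS]addrC addrA subrK.
Qed.

Lemma ge0_integral_shift (f : R -> \bar R) (c : R) (D : set R) :
  measurable D -> measurable_fun setT f -> (forall x, 0 <= f x) ->
  \int[mu]_(x in (fun x => (x + c)%R) @^-1` D) f (x + c)%R =
  \int[mu]_(x in D) f x.
Proof.
move=> mD mf f0.
have mp : measurable_fun setT ((fun x => x + c)%R : measurableTypeR R -> measurableTypeR R).
  exact: measurable_funD.
rewrite -(ge0_integral_pushforward mp mu mD (measurable_funS measurableT (@subsetT _ _) mf))//.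
by apply: eq_measure_integral => //= A mA _; exact: lebesgue_measure_shift.
Qed.

Lemma ge0_integral_reflect (f : R -> \bar R) (c : R) (D : set R) :
  measurable D -> measurable_fun setT f -> (forall x, 0 <= f x) ->
  \int[mu]_(x in (fun x => (c - x)%R) @^-1` D) f (c - x)%R =
  \int[mu]_(x in D) f x.
Proof.
move=> mD mf f0.
have mp : measurable_fun setT ((fun x => c - x)%R : measurableTypeR R -> measurableTypeR R).
  exact: measurable_funB.
rewrite -(ge0_integral_pushforward mp mu mD (measurable_funS measurableT (@subsetT _ _) mf))//.
by apply: eq_measure_integral => //= A mA _; exact: lebesgue_measure_reflect.
Qed.

Lemma ge0_integral_splitco (f : R -> \bar R) (a b c : R) :
  measurable_fun setT f -> (forall x, 0 <= f x) -> (a <= b)%R -> (b <= c)%R ->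
  \int[mu]_(x in `[a, c[) f x =
  \int[mu]_(x in `[a, b[) f x + \int[mu]_(x in `[b, c[) f x.
Proof.
move=> mf f0 ab bc.
rewrite (@itv_bndbnd_setU _ _ _ (BLeft b))//.
rewrite ge0_integral_setU//.
- exact: measurable_funS mf.
- apply/disj_set2P; rewrite -subset0 => z/=; rewrite !in_itv/= => -[/andP[_ h1] /andP[h2 _]].
  by move: h1; rewrite ltNge h2.
Qed.

(** A shift by at most one period creates a single overhang [[L, L + d[], which periodicity moves
    back to [[0, d[]. A negative shift [c] is first replaced by [c + L]. *)
Lemma ge0_integral_periodic (f : R -> \bar R) (L c : R) : (0 < L)%R ->
  measurable_fun setT f -> (forall x, 0 <= f x) ->
  (forall x, f (x + L)%R = f x) -> (`|c| <= L)%R ->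
  \int[mu]_(x in `[0%R, L[) f (x + c)%R = \int[mu]_(x in `[0%R, L[) f x.
Proof.
move=> L0 mf f0 fL.
have pos d : (0 <= d)%R -> (d <= L)%R ->
    \int[mu]_(x in `[0%R, L[) f (x + d)%R = \int[mu]_(x in `[0%R, L[) f x.
  move=> d0 dL.
  have E : `[0%R, L[%classic = (fun x => (x + d)%R) @^-1` `[d, (L + d)%R[.
    by apply/seteqP; split=> x /=; rewrite !in_itv/= lerDr ltrD2r.
  rewrite [in LHS]E ge0_integral_shift// (@ge0_integral_splitco f d L)//; last by rewrite lerDl.
  have -> : \int[mu]_(x in `[L, (L + d)%R[) f x = \int[mu]_(x in `[0%R, d[) f x.
    rewrite -(@ge0_integral_shift f L)//.
    have -> : (fun x => (x + L)%R) @^-1` `[L, (L + d)%R[ = `[0%R, d[%classic.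
      by apply/seteqP; split=> x /=; rewrite !in_itv/= lerDr (addrC L) ltrD2r.
    by apply: eq_integral => x _; rewrite fL.
  by rewrite addeC -ge0_integral_splitco.
rewrite ler_norml => /andP[c1 c2].
have [c0|c0] := leP 0%R c; first exact: pos.
under eq_integral do rewrite -fL -addrA.
by apply: pos; [rewrite -lerBlDr sub0r|rewrite gerDr ltW].
Qed.

End LebesgueUnfolding.

(** * Unfolding a symmetric doubly periodic integral *)

Section SquareUnfolding.
Import mathcomp.algebra_tactics.lra.
Import Order.TTheory GRing.Theory Num.Theory numFieldNormedType.Exports.
Local Open Scope classical_set_scope.
Local Open Scope ring_scope.
Context {R : realType}.
Local Notation mu := (@lebesgue_measure R).
Local Open Scope ereal_scope.

Lemma ge0_integral_setX12 (A B : set R) (G : R * R -> \bar R) :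
  measurable A -> measurable B -> measurable_fun setT G -> (forall z, 0 <= G z) ->
  \int[mu \x mu]_(z in A `*` B) G z = \int[mu]_(x in A) \int[mu]_(y in B) G (x, y).
Proof.
move=> mA mB mG G0; have mAB : measurable (A `*` B) by exact: measurableX.
have mr : measurable_fun setT (G \_ (A `*` B)).
  by apply/(measurable_restrictT _ mAB); exact: measurable_funS mG.
rewrite integral_mkcond (@fubini_tonelli1 _ _ _ _ _ mu mu (G \_ (A `*` B)))//; last first.
  by move=> z; rewrite erestrict_ge0.
rewrite [RHS]integral_mkcond; apply: eq_integral => x _.
rewrite /fubini_F patchE; case: ifPn => xA.
  rewrite [RHS]integral_mkcond; apply: eq_integral => y _; rewrite !patchE.
  by rewrite in_setX xA.
by rewrite integral0_eq// => y _; rewrite patchE in_setX (negbTE xA).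
Qed.

Lemma ge0_integral_setX21 (A B : set R) (G : R * R -> \bar R) :
  measurable A -> measurable B -> measurable_fun setT G -> (forall z, 0 <= G z) ->
  \int[mu \x mu]_(z in A `*` B) G z = \int[mu]_(y in B) \int[mu]_(x in A) G (x, y).
Proof.
move=> mA mB mG G0; have mAB : measurable (A `*` B) by exact: measurableX.
have mr : measurable_fun setT (G \_ (A `*` B)).
  by apply/(measurable_restrictT _ mAB); exact: measurable_funS mG.
rewrite integral_mkcond (@fubini_tonelli2 _ _ _ _ _ mu mu (G \_ (A `*` B)))//; last first.
  by move=> z; rewrite erestrict_ge0.
rewrite [RHS]integral_mkcond; apply: eq_integral => y _.
rewrite /fubini_G patchE; case: ifPn => yB.
  rewrite [RHS]integral_mkcond; apply: eq_integral => x _; rewrite !patchE.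
  by rewrite in_setX yB andbT.
by rewrite integral0_eq// => x _; rewrite patchE in_setX (negbTE yB) andbF.
Qed.

Lemma measurable_ysection_integral (A : set R) (G : R * R -> \bar R) :
  measurable A -> measurable_fun setT G -> (forall z, 0 <= G z) ->
  measurable_fun setT (fun y => \int[mu]_(x in A) G (x, y)).
Proof.
move=> mA mG G0; have mAT : measurable (A `*` @setT R) by exact: measurableX.
have mr : measurable_fun setT (G \_ (A `*` setT)).
  by apply/(measurable_restrictT _ mAT); exact: measurable_funS mG.
have := @measurable_fun_fubini_tonelli_G _ _ _ _ _ mu (G \_ (A `*` setT)) mr.
have h z : 0 <= (G \_ (A `*` setT)) z by rewrite erestrict_ge0.
move=> /(_ h); apply: eq_measurable_fun => y _.
rewrite /fubini_G [RHS]integral_mkcond; apply: eq_integral => x _; rewrite !patchE.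
by rewrite in_setX in_setT andbT.
Qed.

(* The torus is covered by the midpoint-difference coordinates
   [(t, tau) |-> (t + tau/2, t - tau/2)], in which a symmetric kernel is even in [tau]. *)
Lemma ge0_integral_square_symmetric (G : R * R -> \bar R) (L : R) : (0 < L)%R ->
  measurable_fun setT G -> (forall z, 0 <= G z) ->
  (forall x y, G (x + L, y)%R = G (x, y)) -> (forall x y, G (x, y + L)%R = G (x, y)) ->
  (forall x y, G (x, y) = G (y, x)) ->
  \int[mu \x mu]_(z in `[0%R, L] `*` `[0%R, L]) G z =
  2%:E * \int[mu \x mu]_(z in `[0%R, L] `*` `]0%R, (L / 2)%R])
    G (z.1 + z.2 / 2, z.1 - z.2 / 2)%R.
Proof.
move=> L0 mG G0 G1 G2 Gsym.
have mGc (f g : R * R -> R) : measurable_fun setT f -> measurable_fun setT g ->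
    measurable_fun setT (fun z => G (f z, g z)).
  by move=> mf mg; exact: (measurableT_comp mG (measurable_fun_pair mf mg)).
have mfst : measurable_fun setT (fst : R * R -> R) by exact: measurable_fst.
have msnd : measurable_fun setT (snd : R * R -> R) by exact: measurable_snd.
have mhalf : measurable_fun setT (fun z : R * R => (z.2 / 2)%R).
  by apply: measurable_funM => //; exact: measurable_cst.
have mH : measurable_fun setT (fun z : R * R => G (z.1 + z.2 / 2, z.1 - z.2 / 2)%R).
  by apply: mGc; [exact: measurable_funD|exact: measurable_funB].
have mG' : measurable_fun setT (fun z : R * R => G (z.1 + z.2, z.2)%R).
  by apply: mGc => //; exact: measurable_funD.
have mpair (h : R -> R * R) : measurable_fun setT (fst \o h) -> measurable_fun setT (snd \o h) ->
    measurable_fun setT (G \o h).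
  move=> h1 h2; apply: measurableT_comp => //.
  exact/(@measurable_fun_pairP _ _ _ _ _ _ h).
have mid : measurable_fun setT (fun x : R => x) by exact: measurable_id.
pose K x := \int[mu]_(y in `[0%R, L[) G (y + x / 2, y - x / 2)%R.
have mK : measurable_fun setT K.
  exact: (@measurable_ysection_integral _ (fun z => G (z.1 + z.2 / 2, z.1 - z.2 / 2)%R)).
have K0 x : 0 <= K x by exact: integral_ge0.
(* Swapping the two points and moving one of them by a period turns the difference $x$ into $L-x$
   and shifts the midpoint by $L/2$. *)
have KL x : K (L - x)%R = K x.
  rewrite /K -(@ge0_integral_periodic _ (fun y => G (y + x / 2, y - x / 2)%R) L (L / 2)%R)//.
  - apply: eq_integral => y _; rewrite [in LHS]Gsym -[in LHS]G1; congr (G (_, _)); lra.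
  - apply: mpair; apply: measurable_funD => //; exact: measurable_cst.
  - by move=> z; rewrite -addrA [(L + _)%R]addrC addrA G1 -addrA [(L - _)%R]addrC addrA G2.
  - by rewrite ger0_norm; lra.
pose K2 (y x : R) := G (y + x / 2, y - x / 2)%R.
have -> : \int[mu \x mu]_(z in `[0%R, L] `*` `[0%R, L]) G z = \int[mu]_(x in `[0%R, L[) K x.
  rewrite ge0_integral_setX21//.
  (* An inner shift by [y] makes [x] the difference of the two points; after exchanging the
     integrals, a shift by [- (x / 2)] makes [y] their midpoint. *)
  transitivity (\int[mu]_(y in `[0%R, L[) \int[mu]_(x in `[0%R, L[) G (x + y, y)%R).
    rewrite -integral_itv_bndo_bndc; last first.
      by apply: (@measurable_funS _ _ _ _ setT) => //; exact: measurable_ysection_integral.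
    apply: eq_integral => y; rewrite inE/= in_itv/= => /andP[y0 yL].
    have my : measurable_fun setT (fun x => G (x, y)).
      by apply: mpair => //; exact: measurable_cst.
    rewrite -integral_itv_bndo_bndc; last by apply: (@measurable_funS _ _ _ _ setT).
    rewrite (@ge0_integral_periodic _ (fun x => G (x, y)))// ger0_norm//.
    exact: ltW.
  have m1 : measurable_fun setT (fun z : R * R => G (z.1 + z.2, z.2)%R) by [].
  rewrite -(@ge0_integral_setX21 _ _ (fun z : R * R => G (z.1 + z.2, z.2)%R))//.
  rewrite (@ge0_integral_setX12 _ _ (fun z : R * R => G (z.1 + z.2, z.2)%R))//=.
  apply: eq_integral => x; rewrite inE/= in_itv/= => /andP[x0 xL].
  rewrite -(@ge0_integral_periodic _ (fun y => G (x + y, y)%R) L (- (x / 2))%R)//.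
  - rewrite /K; apply: eq_integral => y _; congr (G (_, _)); lra.
  - by apply: mpair => //; apply: measurable_funD => //; exact: measurable_cst.
  - by move=> z; rewrite addrA G1 G2.
  - by rewrite normrN ger0_norm; lra.
rewrite (@ge0_integral_setX21 _ _ (fun z : R * R => G (z.1 + z.2 / 2, z.1 - z.2 / 2)%R))//=.
have -> : \int[mu]_(y in `]0%R, (L / 2)%R]) \int[mu]_(x in `[0%R, L]) G (x + y / 2, x - y / 2)%R =
   \int[mu]_(y in `]0%R, (L / 2)%R]) K y.
  apply: eq_integral => y _; rewrite /K -integral_itv_bndo_bndc//.
  apply: (@measurable_funS _ _ _ _ setT) => //; apply: mpair.
    by apply: measurable_funD => //; exact: measurable_cst.
  by apply: measurable_funB => //; exact: measurable_cst.
have mKS D : measurable_fun D K by exact: (@measurable_funS _ _ _ _ setT).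
rewrite (@ge0_integral_splitco _ K 0%R (L / 2)%R L)//; [|lra|lra].
rewrite integral_itv_bndo_bndc// -integral_itv_obnd_cbnd//.
(* The reflection $x\mapsto L-x$ folds the upper half of the differences onto the lower one; the
   diagonal $x=0$ is excluded from both. *)
have -> : \int[mu]_(x in `[(L / 2)%R, L[) K x = \int[mu]_(x in `]0%R, (L / 2)%R]) K x.
  rewrite -(@ge0_integral_reflect _ K L)//.
  have -> : (fun x : R => (L - x)%R) @^-1` `[(L / 2)%R, L[ = `]0%R, (L / 2)%R]%classic.
    by apply/seteqP; split=> x /=; rewrite !in_itv/= => /andP[h1 h2]; apply/andP; split; lra.
  by apply: eq_integral => x _; rewrite KL.
by rewrite mule_natl mule2n.
Qed.
End SquareUnfolding.

(** * The fundamental theorem of calculus up to a singular end point *)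

Section HalfOpenFTC.
Import Order.TTheory GRing.Theory Num.Theory numFieldNormedType.Exports.
Local Open Scope classical_set_scope.
Local Open Scope ring_scope.
Context {K : realType}.
Local Notation mu := (@lebesgue_measure K).

Lemma itvoc_bigcup (a : K) : 0 < a ->
  \bigcup_n `[a / n.+1%:R, a]%classic = `]0, a]%classic.
Proof.
move=> a0; apply/seteqP; split=> [x [n _] /=|x /=]; rewrite !in_itv/= => /andP[h1 h2].
  by rewrite h2 andbT (lt_le_trans _ h1)// divr_gt0.
exists (Num.truncn (a / x)) => //=; rewrite in_itv/= h2 andbT.
rewrite ler_pdivrMr// mulrC -ler_pdivrMr//.
by apply/ltW; rewrite truncnS_gt.
Qed.

Lemma nondecreasing_itvcc (a : K) : 0 < a ->
  nondecreasing_seq (fun n => `[a / n.+1%:R, a]%classic).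
Proof.
move=> a0 m n mn; apply/subsetPset => x /=; rewrite !in_itv/= => /andP[h1 h2].
rewrite h2 andbT (le_trans _ h1)// ler_pM2l// lef_pV2 ?posrE// ler_nat.
exact: mn.
Qed.

Lemma continuous_FTC2_pos (h G : K -> K) (x a : K) : 0 < x -> x < a ->
  (forall y, 0 < y -> y <= a -> is_derive y 1 G (h y)) ->
  (forall y, 0 < y -> y <= a -> {for y, continuous h}) ->
  (\int[mu]_(y in `[x, a]) (h y)%:E = (G a)%:E - (G x)%:E)%E.
Proof.
move=> x0 xa dG ch.
have cG y : 0 < y -> y <= a -> {for y, continuous G}.
  move=> y0 ya; have ? := dG y y0 ya.
  by apply/differentiable_continuous/derivable1_diffP/ex_derive.
apply: continuous_FTC2 => //.
- apply: continuous_in_subspaceT => y; rewrite inE/= in_itv/= => /andP[h1 h2].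
  by apply: ch => //; exact: lt_le_trans h1.
- split.
  + move=> y; rewrite in_itv/= => /andP[h1 h2].
    by have ? := dG y (lt_trans x0 h1) (ltW h2); exact: ex_derive.
  + by apply: cvg_at_right_filter; apply: cG => //; exact: ltW.
  + by apply: cvg_at_left_filter; apply: cG => //; exact: lt_trans xa.
- move=> y; rewrite in_itv/= => /andP[h1 h2].
  have ? := dG y (lt_trans x0 h1) (ltW h2).
  by rewrite derive1E derive_val.
Qed.

(** With [expR (s * ln x)] standing for $x^s$, the primitive $x^{s+1}/(s+1)$ bounds the integrals
    over [[a / n.+1, a]] by its value at [a], and monotone convergence passes to the union. *)
Lemma integral_exp_ln_lty (s a : K) : -1 < s -> 0 < a ->
  (\int[mu]_(x in `]0%R, a]) (expR (s * ln x))%:E < +oo)%E.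
Proof.
move=> s1 a0; have s0 : 0 < s + 1 by rewrite -ltrBlDr sub0r.
pose G x := expR ((s + 1) * ln x) / (s + 1).
have dG y : 0 < y -> y <= a -> is_derive y 1 G (expR (s * ln y)).
  move=> y0 _; rewrite /G.
  have ? := is_derive1_ln y0.
  apply: is_derive_eq.
  rewrite !scaler0 add0r /GRing.scale/=.
  rewrite mulrCA mulKf ?gt_eqF//.
  by rewrite mulrDl mul1r exp.expRD lnK ?posrE// mulfK// gt_eqF.
have ch y : 0 < y -> y <= a -> {for y, continuous (fun x => expR (s * ln x))}.
  move=> y0 _; apply: continuous_comp; last exact: continuous_expR.
  apply: continuousM; first exact: cvg_cst.
  exact: continuous_ln.
have mh : measurable_fun setT (fun x : K => (expR (s * ln x))%:E).
  apply/measurable_EFinP; apply: measurableT_comp => //.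
  by apply: measurable_funM => //; exact: measurable_cst.
rewrite -itvoc_bigcup//.
have cv : (\int[mu]_(x in `[(a / i.+1%:R)%R, a]) (expR (s * ln x))%:E @[i --> \oo] -->
    \int[mu]_(x in \bigcup_i `[(a / i.+1%:R)%R, a]%classic) (expR (s * ln x))%:E)%E.
  apply: ge0_nondecreasing_set_cvg_integral.
  - exact: nondecreasing_itvcc.
  - by [].
  - by move=> i; exact: measurable_funS mh.
  - by move=> i x _; rewrite lee_fin expR_ge0.
rewrite -(cvg_lim _ cv)//; apply: (@le_lt_trans _ _ (G a)%:E); last by rewrite ltry.
apply: lime_le; first by apply/cvg_ex; eexists; exact: cv.
near=> n.
rewrite (@continuous_FTC2_pos _ G)//.
- by rewrite -EFinB lee_fin gerBl /G divr_ge0// ?expR_ge0// ltW.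
- by rewrite divr_gt0.
- rewrite ltr_pdivrMr// ltr_pMr// ltr1n ltnS; near: n; exact: nbhs_infty_gt.
Unshelve. all: by end_near. Qed.

(** Dominated convergence over the intervals [[a / n.+1, a]], with [h] itself as dominating
    function; the lower boundary term tends to 0 by hypothesis. *)
Lemma Rintegral_FTC_itvoc (h G : K -> K) (a : K) : 0 < a ->
  (forall y, 0 < y -> y <= a -> is_derive y 1 G (h y)) ->
  (forall y, 0 < y -> y <= a -> {for y, continuous h}) ->
  mu.-integrable `]0, a] (EFin \o h) ->
  G (a / n.+1%:R) @[n --> \oo] --> 0 ->
  (\int[mu]_(y in `]0%R, a]) (h y)%:E = (G a)%:E)%E.
Proof.
move=> a0 dG ch ih G0.
have mh : measurable_fun `]0, a] (EFin \o h) by case/integrableP : (ih).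
pose f_ (n : nat) : K -> \bar K := (EFin \o h) \_ (`[a / n.+1%:R, a]%classic : set K).
have sub n : `[a / n.+1%:R, a]%classic `<=` `]0, a]%classic.
  by rewrite -itvoc_bigcup// => x ?; exists n.
have [] := @dominated_convergence _ _ _ mu `]0, a] (measurable_itv _) f_ (EFin \o h) (abse \o (EFin \o h)) => //.
- move=> n; apply/measurable_restrict => //.
  by apply: measurable_funS mh => // x [].
- apply/aeW => x xa.
  have [N _ xN] : (\bigcup_n `[a / n.+1%:R, a]%classic) x by rewrite itvoc_bigcup.
  apply: cvg_near_cst; near=> n; rewrite /f_ patchE ifT// inE.
  have : `[a / N.+1%:R, a] `<=` `[a / n.+1%:R, a].
    apply/subsetPset; apply: (nondecreasing_itvcc a0); near: n; exact: nbhs_infty_ge.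
  by move=> /(_ _ xN).
- exact: integrable_abse.
- apply/aeW => x n xa; rewrite /f_ patchE; case: ifPn => // _.
  by rewrite [X in (abse X <= _)%E](_ : _ = 0%E)// abse0 abse_ge0.
move=> _ _ cv.
have e n : (\int[mu]_(x in `]0%R, a]) f_ n x = (G a - G (a / n.+1%:R))%:E)%E.
  rewrite -integral_mkcondr setIidr//.
  (* For index 0 the interval is the single point [a], which [continuous_FTC2_pos] does not
     cover. *)
  case: n => [|n]; first by rewrite divr1 subrr set_itv1 integral_set1.
  rewrite /= (@continuous_FTC2_pos _ G)//; first by rewrite divr_gt0.
  by rewrite ltr_pdivrMr// ltr_pMr// ltr1n.
move: cv; under eq_fun do rewrite e.
move=> cv; apply: cvg_unique cv _ => //.
apply: cvg_EFin; first exact: nearW.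
rewrite [X in _ --> X](_ : _ = G a - 0); last by rewrite subr0.
by apply: cvgB => //; exact: cvg_cst.
Unshelve. all: by end_near. Qed.

End HalfOpenFTC.

(** * Double integrals over the strip of midpoints and differences *)

Section Strip.
Import Order.TTheory GRing.Theory Num.Theory numFieldNormedType.Exports.
Local Open Scope classical_set_scope.
Local Open Scope ring_scope.
Context {K : realType}.
Local Notation mu := (@lebesgue_measure K).
Local Notation mu2 := (mu \x mu)%E.

Definition strip (L a : K) : set (K * K) := `[0, L] `*` `]0, a].

Lemma measurable_strip L a : measurable (strip L a).
Proof. exact: measurableX. Qed.

Lemma integrable_setX_slice (A B : set K) (f : K * K -> \bar K) :
  measurable A -> measurable B -> mu2.-integrable (A `*` B) f ->
  mu.-integrable A (fun x => \int[mu]_(y in B) f (x, y))%E /\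
  (\int[mu2]_(z in A `*` B) f z = \int[mu]_(x in A) \int[mu]_(y in B) f (x, y))%E.
Proof.
move=> mA mB fi; have mAB : measurable (A `*` B) by exact: measurableX.
have fi' : mu2.-integrable setT (f \_ (A `*` B)) by move/integrable_mkcond : fi => /(_ mAB).
have e : fubini_F mu (f \_ (A `*` B)) = (fun x => \int[mu]_(y in B) f (x, y))%E \_ A.
  apply/funext => x; rewrite /fubini_F [RHS]patchE; case: ifPn => xA.
    rewrite [RHS]integral_mkcond; apply: eq_integral => y _; rewrite !patchE.
    by rewrite in_setX xA.
  by rewrite integral0_eq// => y _; rewrite patchE in_setX (negbTE xA).
split.
  by apply/integrable_mkcond => //; rewrite -e; exact: integrable_fubini_F.
rewrite integral_mkcond -(integral12_prod_meas1 fi') [RHS]integral_mkcond.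
by apply: eq_integral => x _; rewrite -[RHS](congr1 (fun F => F x) e).
Qed.

Lemma integrable_strip_exp_ln (s L a : K) : -1 < s -> 0 < a ->
  mu2.-integrable (strip L a) (EFin \o (fun z => expR (s * ln z.2))).
Proof.
move=> s1 a0; have mf : measurable_fun setT (EFin \o (fun z : K * K => expR (s * ln z.2))).
  apply/measurable_EFinP; apply: measurableT_comp => //.
  apply: measurable_funM; first exact: measurable_cst.
  by apply: measurableT_comp => //; exact: measurable_snd.
apply/integrableP; split; first exact: measurable_funS mf.
under eq_integral do rewrite /= ger0_norm ?expR_ge0//.
rewrite /strip ge0_integral_setX21//.
have -> : (\int[mu]_(y in `]0%R, a]) \int[mu]_(x in `[0%R, L]) (expR (s * ln (x, y).2))%:E =
    \int[mu]_(y in `]0%R, a]) ((expR (s * ln y))%:E * mu `[0%R, L]))%E.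
  by apply: eq_integral => y _; rewrite [LHS](@integral_cst _ _ _ mu _ _ (expR (s * ln y))%:E).
have mh : measurable_fun setT (fun y : K => (expR (s * ln y))%:E).
  apply/measurable_EFinP; apply: measurableT_comp => //.
  by apply: measurable_funM => //; exact: measurable_cst.
rewrite ge0_integralZr//; last exact: measurable_funS mh.
apply: lte_mul_pinfty.
- by apply: integral_ge0 => y _; rewrite lee_fin expR_ge0.
- rewrite ge0_fin_numE; first exact: integral_exp_ln_lty.
  by apply: integral_ge0 => y _; rewrite lee_fin expR_ge0.
- by rewrite lebesgue_measure_itv/=; case: ifPn => _; rewrite ?ltry.
Qed.

(** The boundary term is kept as an integral over the strip of a function constant in $y$, hence the
    factor [a]: double integrals then suffice everywhere. *)
Lemma Rintegral_strip_FTC (h g : K * K -> K) (L a s c : K) : 0 < a -> -1 < s ->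
  mu2.-integrable (strip L a) (EFin \o h) ->
  mu2.-integrable (strip L a) (EFin \o (fun z => g (z.1, a))) ->
  (forall t y, 0 <= t <= L -> 0 < y -> y <= a -> is_derive y 1 (fun y => g (t, y)) (h (t, y))) ->
  (forall t y, 0 <= t <= L -> 0 < y -> y <= a -> {for y, continuous (fun y => h (t, y))}) ->
  (forall t y, 0 <= t <= L -> 0 < y -> y <= a -> `|h (t, y)| <= c * expR (s * ln y)) ->
  (forall t, 0 <= t <= L -> g (t, a / n.+1%:R) @[n --> \oo] --> 0) ->
  a * \int[mu2]_(z in strip L a) h z = \int[mu2]_(z in strip L a) g (z.1, a).
Proof.
move=> a0 s1 hi gi dg ch hle g0.
have [_ e1] := integrable_setX_slice (measurable_itv _) (measurable_itv _) hi.
have [_ e2] := integrable_setX_slice (measurable_itv _) (measurable_itv _) gi.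
have [ii _] := integrable_setX_slice (measurable_itv _) (measurable_itv _) hi.
(* The bound $c\,y^s$ makes every slice integrable; Fubini alone would give this for almost every
   $t$ only. *)
have pi : mu.-integrable `]0, a] (EFin \o (fun y => c * expR (s * ln y))).
  rewrite [X in mu.-integrable _ X](_ : _ = (fun y => c%:E * (expR (s * ln y))%:E)%E)//.
  apply: integrableZl => //; apply/integrableP; split.
    apply/measurable_EFinP; apply: (@measurable_funS _ _ _ _ setT) => //.
    apply: measurableT_comp => //.
    by apply: measurable_funM => //; exact: measurable_cst.
  under eq_integral do rewrite /= ger0_norm ?expR_ge0//.
  exact: integral_exp_ln_lty.
have slice t : 0 <= t <= L -> (\int[mu]_(y in `]0%R, a]) (h (t, y))%:E = (g (t, a))%:E)%E.
  move=> tL; apply: (@Rintegral_FTC_itvoc _ (fun y => h (t, y)) (fun y => g (t, y))) => //.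
  - by move=> y y0 ya; exact: dg.
  - by move=> y y0 ya; exact: ch.
  - apply: le_integrable pi => //.
      apply/measurable_EFinP; apply: subspace_continuous_measurable_fun => //.
      apply: continuous_in_subspaceT => y; rewrite inE/= in_itv/= => /andP[h1 h2].
      exact: ch.
    move=> y /=; rewrite in_itv/= => /andP[h1 h2]; rewrite lee_fin.
    by apply: (le_trans (hle t y tL h1 h2)); exact: ler_norm.
  - exact: g0.
have eslice : {in `[0, L]%classic, (fun x => \int[mu]_(y in `]0%R, a]) (EFin \o h) (x, y))%E =1 (fun t => (g (t, a))%:E)}.
  by move=> t; rewrite inE/= in_itv/= => tL; exact: slice.
have gint : mu.-integrable `[0, L] (fun t => (g (t, a))%:E).
  by apply: eq_integrable ii.
rewrite /Rintegral -[a]/(fine a%:E) -fineM//; last first.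
  by apply: integrable_fin_num => //; exact: measurable_strip.
congr fine; rewrite e1 e2.
rewrite [X in (_ * X)%E = _](_ : _ = \int[mu]_(t in `[0%R, L]) (g (t, a))%:E)%E; last first.
  exact: eq_integral.
rewrite -integralZl//; apply: eq_integral => t _ /=.
have mua : mu `]0, a]%classic = a%:E.
  by rewrite lebesgue_measure_itv/= lte_fin a0 -EFinB subr0.
by rewrite [RHS](@integral_cst _ _ _ mu _ _ (g (t, a))%:E)//= mua muleC.
Qed.

End Strip.

(** * Measurability of Lipschitz functions on the strip *)

Section LipschitzMeasurable.
Import Order.TTheory GRing.Theory Num.Theory numFieldNormedType.Exports.
Import mathcomp.algebra_tactics.lra mathcomp.algebra_tactics.ring.
Local Open Scope classical_set_scope.
Local Open Scope ring_scope.
Context {K : realType}.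

Lemma rat_dense_itv (x y t d : K) : x < y -> x <= t -> t <= y -> 0 < d ->
  exists q : rat, [/\ x <= ratr q, ratr q <= y & `|t - ratr q| < d].
Proof.
move=> xy xt ty d0.
have : Num.max x (t - d) < Num.min y (t + d).
  by rewrite lt_min !gt_max xy/=; apply/and3P; split; lra.
move=> /rat_in_itvoo[q]; rewrite in_itv/= gt_max lt_min => /andP[/andP[h1 h2] /andP[h3 h4]].
exists q; split; [exact: ltW|exact: ltW|].
by rewrite ltr_norml; apply/andP; split; lra.
Qed.

(* A Lipschitz function is the supremum of the cones [f q - c |z - q|] over the
   rational points [q], as in McShane's extension theorem. *)
Lemma measurable_lipschitz_strip (f : K * K -> K) (L a c : K) : 0 < L -> 0 < a -> 0 < c ->
  (forall z w, strip L a z -> strip L a w ->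
     `|f z - f w| <= c * (`|z.1 - w.1| + `|z.2 - w.2|)) ->
  measurable_fun (strip L a) f.
Proof.
move=> L0 a0 c0 lip mD; apply: (measurability _ (RGenOInfty.measurableE K)) => //.
move=> /= _ [_ [b ->] <-]; rewrite preimage_itvoy.
pose cone (q1 q2 : rat) (z : K * K) : K :=
  f (ratr q1, ratr q2) - c * (`|z.1 - ratr q1| + `|z.2 - ratr q2|).
have mcone q1 q2 : measurable_fun setT (cone q1 q2).
  apply: measurable_funB; first exact: measurable_cst.
  apply: measurable_funM; first exact: measurable_cst.
  apply: measurable_funD; apply: measurableT_comp => //.
    by apply: measurable_funB; [exact: measurable_fst|exact: measurable_cst].
  by apply: measurable_funB; [exact: measurable_snd|exact: measurable_cst].
rewrite [X in measurable X](_ : _ = \bigcup_(q1 : rat) \bigcup_(q2 : rat)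
   (if (ratr q1, ratr q2) \in strip L a then
     strip L a `&` [set z | b < cone q1 q2 z] else set0)).
  apply: bigcupT_measurable_rat => q1; apply: bigcupT_measurable_rat => q2.
  case: ifPn => // _; rewrite -preimage_itvoy.
  exact: (measurable_funS _ _ (mcone q1 q2)).
apply/seteqP; split=> [z [Dz /= bz]|z [q1 _ [q2 _]]]; last first.
  case: ifPn => // /set_mem Dq [Dz /=]; rewrite /cone => h; split=> //=.
  by have := lip _ _ Dz Dq; rewrite distrC => /(le_trans (ler_norm _)) /=; lra.
have [z1 z2] := Dz; move: z1 z2; rewrite /= !in_itv/= => /andP[z1 z2] /andP[z3 z4].
(* Coordinates within [d] cost $2cd$ in the value at the rational point and $2cd$ in the cone, in
   all four fifths of $f(z)-b$. *)
pose d := (f z - b) / (5 * c).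
have d0 : 0 < d by rewrite divr_gt0 ?mulr_gt0// subr_gt0.
have [q1 [q11 q12 q13]] := rat_dense_itv L0 z1 z2 d0.
(* The lower end $z_2/2>0$ keeps the rational point inside the half-open strip. *)
have z5 : z.2 / 2 <= z.2 by lra.
have z6 : z.2 / 2 < a by lra.
have [q2 [q21 q22 q23]] := rat_dense_itv z6 z5 z4 d0.
exists q1 => //; exists q2 => //.
have Dq : strip L a (ratr q1, ratr q2).
  by split; rewrite /= in_itv/=; apply/andP; split => //; lra.
rewrite mem_set//; split => //=; rewrite /cone.
have := lip _ _ Dz Dq => /= /(le_trans (ler_norm _)) h.
have : c * (`|z.1 - ratr q1| + `|z.2 - ratr q2|) <= c * (2 * d).
  by rewrite ler_pM2l//; lra.
have : c * (2 * d) = (f z - b) * (2 / 5).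
  by rewrite /d; field; rewrite gt_eqF.
by lra.
Qed.

End LipschitzMeasurable.

(** * Integrals and measurability for functions of two Stdlib reals *)

Section StdlibInterface.
Import Order.TTheory GRing.Theory Num.Theory numFieldNormedType.Exports.
Local Open Scope classical_set_scope.
Local Open Scope ring_scope.
Local Notation Rr := (R : realType).
Local Notation mu := (@lebesgue_measure Rr).

(** These wrappers let the later sections combine Lebesgue integrals with Coquelicot derivatives
    without meeting the MathComp structures on [R]. *)
Definition meas2 (D : set (R * R)) (f : R -> R -> R) : Prop :=
  measurable_fun (D : set (Rr * Rr)) ((fun z => f z.1 z.2) : Rr * Rr -> Rr).

Definition II (L a : R) (f : R -> R -> R) : R :=
  Rintegral leb2 (@strip Rr L a) (fun z => f z.1 z.2).

Definition integ (L a : R) (f : R -> R -> R) : Prop :=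
  (mu \x mu)%E.-integrable (@strip Rr L a) (EFin \o ((fun z => f z.1 z.2) : Rr * Rr -> Rr)).

Definition plane : set (R * R) := setT.
Definition rstrip (L a : R) : set (R * R) := @strip Rr L a.

Lemma rstripP L a z : @strip Rr L a z <-> (Rle 0 z.1 /\ Rle z.1 L) /\ (Rlt 0 z.2 /\ Rle z.2 a).
Proof.
split=> [[] /=|[[/RleP h1 /RleP h2] [/RltP h3 /RleP h4]]].
  by rewrite !in_itv/= => /andP[/RleP h1 /RleP h2] /andP[/RltP h3 /RleP h4].
by split; rewrite /= in_itv/=; apply/andP; split.
Qed.

Lemma meas2_cst D c : meas2 D (fun _ _ => c).
Proof. exact: measurable_cst. Qed.

Lemma meas2_add D f g : meas2 D f -> meas2 D g -> meas2 D (fun s t => Rplus (f s t) (g s t)).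
Proof. exact: measurable_funD. Qed.

Lemma meas2_mul D f g : meas2 D f -> meas2 D g -> meas2 D (fun s t => Rmult (f s t) (g s t)).
Proof. exact: measurable_funM. Qed.

Lemma meas2_sub D f g : meas2 D f -> meas2 D g -> meas2 D (fun s t => Rminus (f s t) (g s t)).
Proof. exact: measurable_funB. Qed.

Lemma measurable_continuity (h : R -> R) : (forall x, continuity_pt h x) ->
  measurable_fun (setT : set Rr) (h : Rr -> Rr).
Proof.
by move=> ch; apply: continuous_measurable_fun => x; apply/continuity_pt_cvg.
Qed.

Lemma meas2_continuity D (h : R -> R) f : (forall x, continuity_pt h x) ->
  meas2 D f -> meas2 D (fun s t => h (f s t)).
Proof. by move=> /measurable_continuity mh; exact: measurableT_comp. Qed.

Lemma meas2_ln D f : meas2 D f -> meas2 D (fun s t => Rpower.ln (f s t)).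
Proof.
move=> mf; rewrite /meas2.
under [X in measurable_fun _ X]eq_fun do rewrite RlnE.
exact: (measurableT_comp (@measurable_ln Rr) mf).
Qed.

Lemma meas2_1 D (h : R -> R) : (forall x, continuity_pt h x) -> meas2 D (fun s _ => h s).
Proof.
move=> /measurable_continuity mh; apply: measurableT_comp => //.
by apply: (@measurable_funS _ _ _ _ setT) => //; exact: measurable_fst.
Qed.

Lemma meas2_2 D (h : R -> R) : (forall x, continuity_pt h x) -> meas2 D (fun _ t => h t).
Proof.
move=> /measurable_continuity mh; apply: measurableT_comp => //.
by apply: (@measurable_funS _ _ _ _ setT) => //; exact: measurable_snd.
Qed.

(** Meant for [cpow], which is a smooth expression where the distance is positive and 0 on the
    diagonal. *)
Lemma meas2_if_pos (f g k : R -> R -> R) : meas2 plane f -> meas2 plane g ->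
  (forall s t, Rlt 0 (f s t) -> k s t = g s t) ->
  (forall s t, ~ Rlt 0 (f s t) -> k s t = IZR 0) -> meas2 plane k.
Proof.
move=> mf mg kp kn; rewrite /meas2.
rewrite [X in measurable_fun _ X](_ : _ = (fun z : Rr * Rr => if 0 < (f z.1 z.2 : Rr) then g z.1 z.2 else 0)).
  by apply: measurable_fun_ifT => //; exact: measurable_fun_ltr.
apply/funext => z; case: ifPn => [/RltP/kp //|/RltP]; exact: kn.
Qed.

Lemma meas2_lipschitz L a f c : Rlt 0 L -> Rlt 0 a -> Rlt 0 c ->
  (forall s t s' t', Rle 0 s /\ Rle s L -> Rlt 0 t /\ Rle t a -> Rle 0 s' /\ Rle s' L -> Rlt 0 t' /\ Rle t' a ->
    Rle (Rabs (Rminus (f s t) (f s' t'))) (Rmult c (Rplus (Rabs (Rminus s s')) (Rabs (Rminus t t'))))) ->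
  meas2 (rstrip L a) f.
Proof.
move=> /RltP L0 /RltP a0 /RltP c0 H.
apply: (@measurable_lipschitz_strip Rr _ L a c) => // z w /rstripP[z1 z2] /rstripP[w1 w2].
by have /RleP := H _ _ _ _ z1 z2 w1 w2; rewrite !RabsE.
Qed.

Lemma II_ext L a f g :
  (forall t y, Rle 0 t /\ Rle t L -> Rlt 0 y /\ Rle y a -> f t y = g t y) -> II L a f = II L a g.
Proof.
by move=> fg; apply: eq_Rintegral => z; rewrite inE => /rstripP[h1 h2]; exact: fg.
Qed.

Lemma integ_ext L a f g :
  (forall t y, Rle 0 t /\ Rle t L -> Rlt 0 y /\ Rle y a -> f t y = g t y) -> integ L a f -> integ L a g.
Proof.
move=> fg; apply: eq_integrable; first exact: measurable_strip.
by move=> z; rewrite inE => /rstripP[h1 h2] /=; rewrite fg.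
Qed.

Lemma integ_le L a f g : meas2 (rstrip L a) f -> integ L a g ->
  (forall t y, Rle 0 t /\ Rle t L -> Rlt 0 y /\ Rle y a -> Rle (Rabs (f t y)) (g t y)) -> integ L a f.
Proof.
move=> mf ig fg; apply: le_integrable ig; first exact: measurable_strip.
  exact/measurable_EFinP.
move=> z /rstripP[h1 h2] /=; rewrite lee_fin.
have /RleP := fg _ _ h1 h2; rewrite RabsE => /le_trans; apply; exact: ler_norm.
Qed.

Lemma integ_add L a f g : integ L a f -> integ L a g -> integ L a (fun t y => Rplus (f t y) (g t y)).
Proof. by move=> h1 h2; apply: (integrableD _ h1 h2); exact: measurable_strip. Qed.

Lemma integ_scal L a f c : integ L a f -> integ L a (fun t y => Rmult c (f t y)).
Proof. by move=> h1; apply: (integrableZl _ c h1); exact: measurable_strip. Qed.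

Lemma II_add L a f g : integ L a f -> integ L a g ->
  II L a (fun t y => Rplus (f t y) (g t y)) = Rplus (II L a f) (II L a g).
Proof. by move=> h1 h2; apply: (RintegralD _ h1 h2); exact: measurable_strip. Qed.

Lemma II_scal L a f c : integ L a f ->
  II L a (fun t y => Rmult c (f t y)) = Rmult c (II L a f).
Proof. by move=> h1; apply: (RintegralZl c _ h1); exact: measurable_strip. Qed.

Lemma II_le L a f g : integ L a f -> integ L a g ->
  (forall t y, Rle 0 t /\ Rle t L -> Rlt 0 y /\ Rle y a -> Rle (Rabs (f t y)) (g t y)) ->
  Rle (Rabs (II L a f)) (II L a g).
Proof.
move=> h1 h2 fg; apply/RleP; rewrite RabsE.
apply: (le_trans (le_normr_Rintegral _ h1)); first exact: measurable_strip.
apply: le_Rintegral => //; first exact: measurable_strip.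
  exact: integrable_norm.
by move=> z /rstripP[k1 k2] /=; apply/RleP; rewrite -RabsE; exact: fg.
Qed.

Lemma integ_exp_ln L a s : Rlt (-1) s -> Rlt 0 a -> integ L a (fun _ y => Rtrigo_def.exp (Rmult s (Rpower.ln y))).
Proof.
move=> /RltP s1 /RltP a0; rewrite /integ.
have := @integrable_strip_exp_ln Rr s L a s1 a0.
by under [X in _ -> _.-integrable _ (_ \o X)]eq_fun do rewrite RexpE RlnE.
Qed.

Lemma II_FTC (h g : R -> R -> R) (L a s c : R) : Rlt 0 a -> Rlt (-1) s ->
  integ L a h -> integ L a (fun t _ => g t a) ->
  (forall t y, Rle 0 t /\ Rle t L -> Rlt 0 y /\ Rle y a -> derivable_pt_lim (g t) y (h t y)) ->
  (forall t y, Rle 0 t /\ Rle t L -> Rlt 0 y /\ Rle y a -> continuity_pt (h t) y) ->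
  (forall t y, Rle 0 t /\ Rle t L -> Rlt 0 y /\ Rle y a ->
     Rle (Rabs (h t y)) (Rmult c (Rtrigo_def.exp (Rmult s (Rpower.ln y))))) ->
  (forall t eps, Rle 0 t /\ Rle t L -> Rlt 0 eps -> exists d, Rlt 0 d /\
     forall y, Rlt 0 y -> Rlt y d -> Rlt (Rabs (g t y)) eps) ->
  Rmult a (II L a h) = II L a (fun t _ => g t a).
Proof.
move=> /RltP a0 /RltP s1 hi gi dg ch hle g0.
apply: (@Rintegral_strip_FTC Rr (fun z => h z.1 z.2) (fun z => g z.1 z.2) L a s c) => //.
- move=> t y /andP[/RleP t0 /RleP tL] /RltP y0 /RleP ya /=.
  exact/derivable_pt_lim_is_derive/dg.
- by move=> t y /andP[/RleP t0 /RleP tL] /RltP y0 /RleP ya; apply/continuity_pt_cvg; exact: ch.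
- move=> t y /andP[/RleP t0 /RleP tL] /RltP y0 /RleP ya /=.
  by have /RleP := hle t y (conj t0 tL) (conj y0 ya); rewrite RabsE RexpE RlnE.
- move=> t /andP[/RleP t0 /RleP tL]; apply/cvgrPdist_lt => /= e /RltP e0.
  have [d [/RltP d0 Hd]] := g0 t e (conj t0 tL) e0.
  near=> n; rewrite sub0r normrN -RabsE; apply/RltP; apply: Hd; apply/RltP.
    by rewrite divr_gt0.
  rewrite ltr_pdivrMr// mulrC -ltr_pdivrMr//.
  apply: (@lt_trans _ _ n%:R); last by rewrite ltr_nat.
  near: n; exact: nbhs_infty_gtr.
Unshelve. all: by end_near. Qed.

(** The nonnegative case is applied to the positive and the negative part; integrability on the half
    strip makes both finite, so that they can be subtracted. *)
Lemma Rintegral_square_symmetric (G : R -> R -> R) (L : R) : Rlt 0 L -> meas2 plane G ->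
  (forall x y, G (Rplus x L) y = G x y) -> (forall x y, G x y = G y x) ->
  integ L (Rdiv L 2) (fun t y => G (Rplus t (Rdiv y 2)) (Rminus t (Rdiv y 2))) ->
  Rintegral leb2 (square L) (fun z => G z.1 z.2) =
  Rmult 2 (II L (Rdiv L 2) (fun t y => G (Rplus t (Rdiv y 2)) (Rminus t (Rdiv y 2)))).
Proof.
move=> /RltP L0 mG G1 Gsym iG.
have G2 x y : G x (Rplus y L) = G x y by rewrite Gsym G1 Gsym.
pose f : Rr * Rr -> \bar Rr := EFin \o (fun z => G z.1 z.2).
have mf : measurable_fun setT f by exact/measurable_EFinP.
have ep := @ge0_integral_square_symmetric Rr (f^\+)%E L L0 (measurable_funepos mf).
have en := @ge0_integral_square_symmetric Rr (f^\-)%E L L0 (measurable_funeneg mf).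
have hp z w : f z = f w -> (f^\+ z = f^\+ w)%E by move=> e; rewrite !funeposE e.
have hn z w : f z = f w -> (f^\- z = f^\- w)%E by move=> e; rewrite !funenegE e.
have h1 x y : f (x + L, y) = f (x, y) by congr EFin; exact: G1.
have h2 x y : f (x, y + L) = f (x, y) by congr EFin; exact: G2.
have h3 x y : f (x, y) = f (y, x) by congr EFin; exact: Gsym.
have {}ep := ep (fun z => funepos_ge0 _ z) (fun x y => hp _ _ (h1 x y)) (fun x y => hp _ _ (h2 x y)) (fun x y => hp _ _ (h3 x y)).
have {}en := en (fun z => funeneg_ge0 _ z) (fun x y => hn _ _ (h1 x y)) (fun x y => hn _ _ (h2 x y)) (fun x y => hn _ _ (h3 x y)).
pose g : Rr * Rr -> \bar Rr := EFin \o (fun z => G (z.1 + z.2 / 2) (z.1 - z.2 / 2)).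
have eg : II L (Rdiv L 2) (fun t y => G (Rplus t (Rdiv y 2)) (Rminus t (Rdiv y 2))) =
   fine (\int[mu \x mu]_(z in `[0%R, L] `*` `]0%R, (L / 2)%R]) g z)%E by [].
rewrite eg; transitivity (fine (\int[mu \x mu]_(z in `[0%R, L] `*` `[0%R, L]) f z)%E) => //.
have ig : (mu \x mu)%E.-integrable (`[0%R, L] `*` `]0%R, (L / 2)%R]) g by [].
have fp : (\int[mu \x mu]_(z in `[0%R, L] `*` `]0%R, (L / 2)%R]) g^\+ z)%E \is a fin_num.
  by apply: (integrable_pos_fin_num _ ig); exact: measurable_strip.
have fn : (\int[mu \x mu]_(z in `[0%R, L] `*` `]0%R, (L / 2)%R]) g^\- z)%E \is a fin_num.
  by apply: (integrable_neg_fin_num _ ig); exact: measurable_strip.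
rewrite [in LHS]integralE [in RHS]integralE ep en.
have -> : (\int[mu \x mu]_(z in `[0%R, L] `*` `]0%R, (L / 2)%R]) f^\+ ((z.1 + z.2 / 2)%R, (z.1 - z.2 / 2)%R) =
  \int[mu \x mu]_(z in `[0%R, L] `*` `]0%R, (L / 2)%R]) g^\+ z)%E.
  by apply: eq_integral => z _; rewrite !funeposE.
have -> : (\int[mu \x mu]_(z in `[0%R, L] `*` `]0%R, (L / 2)%R]) f^\- ((z.1 + z.2 / 2)%R, (z.1 - z.2 / 2)%R) =
  \int[mu \x mu]_(z in `[0%R, L] `*` `]0%R, (L / 2)%R]) g^\- z)%E.
  by apply: eq_integral => z _; rewrite !funenegE.
rewrite -muleBr//; last by rewrite fin_num_adde_defl// fin_numN.
by rewrite fineM// fin_numB fp fn.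
Qed.

Lemma cpow_pos d (z : Complex.C) : Rlt 0 d ->
  cpow d z = (Rmult (Rtrigo_def.exp (Rmult z.1 (Rpower.ln d))) (Rtrigo_def.cos (Rmult z.2 (Rpower.ln d))),
              Rmult (Rtrigo_def.exp (Rmult z.1 (Rpower.ln d))) (Rtrigo_def.sin (Rmult z.2 (Rpower.ln d)))).
Proof.
move=> d0; rewrite /cpow; case: (Rlt_dec 0 d) => // d0'.
by have [-> ->] := trigo_RE (Rmult z.2 (ln d)); rewrite RlnE.
Qed.

Lemma cpow_npos d (z : Complex.C) : ~ Rlt 0 d -> cpow d z = (IZR 0, IZR 0).
Proof. by move=> d0; rewrite /cpow; case: Rlt_dec. Qed.

(** Of the angle, only what preserves the Hermitian form is retained. *)
Lemma rotationE th : exists c s : R, Rplus (pow c 2) (pow s 2) = IZR 1 /\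
  (forall p, rotation th (Some p) =
    Some ((Rminus (Rmult c (px p)) (Rmult s (py p)), Rplus (Rmult s (px p)) (Rmult c (py p))), pu p)).
Proof.
by exists (trigo.cos th), (trigo.sin th); split=> //; rewrite !RpowE; exact: cos2Dsin2.
Qed.

Lemma beta_symmetric (delta : R -> pt) (L : R) (z : Complex.C) (G0 G1 : R -> R -> R) : Rlt 0 L ->
  (forall s t, Rmult (Rmult (fst (cpow (kdist (delta s) (delta t)) z)) (speed delta s)) (speed delta t) = G0 s t) ->
  (forall s t, Rmult (Rmult (snd (cpow (kdist (delta s) (delta t)) z)) (speed delta s)) (speed delta t) = G1 s t) ->
  meas2 plane G0 -> meas2 plane G1 ->
  (forall s t, G0 (Rplus s L) t = G0 s t) -> (forall s t, G1 (Rplus s L) t = G1 s t) ->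
  (forall s t, G0 s t = G0 t s) -> (forall s t, G1 s t = G1 t s) ->
  integ L (Rdiv L 2) (fun t y => G0 (Rplus t (Rdiv y 2)) (Rminus t (Rdiv y 2))) ->
  integ L (Rdiv L 2) (fun t y => G1 (Rplus t (Rdiv y 2)) (Rminus t (Rdiv y 2))) ->
  beta delta L z =
  (Rmult 2 (II L (Rdiv L 2) (fun t y => G0 (Rplus t (Rdiv y 2)) (Rminus t (Rdiv y 2)))),
   Rmult 2 (II L (Rdiv L 2) (fun t y => G1 (Rplus t (Rdiv y 2)) (Rminus t (Rdiv y 2))))).
Proof.
move=> L0 e0 e1 m0 m1 p0 p1 s0 s1 i0 i1; rewrite /beta.
rewrite -(Rintegral_square_symmetric L0 m0 p0 s0 i0) -(Rintegral_square_symmetric L0 m1 p1 s1 i1).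
by congr pair; apply: eq_Rintegral => st _; [rewrite -e0|rewrite -e1].
Qed.

End StdlibInterface.

End PlaneIntegration.
Import PlaneIntegration.

(** * Even functions *)

Section EvenSmooth.
Import Coquelicot.
Local Open Scope R_scope.

(** The range of $y$ is open and contains 0, so that regularity holds across the diagonal although
    the integrals involve only $y>0$. *)
Definition dom (L b t y : R) : Prop := 0 <= t <= L /\ Rabs y < b.

(** The joint Lipschitz bound supplies measurability on the strip, continuity in $y$ and the
    compactness argument for lower bounds. *)
Definition lipb (L b : R) (f : R -> R -> R) : Prop :=
  exists c, 0 < c /\ (forall t y, dom L b t y -> Rabs (f t y) <= c) /\
    (forall t y t' y', dom L b t y -> dom L b t' y' ->
       Rabs (f t y - f t' y') <= c * (Rabs (t - t') + Rabs (y - y'))).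

(* [f'(y) / y], completed by its limit at [y = 0] (a junk value when there is none). *)
Definition Dq (f : R -> R -> R) (t y : R) : R :=
  if Req_EM_T y 0 then real (Lim (fun y => Derive (f t) y / y) 0) else Derive (f t) y / y.

(* Evenness and regularity in [y] to order [n], through the operator [Dq] which preserves
   even functions; it lowers the order of the singularity in each integration by parts. *)
Fixpoint ES (L b : R) (n : nat) (f : R -> R -> R) : Prop :=
  lipb L b f /\
  match n with
  | O => True
  | S n => (forall t y, dom L b t y -> is_derive (f t) y (y * Dq f t y)) /\ ES L b n (Dq f)
  end.

Lemma dom_open L b t y : dom L b t y -> locally y (fun z => dom L b t z).
Proof.
move=> [ht hy]; have h : 0 < b - Rabs y by lra.
have key (z : R) : Rabs (z - y) < b - Rabs y -> dom L b t z.
  move=> hz; split=> //; have -> : z = (z - y) + y by ring.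
  by apply: Rle_lt_trans (Rabs_triang _ _) _; lra.
by exists (mkposreal _ h) => z; exact: key.
Qed.

Lemma lipb_ext L b f g : (forall t y, dom L b t y -> f t y = g t y) -> lipb L b f -> lipb L b g.
Proof.
move=> fg [c [c0 [h1 h2]]]; exists c; split=> //; split.
  by move=> t y d; rewrite -fg //; exact: h1.
by move=> t y t' y' d d'; rewrite -!fg //; exact: h2.
Qed.

Lemma lipb_continuous L b f t y : lipb L b f -> dom L b t y -> continuous (f t) y.
Proof.
move=> [c [c0 [h1 h2]]] d; apply continuity_pt_filterlim.
have [e He] := dom_open d.
move=> eps eps0; exists (Rmin e (eps / (2 * c))); split.
  apply: Rmin_pos; first exact: cond_pos.
  by apply: Rdiv_lt_0_compat; lra.
move=> z [_ hz]; rewrite /= /Rdist in hz; rewrite /= /Rdist.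
have hz1 : Rabs (z - y) < e by apply: Rlt_le_trans hz (Rmin_l _ _).
have hz2 : Rabs (z - y) < eps / (2 * c) by apply: Rlt_le_trans hz (Rmin_r _ _).
have := h2 t z t y (He _ hz1) d; rewrite Rminus_diag Rabs_R0 Rplus_0_l => h.
apply: Rle_lt_trans h _.
apply: Rlt_le_trans (Rmult_lt_compat_l _ _ _ c0 hz2) _.
by have -> : c * (eps / (2 * c)) = eps / 2; [field|]; lra.
Qed.

(** For $y\neq0$ this is division by $y$; at 0 the limit in [Dq] is that of [g], which is
    continuous. *)
Lemma Dq_eq L b f g t y : lipb L b g ->
  (forall t y, dom L b t y -> is_derive (f t) y (y * g t y)) -> dom L b t y -> Dq f t y = g t y.
Proof.
move=> lg df d; rewrite /Dq; case: (Req_EM_T y 0) => hy /=; last first.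
  by rewrite (is_derive_unique _ _ _ (df _ _ d)); field.
subst y; rewrite (is_lim_unique _ _ (Finite (g t 0))) //.
apply: (is_lim_ext_loc (g t)); last first.
  by apply: is_lim_continuity; apply continuity_pt_filterlim; apply: lipb_continuous lg d.
have [e He] := dom_open d; exists e => z hz z0.
by rewrite (is_derive_unique _ _ _ (df _ _ (He _ hz))); field.
Qed.

Lemma ES_lipb L b n f : ES L b n f -> lipb L b f.
Proof. by case: n => [|n] []. Qed.

(** The joint induction is forced: extensionality at order [n.+1] is introduction at order [n] with
    [Dq f] as the quotient of [g], and introduction at order [n.+1] uses that extensionality to
    replace [g] by [Dq f]. *)
Lemma ES_intro_ext L b n :
  (forall f g, (forall t y, dom L b t y -> f t y = g t y) -> ES L b n f -> ES L b n g) /\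
  (forall f g, lipb L b f -> (forall t y, dom L b t y -> is_derive (f t) y (y * g t y)) ->
     ES L b n g -> ES L b n.+1 f).
Proof.
elim: n => [|n [IHe IHi]].
  have ext0 f g : (forall t y, dom L b t y -> f t y = g t y) -> ES L b 0 f -> ES L b 0 g.
    by move=> fg [lf _]; split=> //; apply: lipb_ext lf.
  split=> // f g lf df eg; split=> //; split.
    by move=> t y d; rewrite (Dq_eq (ES_lipb eg) df d); exact: df.
  by apply: (ext0 g) (eg) => t y d; rewrite (Dq_eq (ES_lipb (n := 0) eg) df d).
have extS f g : (forall t y, dom L b t y -> f t y = g t y) -> ES L b n.+1 f -> ES L b n.+1 g.
  move=> fg [lf [df ef]]; apply: (IHi g (Dq f)) => //; first exact: lipb_ext lf.
  move=> t y d; apply: is_derive_ext_loc (df _ _ d).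
  by apply: filter_imp (dom_open d) => z dz; exact: fg.
split=> // f g lf df eg; split=> //; split.
  by move=> t y d; rewrite (Dq_eq (ES_lipb eg) df d); exact: df.
by apply: (extS g) (eg) => t y d; rewrite (Dq_eq (ES_lipb (n := n.+1) eg) df d).
Qed.

Lemma ES_ext L b n f g : (forall t y, dom L b t y -> f t y = g t y) -> ES L b n f -> ES L b n g.
Proof. exact: (proj1 (ES_intro_ext L b n)). Qed.

Lemma ES_intro L b n f g : lipb L b f ->
  (forall t y, dom L b t y -> is_derive (f t) y (y * g t y)) ->
  ES L b n g -> ES L b n.+1 f.
Proof. exact: (proj2 (ES_intro_ext L b n)). Qed.

Lemma ES_le L b n f : ES L b n.+1 f -> ES L b n f.
Proof.
elim: n f => [|n IH] f [lf [df ef]]; first by split.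
by split=> //; split=> //; exact: IH.
Qed.

Lemma lipb_add L b f g : lipb L b f -> lipb L b g -> lipb L b (fun t y => f t y + g t y).
Proof.
move=> [c [c0 [h1 h2]]] [c' [c0' [h1' h2']]]; exists (c + c'); split; first lra.
split=> [t y d|t y t' y' d d'].
  by have := h1 _ _ d; have := h1' _ _ d; have := Rabs_triang (f t y) (g t y); lra.
have := h2 _ _ _ _ d d'; have := h2' _ _ _ _ d d'.
have := Rabs_triang (f t y - f t' y') (g t y - g t' y').
have -> : f t y - f t' y' + (g t y - g t' y') = f t y + g t y - (f t' y' + g t' y') by ring.
lra.
Qed.

Lemma lipb_mul L b f g : lipb L b f -> lipb L b g -> lipb L b (fun t y => f t y * g t y).
Proof.
move=> [c [c0 [h1 h2]]] [c' [c0' [h1' h2']]]; exists (2 * (c * c')); split; first nra.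
split=> [t y d|t y t' y' d d'].
  rewrite Rabs_mult.
  have := Rmult_le_compat _ _ _ _ (Rabs_pos _) (Rabs_pos _) (h1 _ _ d) (h1' _ _ d).
  by nra.
have -> : f t y * g t y - f t' y' * g t' y' =
  (f t y - f t' y') * g t y + f t' y' * (g t y - g t' y') by ring.
apply: Rle_trans (Rabs_triang _ _) _; rewrite !Rabs_mult.
have := Rmult_le_compat _ _ _ _ (Rabs_pos _) (Rabs_pos _) (h2 _ _ _ _ d d') (h1' _ _ d).
have := Rmult_le_compat _ _ _ _ (Rabs_pos _) (Rabs_pos _) (h1 _ _ d') (h2' _ _ _ _ d d').
by nra.
Qed.

Lemma lipb_comp L b (phi dphi : R -> R) f (m M k : R) : lipb L b f -> 0 <= k ->
  (forall t y, dom L b t y -> m <= f t y <= M) ->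
  (forall x, m <= x <= M -> is_derive phi x (dphi x) /\ Rabs (dphi x) <= k) ->
  lipb L b (fun t y => phi (f t y)).
Proof.
move=> [c [c0 [h1 h2]]] k0 hm hphi.
have key x x' : m <= x <= M -> m <= x' <= M -> Rabs (phi x - phi x') <= k * Rabs (x - x').
  move=> hx hx'.
  have bd z : Rmin x' x <= z <= Rmax x' x -> m <= z <= M.
    move: (Rmin_glb _ _ m (proj1 hx') (proj1 hx)) (Rmax_lub _ _ M (proj2 hx') (proj2 hx)); lra.
  have [||z [hz ->]] := MVT_gen phi x' x dphi.
  - by move=> z hz; apply: (proj1 (hphi z _)); apply: bd; lra.
  - move=> z hz; apply continuity_pt_filterlim; apply: ex_derive_continuous.
    by exists (dphi z); apply: (proj1 (hphi z _)); exact: bd.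
  rewrite Rabs_mult; apply: Rmult_le_compat_r; first exact: Rabs_pos.
  by apply: (proj2 (hphi z _)); exact: bd.
(* The first two terms bound the values, the third is the Lipschitz constant, and 1 makes the sum
   positive. *)
exists (Rabs (phi m) + k * Rabs (M - m) + k * c + 1).
have ? := Rabs_pos (phi m); have ? := Rabs_pos (M - m); split; first nra.
split=> [t y d|t y t' y' d d'].
  have hf := hm _ _ d.
  have hmm : m <= m <= M by lra.
  have := key _ _ hf hmm; have := Rabs_triang (phi (f t y) - phi m) (phi m).
  have -> : phi (f t y) - phi m + phi m = phi (f t y) by ring.
  have : Rabs (f t y - m) <= Rabs (M - m) by rewrite !Rabs_pos_eq; lra.
  by nra.
have := key _ _ (hm _ _ d) (hm _ _ d'); have := h2 _ _ _ _ d d'.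
have := Rabs_pos (t - t'); have := Rabs_pos (y - y'); have := Rabs_pos (f t y - f t' y').
move=> p1 p2 p3 q1 q2; apply: Rle_trans q2 _.
apply: Rle_trans (Rmult_le_compat_l _ _ _ k0 q1) _.
rewrite -Rmult_assoc; apply: Rmult_le_compat_r; nra.
Qed.

Lemma lipb_cst L b c : lipb L b (fun _ _ => c).
Proof.
exists (Rabs c + 1); have ? := Rabs_pos c; split; first lra.
split=> [t y d|t y t' y' d d']; first lra.
rewrite Rminus_diag Rabs_R0; have := Rabs_pos (t - t'); have := Rabs_pos (y - y'); nra.
Qed.

Lemma ES_cst L b n c : ES L b n (fun _ _ => c).
Proof.
elim: n c => [|n IH] c; first by split=> //; exact: lipb_cst.
apply: (ES_intro (g := fun _ _ => 0)) => //; first exact: lipb_cst.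
by move=> t y d; rewrite Rmult_0_r; exact: is_derive_const.
Qed.

Lemma ES_add L b n f g : ES L b n f -> ES L b n g -> ES L b n (fun t y => f t y + g t y).
Proof.
elim: n f g => [|n IH] f g; first by move=> [lf _] [lg _]; split=> //; exact: lipb_add.
move=> [lf [df ef]] [lg [dg eg]].
apply: (ES_intro (g := fun t y => Dq f t y + Dq g t y)); first exact: lipb_add.
  move=> t y d; rewrite Rmult_plus_distr_l.
  exact: (is_derive_plus _ _ _ _ _ (df _ _ d) (dg _ _ d)).
exact: IH.
Qed.

Lemma ES_mul L b n f g : ES L b n f -> ES L b n g -> ES L b n (fun t y => f t y * g t y).
Proof.
elim: n f g => [|n IH] f g; first by move=> [lf _] [lg _]; split=> //; exact: lipb_mul.
move=> ef' eg'; have [lf [df ef]] := ef'; have [lg [dg eg]] := eg'.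
apply: (ES_intro (g := fun t y => Dq f t y * g t y + f t y * Dq g t y)); first exact: lipb_mul.
  move=> t y d.
  have -> : y * (Dq f t y * g t y + f t y * Dq g t y) =
     (y * Dq f t y) * g t y + f t y * (y * Dq g t y) by ring.
  exact: (is_derive_mult _ _ _ _ _ (df _ _ d) (dg _ _ d) Rmult_comm).
by apply: ES_add; apply: IH => //; exact: ES_le.
Qed.

Lemma ES_scal L b n c f : ES L b n f -> ES L b n (fun t y => c * f t y).
Proof. by move=> ef; apply: ES_mul => //; exact: ES_cst. Qed.

Lemma ES_opp L b n f : ES L b n f -> ES L b n (fun t y => - f t y).
Proof. by move=> /(ES_scal (-1)); apply: ES_ext => t y _; ring. Qed.

Lemma ES_sub L b n f g : ES L b n f -> ES L b n g -> ES L b n (fun t y => f t y - g t y).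
Proof. by move=> ef eg; apply: ES_add => //; exact: ES_opp. Qed.

Lemma lipb_bounds L b f : lipb L b f -> exists c, 0 < c /\ forall t y, dom L b t y -> - c <= f t y <= c.
Proof.
move=> [c [c0 [h1 _]]]; exists c; split=> // t y d.
by apply/Rabs_le_between; exact: h1.
Qed.

Lemma ES_exp L b n f : ES L b n f -> ES L b n (fun t y => exp (f t y)).
Proof.
have lip g : lipb L b g -> lipb L b (fun t y => exp (g t y)).
  move=> lg; have [c [c0 hc]] := lipb_bounds lg.
  apply: (lipb_comp (dphi := exp) (k := exp c) lg _ hc); first exact: Rlt_le (exp_pos _).
  move=> x hx; split; first exact: is_derive_exp.
  rewrite Rabs_pos_eq; last exact: Rlt_le (exp_pos _).
  by case: (Req_dec x c) => [->|?]; [right|left; apply: exp_increasing; lra].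
elim: n f => [|n IH] f; first by move=> [lf _]; split=> //; exact: lip.
move=> ef'; have [lf [df ef]] := ef'.
apply: (ES_intro (g := fun t y => exp (f t y) * Dq f t y)); first exact: lip.
  move=> t y d; have := is_derive_comp exp (f t) y _ _ (is_derive_exp _) (df _ _ d).
  rewrite /scal /= /mult /=.
  by have -> : y * Dq f t y * exp (f t y) = y * (exp (f t y) * Dq f t y) by ring.
by apply: ES_mul => //; apply: IH; exact: ES_le.
Qed.

Lemma ES_inv L b n f m : 0 < m -> (forall t y, dom L b t y -> m <= f t y) ->
  ES L b n f -> ES L b n (fun t y => / f t y).
Proof.
move=> m0 fm.
have lip : lipb L b f -> lipb L b (fun t y => / f t y).
  move=> lg; have [c [c0 hc]] := lipb_bounds lg.
  apply: (lipb_comp (phi := Rinv) (dphi := fun x => - / x ^ 2) (k := / m ^ 2) (m := m) (M := c) lg).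
  - by left; apply: Rinv_0_lt_compat; nra.
  - by move=> t y d; split; [exact: fm|have := hc _ _ d; lra].
  - move=> x hx; split.
      by auto_derive; [lra|field; lra].
    rewrite Rabs_Ropp Rabs_pos_eq; last by left; apply: Rinv_0_lt_compat; nra.
    by apply: Rinv_le_contravar; nra.
elim: n => [|n IH]; first by move=> [lf _]; split=> //; exact: lip.
move=> ef'; have [lf [df ef]] := ef'.
apply: (ES_intro (g := fun t y => - (/ f t y * / f t y * Dq f t y))); first exact: lip.
  move=> t y d; have fty := fm _ _ d.
  have := is_derive_inv (f t) y _ (df _ _ d).
  have -> : - (y * Dq f t y) / f t y ^ 2 = y * - (/ f t y * / f t y * Dq f t y) by field; lra.
  by apply; lra.
have ei := IH (ES_le ef'); apply: ES_opp; apply: ES_mul => //.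
exact: ES_mul.
Qed.

Lemma ES_ln L b n f m : 0 < m -> (forall t y, dom L b t y -> m <= f t y) ->
  ES L b n f -> ES L b n (fun t y => ln (f t y)).
Proof.
move=> m0 fm.
have lip : lipb L b f -> lipb L b (fun t y => ln (f t y)).
  move=> lg; have [c [c0 hc]] := lipb_bounds lg.
  apply: (lipb_comp (phi := ln) (dphi := fun x => / x) (k := / m) (m := m) (M := c) lg).
  - by left; apply: Rinv_0_lt_compat.
  - by move=> t y d; split; [exact: fm|have := hc _ _ d; lra].
  - move=> x hx; split.
      by auto_derive; [lra|field; lra].
    rewrite Rabs_pos_eq; last by left; apply: Rinv_0_lt_compat; lra.
    by apply: Rinv_le_contravar; lra.
case: n => [|n]; first by move=> [lf _]; split=> //; exact: lip.
move=> ef'; have [lf [df ef]] := ef'.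
apply: (ES_intro (g := fun t y => / f t y * Dq f t y)); first exact: lip.
  move=> t y d; have fty := fm _ _ d.
  have hl : is_derive ln (f t y) (/ f t y) by auto_derive; [lra|field; lra].
  have := is_derive_comp ln (f t) y _ _ hl (df _ _ d).
  rewrite /scal /= /mult /=.
  by have -> : y * Dq f t y * / f t y = y * (/ f t y * Dq f t y) by ring.
by apply: ES_mul => //; apply: ES_inv m0 fm (ES_le ef').
Qed.

End EvenSmooth.

(** * Hadamard means of even functions *)

Section HadamardMean.
Import Coquelicot.
Local Open Scope R_scope.

(** The quotient in Hadamard's lemma: if $F(0)=0$ and $F'(y)=y^m f(y)$, then $F(y)=y^{m+1}\int_0^1
    s^m f(sy)\,ds$. *)
Definition J (m : nat) (f : R -> R -> R) (t y : R) : R := RInt (fun s => s ^ m * f t (s * y)) 0 1.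

Lemma dom_scale L b t y s : dom L b t y -> 0 <= s <= 1 -> dom L b t (s * y).
Proof.
move=> [ht hy] hs; split=> //; rewrite Rabs_mult (Rabs_pos_eq s); last lra.
have := Rabs_pos y; nra.
Qed.

Lemma J_cont L b m f t y s : lipb L b f -> dom L b t y -> 0 <= s <= 1 ->
  continuous (fun s => s ^ m * f t (s * y)) s.
Proof.
move=> lf d hs; apply: (continuous_mult (K := R_AbsRing) (fun s => s ^ m) (fun s => f t (s * y))).
  by apply: ex_derive_continuous; auto_derive.
apply: (continuous_comp (fun s => s * y) (f t)).
  by apply: ex_derive_continuous; auto_derive.
by apply: lipb_continuous lf _; exact: dom_scale.
Qed.

Lemma J_ex L b m f t y : lipb L b f -> dom L b t y ->
  ex_RInt (fun s => s ^ m * f t (s * y)) 0 1.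
Proof.
move=> lf d; apply: ex_RInt_continuous => s; rewrite Rmin_left ?Rmax_right; try lra.
exact: J_cont lf d.
Qed.

Lemma RInt_abs_le (h : R -> R) (c : R) : ex_RInt h 0 1 ->
  (forall s, 0 <= s <= 1 -> Rabs (h s) <= c) -> Rabs (RInt h 0 1) <= c.
Proof.
move=> eh hc; have := abs_RInt_le_const h 0 1 c (Rle_0_1) eh hc.
by rewrite Rminus_0_r Rmult_1_l.
Qed.

Lemma pow_le_1 s m : 0 <= s <= 1 -> 0 <= s ^ m <= 1.
Proof.
move=> hs; elim: m => [|m IH] /=; first lra.
by nra.
Qed.

Lemma lipb_J L b m f : lipb L b f -> lipb L b (J m f).
Proof.
move=> lf; have [c [c0 [h1 h2]]] := lf; exists c; split=> //; split.
  move=> t y d; apply: RInt_abs_le; first exact: J_ex lf d.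
  move=> s hs; rewrite Rabs_mult; have := h1 _ _ (dom_scale d hs).
  have := pow_le_1 m hs; have := Rabs_pos (f t (s * y)) => p1 p2 p3.
  by rewrite (Rabs_pos_eq (s ^ m)); [nra|lra].
move=> t y t' y' d d'.
have := RInt_minus (V := R_CompleteNormedModule) _ _ 0 1 (J_ex m lf d) (J_ex m lf d').
rewrite /J {2}/minus /plus /opp /= => e; rewrite {1}/Rminus -e.
apply: RInt_abs_le.
  by apply: (ex_RInt_minus (V := R_NormedModule)); [exact: J_ex lf d|exact: J_ex lf d'].
move=> s hs; rewrite /minus /plus /opp /=.
have -> : s ^ m * f t (s * y) + - (s ^ m * f t' (s * y')) = s ^ m * (f t (s * y) - f t' (s * y')) by ring.
rewrite Rabs_mult; have := h2 _ _ _ _ (dom_scale d hs) (dom_scale d' hs).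
have := pow_le_1 m hs; rewrite (Rabs_pos_eq (s ^ m)); last by have := pow_le_1 m hs; lra.
have -> : s * y - s * y' = s * (y - y') by ring.
rewrite Rabs_mult (Rabs_pos_eq s); last lra.
have := Rabs_pos (y - y'); have := Rabs_pos (t - t'); have := Rabs_pos (f t (s * y) - f t' (s * y')).
move=> p1 p2 p3 p4 p5.
have : s * Rabs (y - y') <= Rabs (y - y') by nra.
nra.
Qed.

(** The chain rule contributes one factor $s$ and the derivative $sy\,g(t,sy)$ a second one, so the
    weight rises by two. *)
Lemma is_derive_J L b m f g t y : lipb L b f -> lipb L b g ->
  (forall t y, dom L b t y -> is_derive (f t) y (y * g t y)) -> dom L b t y ->
  is_derive (J m f t) y (y * J (m + 2) g t y).
Proof.
move=> lf lg df d.
have dd (u s : R) : dom L b t (s * u) -> is_derive (fun u => s ^ m * f t (s * u)) u (u * (s ^ (m + 2) * g t (s * u))).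
  move=> du; have := df _ _ du => dfu.
  have h : is_derive (fun u => s * u) u s by auto_derive => //; ring.
  have := is_derive_scal _ _ (s ^ m) _ (is_derive_comp (f t) _ u _ _ dfu h).
  rewrite /scal /= /mult /= pow_add.
  by have -> : s ^ m * (s * (s * u * g t (s * u))) = u * (s ^ m * s ^ 2 * g t (s * u)) by ring.
have := is_derive_RInt_param (fun u s => s ^ m * f t (s * u)) 0 1 y.
rewrite Rmin_left ?Rmax_right; try lra.
have -> : RInt (fun s => Derive (fun u => s ^ m * f t (s * u)) y) 0 1 = y * J (m + 2) g t y.
  have := RInt_scal (V := R_CompleteNormedModule) _ 0 1 y (J_ex (m + 2) lg d).
  rewrite /J /scal /= /mult /= => <-.
  apply: RInt_ext => s; rewrite Rmin_left ?Rmax_right; try lra.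
  move=> hs; apply: is_derive_unique; apply: dd; apply: dom_scale => //; lra.
apply.
- apply: filter_imp (dom_open d) => u du s hs.
  by eexists; apply: dd; exact: dom_scale.
- move=> s hs.
  have ds := dom_scale d hs.
  apply: (continuity_2d_pt_ext_loc (fun u v => u * (v ^ (m + 2) * g t (v * u)))).
    have [e He] := dom_open ds.
    have : continuity_2d_pt (fun u v => v * u) y s.
      by apply: continuity_2d_pt_mult; [exact: continuity_2d_pt_id2|exact: continuity_2d_pt_id1].
    move=> /(_ e)[e' He']; exists e' => u v hu hv.
    symmetry; apply: is_derive_unique; apply: dd; apply: He.
    exact: He'.
  apply: continuity_2d_pt_mult; first exact: continuity_2d_pt_id1.
  apply: continuity_2d_pt_mult.
    apply: (continuity_1d_2d_pt_comp (fun v => v ^ (m + 2)) (fun _ v => v)).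
      by apply continuity_pt_filterlim; apply: ex_derive_continuous; auto_derive.
    exact: continuity_2d_pt_id2.
  apply: (continuity_1d_2d_pt_comp (g t) (fun u v => v * u)).
    by apply continuity_pt_filterlim; exact: lipb_continuous lg ds.
  by apply: continuity_2d_pt_mult; [exact: continuity_2d_pt_id2|exact: continuity_2d_pt_id1].
- apply: filter_imp (dom_open d) => u du; exact: J_ex lf du.
Qed.

Lemma ES_J L b n m f : ES L b n f -> ES L b n (J m f).
Proof.
elim: n m f => [|n IH] m f; first by move=> [lf _]; split=> //; exact: lipb_J.
move=> [lf [df ef]]; apply: (ES_intro (g := J (m + 2) (Dq f))); first exact: lipb_J.
  by move=> t y d; apply: is_derive_J lf (ES_lipb ef) df d.
exact: IH.
Qed.

End HadamardMean.

(** * Sums, difference quotients and products at $t\pm y/2$ *)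

Section MidpointPairs.
Import Coquelicot.
Local Open Scope R_scope.

Lemma smooth_Derive h : smooth h -> smooth (Derive h).
Proof.
move=> sh n t; have := sh n.+1 t.
case: n => [|n] //=; apply: ex_derive_ext => u.
by have := Derive_n_comp h n 1 u; rewrite PeanoNat.Nat.add_1_r => e; symmetry; exact: e.
Qed.

Lemma smooth_ex h t : smooth h -> ex_derive h t.
Proof. by move=> /(_ 1%nat t). Qed.

Lemma smooth_is_derive h t : smooth h -> is_derive h t (Derive h t).
Proof. by move=> sh; apply: Derive_correct; exact: smooth_ex. Qed.

Lemma smooth_continuous h t : smooth h -> continuous h t.
Proof. by move=> sh; apply: ex_derive_continuous; exact: smooth_ex. Qed.

Lemma smooth_bounded h A B : smooth h -> A <= B -> exists c, 0 < c /\ forall t, A <= t <= B -> Rabs (h t) <= c.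
Proof.
move=> sh AB.
have ch t : A <= t <= B -> continuity_pt (fun t => Rabs (h t)) t.
  move=> _; apply: continuity_pt_comp; last exact: Rcontinuity_abs.
  by apply continuity_pt_filterlim; exact: smooth_continuous.
have [M [HM _]] := continuity_ab_maj _ _ _ AB ch.
exists (Rabs (h M) + 1); split; first by have := Rabs_pos (h M); lra.
by move=> t ht; have := HM t ht; lra.
Qed.

Definition Ep (h : R -> R) (t y : R) : R := h (t + y / 2) + h (t - y / 2).
(* The difference quotient [(h (t + y / 2) - h (t - y / 2)) / y], even in [y], in the
   integral form of Hadamard's lemma, which makes sense at [y = 0]. *)
Definition Od (h : R -> R) (t y : R) : R := / 2 * J 0 (Ep (Derive h)) t y.

Lemma smooth_lipschitz h A B : smooth h -> A <= B -> exists c, 0 < c /\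
  forall s t, A <= s <= B -> A <= t <= B -> Rabs (h s - h t) <= c * Rabs (s - t).
Proof.
move=> sh AB; have [c [c0 hc]] := smooth_bounded (smooth_Derive sh) AB.
exists c; split=> // s t hs ht.
have [||z [hz ->]] := MVT_gen h t s (Derive h).
- by move=> z _; exact: smooth_is_derive.
- by move=> z _; apply continuity_pt_filterlim; exact: smooth_continuous.
rewrite Rabs_mult; apply: Rmult_le_compat_r; first exact: Rabs_pos.
apply: hc; move: (Rmin_glb _ _ A (proj1 ht) (proj1 hs)) (Rmax_lub _ _ B (proj2 ht) (proj2 hs)); lra.
Qed.

Lemma lipb_Ep L b h : smooth h -> lipb L b (Ep h).
Proof.
move=> sh; set A := - Rabs b; set B := Rabs L + Rabs b.
have AB : A <= B by rewrite /A /B; have := Rabs_pos b; have := Rabs_pos L; lra.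
have [c [c0 hc]] := smooth_bounded sh AB.
have [k [k0 hk]] := smooth_lipschitz sh AB.
have hb := Rle_abs b; have hL := Rle_abs L; have hb0 := Rabs_pos b; have hL0 := Rabs_pos L.
have inp t y : dom L b t y -> A <= t + y / 2 <= B.
  by rewrite /A /B => -[[? ?] /Rabs_def2 [? ?]]; lra.
have inm t y : dom L b t y -> A <= t - y / 2 <= B.
  by rewrite /A /B => -[[? ?] /Rabs_def2 [? ?]]; lra.
exists (2 * c + 2 * k); split; first lra; split.
  move=> t y d; rewrite /Ep.
  have := hc _ (inp _ _ d); have := hc _ (inm _ _ d).
  have := Rabs_triang (h (t + y / 2)) (h (t - y / 2)); lra.
move=> t y t' y' d d'; rewrite /Ep.
have -> : h (t + y / 2) + h (t - y / 2) - (h (t' + y' / 2) + h (t' - y' / 2)) =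
  (h (t + y / 2) - h (t' + y' / 2)) + (h (t - y / 2) - h (t' - y' / 2)) by ring.
apply: Rle_trans (Rabs_triang _ _) _.
have := hk _ _ (inp _ _ d) (inp _ _ d'); have := hk _ _ (inm _ _ d) (inm _ _ d').
have e1 : Rabs (t + y / 2 - (t' + y' / 2)) <= Rabs (t - t') + Rabs (y - y').
  have -> : t + y / 2 - (t' + y' / 2) = (t - t') + (y - y') * / 2 by field.
  have := Rabs_triang (t - t') ((y - y') * / 2); rewrite Rabs_mult (Rabs_pos_eq (/ 2)); last lra.
  by have := Rabs_pos (y - y'); lra.
have e2 : Rabs (t - y / 2 - (t' - y' / 2)) <= Rabs (t - t') + Rabs (y - y').
  have -> : t - y / 2 - (t' - y' / 2) = (t - t') + (y - y') * - / 2 by field.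
  have := Rabs_triang (t - t') ((y - y') * - / 2); rewrite Rabs_mult Rabs_Ropp (Rabs_pos_eq (/ 2)); last lra.
  by have := Rabs_pos (y - y'); lra.
have := Rabs_pos (t - t'); have := Rabs_pos (y - y').
nra.
Qed.

Lemma is_derive_affine h a c s l : is_derive h (a + s * c) l ->
  is_derive (fun s => h (a + s * c)) s (c * l).
Proof.
move=> dh; have d : is_derive (fun s => a + s * c) s c by auto_derive => //; ring.
exact: (is_derive_comp h (fun s => a + s * c) s _ _ dh d).
Qed.

Lemma Od_diff h t y : smooth h -> h (t + y / 2) - h (t - y / 2) = y * Od h t y.
Proof.
move=> sh; rewrite /Od /J.
have sd := smooth_Derive sh.
pose F s := Ep (Derive h) t (s * y).
have FE s : F s = Derive h (t + s * (y / 2)) + Derive h (t + s * - (y / 2)).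
  by rewrite /F /Ep; congr (Derive h _ + Derive h _); field.
have d (s : R) : is_derive (fun s => h (t + s * (y / 2)) - h (t + s * - (y / 2))) s
    (y / 2 * (s ^ 0 * F s)).
  have -> : y / 2 * (s ^ 0 * F s) =
    y / 2 * Derive h (t + s * (y / 2)) - (- (y / 2)) * Derive h (t + s * - (y / 2)).
    by rewrite FE /=; ring.
  by apply: (is_derive_minus (V := R_NormedModule)); apply: is_derive_affine; exact: smooth_is_derive.
have cF (s : R) : continuous (fun s => s ^ 0 * F s) s.
  apply: (continuous_ext (fun s => Derive h (t + s * (y / 2)) + Derive h (t + s * - (y / 2)))).
    by move=> u; rewrite FE /=; ring.
  apply: ex_derive_continuous; eexists.
  by apply: (is_derive_plus (V := R_NormedModule)); apply: is_derive_affine; exact: smooth_is_derive.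
have c (s : R) : continuous (fun s => y / 2 * (s ^ 0 * F s)) s.
  by apply: (continuous_scal_r (V := R_NormedModule)); exact: cF.
have H := is_RInt_derive (V := R_CompleteNormedModule) _ _ 0 1 (fun s _ => d s) (fun s _ => c s).
have := is_RInt_unique _ _ _ _ H.
rewrite /minus /plus /opp /=.
have -> : t + 1 * (y / 2) = t + y / 2 by field.
have -> : t + 1 * - (y / 2) = t - y / 2 by field.
have -> : t + 0 * (y / 2) = t by field.
have -> : t + 0 * - (y / 2) = t by field.
have ex : ex_RInt (fun s => s ^ 0 * F s) 0 1.
  by apply: ex_RInt_continuous => s _; exact: cF.
have := RInt_scal (V := R_CompleteNormedModule) _ 0 1 (y / 2) ex.
rewrite /scal /= /mult /= => -> e.
have -> : y * (/ 2 * RInt (fun s : R => 1 * F s) 0 1) = y / 2 * RInt (fun s : R => 1 * F s) 0 1 by field.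
by rewrite e; ring.
Qed.

(** Differentiating in $y$ gives half the difference of $h'$ at the two points, which is $y$ times a
    mean of [Ep] of $h''$; the induction therefore passes from $h$ to $h''$. *)
Lemma ES_Ep L b n h : smooth h -> ES L b n (Ep h).
Proof.
elim: n h => [|n IH] h sh; first by split=> //; exact: lipb_Ep.
apply: (ES_intro (g := fun t y => / 4 * J 0 (Ep (Derive (Derive h))) t y)).
- exact: lipb_Ep.
- move=> t y _.
  have -> : y * (/ 4 * J 0 (Ep (Derive (Derive h))) t y) = / 2 * (y * Od (Derive h) t y).
    by rewrite /Od; field.
  rewrite -Od_diff; last exact: smooth_Derive.
  have e (u : R) : t - u / 2 = t + u * - / 2 by field.
  apply: (is_derive_ext (fun y => h (t + y * / 2) + h (t + y * - / 2))).
    by move=> u; rewrite /Ep e.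
  have -> : / 2 * (Derive h (t + y / 2) - Derive h (t - y / 2)) =
    / 2 * Derive h (t + y * / 2) + (- / 2) * Derive h (t + y * - / 2).
    by rewrite e /Rdiv; ring.
  by apply: (is_derive_plus (V := R_NormedModule)); apply: is_derive_affine; exact: smooth_is_derive.
- by apply: ES_scal; apply: ES_J; apply: IH; do 2 apply: smooth_Derive.
Qed.

Lemma ES_Od L b n h : smooth h -> ES L b n (Od h).
Proof. by move=> sh; apply: ES_scal; apply: ES_J; apply: ES_Ep; exact: smooth_Derive. Qed.

Lemma ES_sqr L b n : ES L b n (fun _ y => y * y).
Proof.
have lip : lipb L b (fun _ y => y * y).
  exists (Rabs b * Rabs b + 2 * Rabs b + 1); have := Rabs_pos b => b0.
  have hb := Rle_abs b.
  split; first nra; split=> [t y [_ d]|t y t' y' [_ d] [_ d']].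
    by rewrite Rabs_mult; have := Rabs_pos y; nra.
  have -> : y * y - y' * y' = (y + y') * (y - y') by ring.
  rewrite Rabs_mult; have := Rabs_triang y y'; have := Rabs_pos (y - y'); have := Rabs_pos (t - t').
  by have := Rabs_pos (y + y'); nra.
case: n => [|n]; first by split.
apply: (ES_intro (g := fun _ _ => 2)) => //; last exact: ES_cst.
by move=> t y _; auto_derive => //; ring.
Qed.

(* The product [h p * h q] is even in [y], being [((h p + h q)^2 - (h p - h q)^2) / 4]. *)
Lemma ES_pair L b n h : smooth h -> ES L b n (fun t y => h (t + y / 2) * h (t - y / 2)).
Proof.
move=> sh; have y2 := ES_sqr L b n.
apply: (ES_ext (f := fun t y => / 4 * (Ep h t y * Ep h t y - (y * y) * (Od h t y * Od h t y)))).
  move=> t y _; have -> : y * y * (Od h t y * Od h t y) = (y * Od h t y) * (y * Od h t y) by ring.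
  by rewrite -!Od_diff // /Ep; field.
have e1 := @ES_Ep L b n h sh; have e2 := @ES_Od L b n h sh.
apply: ES_scal; apply: ES_sub; first exact: ES_mul.
by apply: ES_mul => //; exact: ES_mul.
Qed.

End MidpointPairs.

(** * Legendrian curves *)

Section SmoothAlgebra.
Import Coquelicot.
Local Open Scope R_scope.

Lemma ex_derive_n_S f n : (forall t, ex_derive f t) ->
  (forall t, ex_derive_n (Derive f) n t) -> forall t, ex_derive_n f n.+1 t.
Proof.
move=> df dn t; case: n dn => [|n] dn; first exact: df.
apply: (ex_derive_ext (Derive_n (Derive f) n)) (dn t) => u.
by have := Derive_n_comp f n 1 u; rewrite PeanoNat.Nat.add_1_r => e; exact: e.
Qed.

Lemma smooth_cst c : smooth (fun _ => c).
Proof. by move=> n t; exact: ex_derive_n_const. Qed.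

Lemma smooth_add f g : smooth f -> smooth g -> smooth (fun t => f t + g t).
Proof. by move=> sf sg n t; apply: ex_derive_n_plus; apply: filter_forall. Qed.

Lemma smooth_mul f g : smooth f -> smooth g -> smooth (fun t => f t * g t).
Proof.
(* The sum rule asks for all orders up to [n], hence a strong induction through the bound [m]. *)
move=> sf sg n; have [m mn] : exists m, (n < m)%coq_nat by exists n.+1; lia.
elim: m n mn f g sf sg => [|m IH] [|n] mn f g sf sg t; try lia; first by [].
apply: ex_derive_n_S => {}t.
  by apply: ex_derive_mult; exact: smooth_ex.
apply: (ex_derive_n_ext (fun t => Derive f t * g t + f t * Derive g t)).
  by move=> u; rewrite Derive_mult //; exact: smooth_ex.
by apply: ex_derive_n_plus; apply: filter_forall => u k kn; apply: IH => //; try lia; exact: smooth_Derive.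
Qed.

Lemma smooth_opp f : smooth f -> smooth (fun t => - f t).
Proof.
move=> sf n t; apply: (ex_derive_n_ext (fun t => (-1) * f t)); first by move=> u; ring.
by apply: smooth_mul => //; exact: smooth_cst.
Qed.

Lemma smooth_sub f g : smooth f -> smooth g -> smooth (fun t => f t - g t).
Proof. by move=> sf sg; apply: smooth_add => //; exact: smooth_opp. Qed.

(** On the square of radius $f(u,v)/(4c)$ about $(u,v)$ the function stays above $f(u,v)/2$.
    Compactness of the closed rectangle bounds the radii in use below by some $d$, which gives the
    minimum $2cd$. *)
Lemma lipb_pos_min L b b' f : lipb L b f -> b' < b ->
  (forall t y, 0 <= t <= L -> - b' <= y <= b' -> 0 < f t y) ->
  exists m, 0 < m /\ forall t y, dom L b' t y -> m <= f t y.
Proof.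
move=> [c [c0 [_ h2]]] bb fpos.
(* The gauge has to be positive on the whole plane; where [f] is not positive it is given the
   default value 1. *)
have pos u v : 0 < Rmax (f u v / (4 * c)) 0 + (if Rlt_dec 0 (f u v) then 0 else 1).
  case: (Rlt_dec 0 (f u v)) => h /=; last by have := Rmax_r (f u v / (4 * c)) 0; lra.
  have := Rmax_l (f u v / (4 * c)) 0; have : 0 < f u v / (4 * c) by apply: Rdiv_lt_0_compat; lra.
  lra.
have [d Hd] := compactness_value_2d 0 L (- b') b' (fun u v => mkposreal _ (pos u v)).
exists (2 * c * d); split; first by have := cond_pos d; nra.
move=> t y [ht hy]; have hy' : - b' <= y <= b' by apply/Rabs_le_between; lra.
apply: Rnot_lt_le => hlt; apply: (Hd t y ht hy') => -[u [v [hu [hv [h3 [h4 h5]]]]]].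
have fu := fpos u v hu hv; move: h3 h4 h5 => /=.
case: (Rlt_dec 0 (f u v)) => //= _.
have p : 0 < f u v / (4 * c) by apply: Rdiv_lt_0_compat; lra.
rewrite Rmax_left; last lra.
rewrite Rplus_0_r => h3 h4 h5.
have duv : dom L b u v by split=> //; have := proj2 (Rabs_le_between v b') hv; lra.
have dty : dom L b t y by split=> //; lra.
have := h2 _ _ _ _ dty duv => /Rabs_le_between [h6 _].
have e : f u v = 4 * c * (f u v / (4 * c)) by field; lra.
nra.
Qed.

End SmoothAlgebra.

(** * The Korányi distance along a Legendrian curve *)

Section LegendrianGeometry.
Import Coquelicot.
Local Open Scope R_scope.

Definition N4 (p q : pt) : R :=
  ((px q - px p) ^ 2 + (py q - py p) ^ 2) ^ 2 +
  16 * (pu q - pu p + / 2 * (py p * px q - px p * py q)) ^ 2.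

Lemma kdistE p q : kdist p q = sqrt (sqrt (N4 p q)).
Proof.
by rewrite /kdist /hnorm /N4 /hmul /hinv /px /py /pu /=; do 2 congr sqrt; field.
Qed.

Lemma pow2_sum_eq0 a b : a ^ 2 + b ^ 2 = 0 -> a = 0 /\ b = 0.
Proof.
have := pow2_ge_0 a; have := pow2_ge_0 b => h1 h2 h.
by split; apply: Rsqr_0_uniq; rewrite Rsqr_pow2; lra.
Qed.

Lemma N4_ge0 p q : 0 <= N4 p q.
Proof.
rewrite /N4; have := pow2_ge_0 ((px q - px p) ^ 2 + (py q - py p) ^ 2).
by have := pow2_ge_0 (pu q - pu p + / 2 * (py p * px q - px p * py q)); lra.
Qed.

Lemma N4_eq0 p q : N4 p q = 0 -> p = q.
Proof.
case: p => [[x y] u]; case: q => [[x' y'] u']; rewrite /N4 /px /py /pu /fst /snd => h.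
have [hA hB] : (x' - x) ^ 2 + (y' - y) ^ 2 = 0 /\ 4 * (u' - u + / 2 * (y * x' - x * y')) = 0.
  by apply: pow2_sum_eq0; rewrite -[RHS]h; ring.
have [hx hy] := pow2_sum_eq0 hA.
have ex : x' = x by lra.
have ey : y' = y by lra.
subst; have hu : u' = u by lra.
by subst.
Qed.

Lemma N4_sym p q : N4 p q = N4 q p.
Proof. by rewrite /N4; field. Qed.

Variables (gamma : R -> pt) (L : R).
Hypothesis leg : legendrian_knot gamma L.

Let x t := px (gamma t).
Let y t := py (gamma t).
Let u t := pu (gamma t).

Let L0 : 0 < L. Proof. by case: leg. Qed.
Let sx : smooth x. Proof. by case: leg => _ [_ [_ [h _]]]. Qed.
Let sy : smooth y. Proof. by case: leg => _ [_ [_ [_ [h _]]]]. Qed.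
Let su : smooth u. Proof. by case: leg => _ [_ [_ [_ [_ [h _]]]]]. Qed.
Let reg t : 0 < Derive x t ^ 2 + Derive y t ^ 2.
Proof. by case: leg => _ [_ [_ [_ [_ [_ [h _]]]]]]; exact: h. Qed.
Let hor t : Derive u t = / 2 * (x t * Derive y t - y t * Derive x t).
Proof. by case: leg => _ [_ [_ [_ [_ [_ [_ h]]]]]]; exact: h. Qed.

Lemma gamma_periodZ (t : R) (k : Z) : gamma (t + IZR k * L) = gamma t.
Proof.
have per s : gamma (s + L) = gamma s by case: leg => _ [h _]; exact: h.
have pos n s : gamma (s + INR n * L) = gamma s.
  elim: n s => [|n IH] s; first by rewrite Rmult_0_l Rplus_0_r.
  by rewrite S_INR Rmult_plus_distr_r Rmult_1_l -Rplus_assoc per IH.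
case: (Z_le_gt_dec 0 k) => hk.
  by rewrite -(Z2Nat.id k hk) -INR_IZR_INZ pos.
rewrite -(pos (Z.to_nat (- k)) (t + _)) INR_IZR_INZ Z2Nat.id; last lia.
by congr gamma; rewrite opp_IZR; ring.
Qed.

(** Reduction of both parameters to one period shows that $s-t$ is an integer multiple of $L$, of
    modulus less than $L$. *)
Lemma gamma_inj_period s t : gamma s = gamma t -> Rabs (s - t) < L -> s = t.
Proof.
move=> e hst.
pose k r := Int_part (r / L).
have red r : 0 <= r + IZR (- k r) * L < L.
  have [h1 h2] := base_Int_part (r / L); rewrite -/(k r) in h1 h2.
  have er : r = r / L * L by field; lra.
  rewrite opp_IZR; nra.
have inj : forall s t, 0 <= s < L -> 0 <= t < L -> gamma s = gamma t -> s = t by case: leg => _ [_ [h _]].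
have := inj _ _ (red s) (red t); rewrite !gamma_periodZ => /(_ e).
rewrite !opp_IZR => h.
have h' : s - t = IZR (k s - k t) * L by rewrite minus_IZR; lra.
have : (k s - k t = 0)%Z.
  move: hst; rewrite h' Rabs_mult (Rabs_pos_eq L); last lra.
  move=> hh; have : Rabs (IZR (k s - k t)) < 1 by nra.
  rewrite -abs_IZR => /lt_IZR; lia.
by move=> hk; rewrite hk in h'; lra.
Qed.

(** A finite-difference version of $x'y''-y'x''$, which is its value at $s=0$. *)
Definition Wr (t s : R) : R := Od x t s * Od (Derive y) t s - Od y t s * Od (Derive x) t s.
Definition chi (t s : R) : R := / 4 * J 2 Wr t s.

Lemma ES_Wr b n : ES L b n Wr.
Proof.
by apply: ES_sub; apply: ES_mul; apply: ES_Od => //; exact: smooth_Derive.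
Qed.

Lemma ES_chi b n : ES L b n chi.
Proof. by apply: ES_scal; apply: ES_J; exact: ES_Wr. Qed.

(** The vertical coordinate of $\gamma(t-s/2)^{-1}\gamma(t+s/2)$. *)
Definition area (t s : R) : R := u (t + s / 2) - u (t - s / 2)
  - / 2 * (x (t - s / 2) * y (t + s / 2) - y (t - s / 2) * x (t + s / 2)).

Lemma is_derive_shift h t s c : smooth h -> is_derive (fun s => h (t + s * c)) s (c * Derive h (t + s * c)).
Proof. by move=> sh; apply: is_derive_affine; exact: smooth_is_derive. Qed.

Lemma is_derive_conv (f : R -> R) (a l l' : R) : is_derive f a l -> l = l' -> is_derive f a l'.
Proof. by move=> df <-. Qed.

(** Horizontality reduces the derivative to $\frac14(\Delta x\,\Delta y'-\Delta y\,\Delta x')$, with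
    $\Delta$ the difference between the two parameters; every $\Delta$ is divisible by $s$. *)
Lemma is_derive_area t s : is_derive (area t) s (/ 4 * s ^ 2 * Wr t s).
Proof.
have e h v : h (t - v / 2) = h (t + v * - / 2) :> R by congr (h _); field.
apply: (is_derive_ext (fun s => u (t + s * / 2) - u (t + s * - / 2)
  - / 2 * (x (t + s * - / 2) * y (t + s * / 2) - y (t + s * - / 2) * x (t + s * / 2)))).
  by move=> v; rewrite /area !e.
have dx c := is_derive_shift t s c sx.
have dy c := is_derive_shift t s c sy.
have du c := is_derive_shift t s c su.
have H := is_derive_minus _ _ _ _ _ (is_derive_minus _ _ _ _ _ (du (/ 2)) (du (- / 2)))
  (is_derive_scal _ _ (/ 2) _ (is_derive_minus _ _ _ _ _
     (is_derive_mult _ _ _ _ _ (dx (- / 2)) (dy (/ 2)) Rmult_comm)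
     (is_derive_mult _ _ _ _ _ (dy (- / 2)) (dx (/ 2)) Rmult_comm))).
apply: is_derive_conv H _; rewrite /minus /plus /opp /mult /= !hor.
have -> : / 4 * (s * (s * 1)) * Wr t s = / 4 * ((s * Od x t s) * (s * Od (Derive y) t s)
   - (s * Od y t s) * (s * Od (Derive x) t s)) by rewrite /Wr; ring.
have sdx := smooth_Derive sx; have sdy := smooth_Derive sy.
by rewrite -!Od_diff // !e /Rdiv; field.
Qed.

Lemma area_chi t s : 0 <= t <= L -> area t s = s ^ 3 * chi t s.
Proof.
move=> tL; pose b := Rabs s + 1.
have d : dom L b t s by split=> //; rewrite /b; lra.
have lw := ES_lipb (ES_Wr b 0).
have dd (r : R) : is_derive (fun r => area t (r * s)) r (/ 4 * s ^ 3 * (r ^ 2 * Wr t (r * s))).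
  have hs : is_derive (fun r => r * s) r s by auto_derive => //; ring.
  have := is_derive_comp (area t) _ r _ _ (is_derive_area t (r * s)) hs.
  rewrite /scal /= /mult /=.
  by have -> : s * (/ 4 * (r * s * (r * s * 1)) * Wr t (r * s)) = / 4 * (s * (s * (s * 1))) * (r * (r * 1) * Wr t (r * s)) by ring.
have cc (r : R) : Rmin 0 1 <= r <= Rmax 0 1 -> continuous (fun r => / 4 * s ^ 3 * (r ^ 2 * Wr t (r * s))) r.
  rewrite Rmin_left ?Rmax_right; try lra.
  by move=> hr; apply: (continuous_scal_r (V := R_NormedModule)); apply: J_cont lw d hr.
have H := is_RInt_derive (V := R_CompleteNormedModule) _ _ 0 1 (fun r _ => dd r) cc.
have := is_RInt_unique _ _ _ _ H.
have := RInt_scal (V := R_CompleteNormedModule) _ 0 1 (/ 4 * s ^ 3) (J_ex 2 lw d).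
rewrite /scal /mult /minus /plus /opp /chi /J [LHS]/= => ->.
have -> : area t (0 * s) = 0.
  by rewrite /area Rmult_0_l /Rdiv Rmult_0_l Rplus_0_r Rminus_0_r; ring.
rewrite Rmult_1_l => e.
have {}e : / 4 * s ^ 3 * RInt (fun r => r ^ 2 * Wr t (r * s)) 0 1 = area t s + - 0 := e.
rewrite /chi /J; lra.
Qed.

(* The quotient of the fourth power of [kdist (gamma (t + s / 2)) (gamma (t - s / 2))] by
   [s ^ 4]; horizontality makes [area] equal to [s ^ 3 * chi]. *)
Definition Qf (t s : R) : R :=
  (Od x t s * Od x t s + Od y t s * Od y t s) * (Od x t s * Od x t s + Od y t s * Od y t s)
  + 16 * (s * s * (chi t s * chi t s)).

Lemma ES_Qf b n : ES L b n Qf.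
Proof.
have e1 : ES L b n (fun t s => Od x t s * Od x t s + Od y t s * Od y t s).
  by apply: ES_add; apply: ES_mul; exact: ES_Od.
apply: ES_add; first exact: ES_mul.
apply: ES_scal; apply: ES_mul; first exact: ES_sqr.
by apply: ES_mul; exact: ES_chi.
Qed.

Lemma N4_Qf t s : 0 <= t <= L -> N4 (gamma (t + s / 2)) (gamma (t - s / 2)) = s ^ 4 * Qf t s.
Proof.
move=> tL.
have -> : s ^ 4 * Qf t s =
  ((s * Od x t s) ^ 2 + (s * Od y t s) ^ 2) ^ 2 + 16 * (s ^ 3 * chi t s) ^ 2.
  by rewrite /Qf; ring.
rewrite -!Od_diff // -area_chi // /N4 /area -/(x _) -/(x _) -/(y _) -/(y _) -/(u _) -/(u _).
by ring.
Qed.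

Lemma Od_0 h t : Od h t 0 = Derive h t.
Proof.
rewrite /Od /J (RInt_ext _ (fun _ => 2 * Derive h t)).
  by rewrite RInt_const /scal /= /mult /=; field.
by move=> s _; rewrite /Ep Rmult_0_r /= /Rdiv Rmult_0_l Rplus_0_r Rminus_0_r; ring.
Qed.

(** At $s=0$ the positivity is the regularity of the curve; elsewhere it is embeddedness, as
    parameters at distance less than $L$ give distinct points. *)
Lemma Qf_pos t s : 0 <= t <= L -> Rabs s < L -> 0 < Qf t s.
Proof.
move=> tL sL; case: (Req_dec s 0) => [->|s0].
  rewrite /Qf !Od_0; have := reg t; set a := Derive x t; set b := Derive y t => h.
  have h' : 0 < a * a + b * b by nra.
  by have := Rmult_lt_0_compat _ _ h' h'; lra.
have s4 : 0 < s ^ 4.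
  have s2 : 0 < s * s by have := Rsqr_pos_lt s s0.
  have -> : s ^ 4 = (s * s) * (s * s) by ring.
  exact: Rmult_lt_0_compat.
have Nn : 0 < N4 (gamma (t + s / 2)) (gamma (t - s / 2)).
  case: (N4_ge0 (gamma (t + s / 2)) (gamma (t - s / 2))) => // /esym/N4_eq0 e.
  have es : t + s / 2 - (t - s / 2) = s by field.
  have := gamma_inj_period e; rewrite es => /(_ sL); lra.
rewrite N4_Qf // in Nn.
apply: Rnot_le_lt => h; nra.
Qed.

End LegendrianGeometry.

(** * Continuation by parts *)

Section ComplexDerivative.
Import Coquelicot.
Local Open Scope R_scope.

Lemma Cmod_le_components (z : C) k : Rabs (fst z) <= k -> Rabs (snd z) <= k -> Cmod z <= 2 * k.
Proof.
move=> h1 h2; apply: Rle_trans (Cmod_2Rmax z) _.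
have : Rmax (Rabs (fst z)) (Rabs (snd z)) <= k by exact: Rmax_lub.
have k0 : 0 <= k by have := Rabs_pos (fst z); lra.
have s2 : sqrt 2 <= 2 by rewrite -{2}(sqrt_pow2 2); [apply: sqrt_le_1_alt; lra|lra].
have := sqrt_pos 2; have := Rmax_l (Rabs (fst z)) (Rabs (snd z)); have := Rabs_pos (fst z).
nra.
Qed.

(** Adapted to the estimates under the integral sign below, whose remainder is quadratic with an
    explicit constant. *)
Lemma C_is_derive_quadratic (F : C -> C) (z l : C) (k d : R) : 0 < d ->
  (forall h : C, Cmod h < d -> Cmod (F (z + h)%C - F z - h * l)%C <= k * Cmod h ^ 2) ->
  @is_derive C_AbsRing C_NormedModule F z l.
Proof.
move=> d0 H; split; first exact: is_linear_scal_l.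
move=> w /is_filter_lim_locally_unique <- eps.
pose r := Rmin d (eps / (Rabs k + 1)).
have k0 := Rabs_pos k.
have r0 : 0 < r by apply: Rmin_pos => //; apply: Rdiv_lt_0_compat; [exact: cond_pos|lra].
exists (mkposreal r r0) => y hy.
have hm : Cmod (y - z)%C < r := hy.
have := H (y - z)%C (Rlt_le_trans _ _ _ hm (Rmin_l _ _)).
have -> : (z + (y - z) = y)%C by ring.
move=> h; apply: Rle_trans h _.
change (k * Cmod (y - z)%C ^ 2 <= eps * Cmod (y - z)%C).
have hm2 : Cmod (y - z)%C < eps / (Rabs k + 1) := Rlt_le_trans _ _ _ hm (Rmin_r _ _).
have c0 := Cmod_ge_0 (y - z)%C.
have : (Rabs k + 1) * Cmod (y - z)%C <= eps.
  have -> : pos eps = (Rabs k + 1) * (eps / (Rabs k + 1)) by field; lra.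
  by apply: Rmult_le_compat_l; lra.
have := Rle_abs k; nra.
Qed.

Lemma C_is_derive_inv (c z : C) : (z + c <> 0)%C ->
  @is_derive C_AbsRing C_NormedModule (fun z => (/ (z + c))%C) z (- / ((z + c) * (z + c)))%C.
Proof.
move=> nz; have m0 := proj1 (Cmod_gt_0 (z + c)%C) nz.
set m := Cmod (z + c)%C in m0.
apply: (@C_is_derive_quadratic _ _ _ (2 / m ^ 3) (m / 2)); first lra.
move=> h hh.
have hm : m / 2 <= Cmod (z + h + c)%C.
  have := Cmod_triangle (z + h + c)%C (- h)%C.
  by have -> : (z + h + c + - h = z + c)%C; [ring|rewrite Cmod_opp -/m; lra].
have nzh : (z + h + c <> 0)%C by move=> e; rewrite e Cmod_0 in hm; lra.
have -> : (/ (z + h + c) - / (z + c) - h * - / ((z + c) * (z + c)) =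
   h * h * / ((z + c) * (z + c) * (z + h + c)))%C by field.
have nn : ((z + c) * (z + c) * (z + h + c) <> 0)%C by repeat apply: Cmult_neq_0.
rewrite !Cmod_mult Cmod_inv // !Cmod_mult -/m.
have c0 := Cmod_ge_0 h.
have -> : 2 / m ^ 3 * Cmod h ^ 2 = Cmod h * Cmod h * / (m * m * (m / 2)) by field; lra.
apply: Rmult_le_compat_l; first nra.
apply: Rinv_le_contravar; first by repeat apply: Rmult_lt_0_compat; lra.
by apply: Rmult_le_compat_l => //; nra.
Qed.

(** The product rule views [C] as a module over itself, whereas the definition of the energy uses
    [C_NormedModule]; this passes between the two structures. *)
Lemma C_is_derive_AbsRing (F : C -> C) (z l : C) :
  @is_derive C_AbsRing C_NormedModule F z l <->
  @is_derive C_AbsRing (AbsRing_NormedModule C_AbsRing) F z l.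
Proof.
split=> -[_ h]; split; try exact: is_linear_scal_l; exact: h.
Qed.

Lemma C_ex_derive_mult (F G : C -> C) z :
  @ex_derive C_AbsRing C_NormedModule F z -> @ex_derive C_AbsRing C_NormedModule G z ->
  @ex_derive C_AbsRing C_NormedModule (fun z => (F z * G z)%C) z.
Proof.
move=> [f /C_is_derive_AbsRing df] [g /C_is_derive_AbsRing dg]; eexists; apply/C_is_derive_AbsRing.
exact: (@is_derive_mult C_AbsRing F G z f g df dg Cmult_comm).
Qed.

Lemma C_ex_derive_minus (F G : C -> C) z :
  @ex_derive C_AbsRing C_NormedModule F z -> @ex_derive C_AbsRing C_NormedModule G z ->
  @ex_derive C_AbsRing C_NormedModule (fun z => (F z - G z)%C) z.
Proof. exact: (@ex_derive_minus C_AbsRing C_NormedModule). Qed.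

Lemma C_ex_derive_cst (c z : C) : @ex_derive C_AbsRing C_NormedModule (fun _ => c) z.
Proof. exact: (@ex_derive_const C_AbsRing C_NormedModule). Qed.

Lemma C_ex_derive_id (z : C) : @ex_derive C_AbsRing C_NormedModule (fun z => z) z.
Proof. by eexists; apply/C_is_derive_AbsRing; exact: is_derive_id. Qed.

End ComplexDerivative.

(** * The kernel $e^{zp}$ and its first-order expansion in $z$ *)

Section LaplaceKernel.
Import Coquelicot.
Local Open Scope R_scope.

(* The real part ([th = 0]) and the imaginary part ([th = - PI / 2]) of [e^((xi + i eta) p)]. *)
Definition ker (th xi eta p : R) : R := exp (xi * p) * cos (eta * p + th).

Lemma exp_taylor_bound p : Rabs (exp p - 1 - p) <= p ^ 2 * exp (Rabs p).
Proof.
have h1 := exp_ineq1_le p; rewrite Rabs_pos_eq; last lra.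
have h2 := exp_ineq1_le (- p); have e0 := exp_pos p; have e1 := exp_pos (- p).
have ee : exp p * exp (- p) = 1 by rewrite -exp_plus Rplus_opp_r exp_0.
case: (Rle_dec 0 p) => hp.
  rewrite Rabs_pos_eq //; have : exp p - 1 <= p * exp p by nra.
  by nra.
have p0 : p <= 0 by lra.
rewrite Rabs_left1 //; have : exp p * (1 - p) <= 1 by nra.
move=> h; have : exp p - 1 - p <= p ^ 2 by nra.
have : 1 <= exp (- p) by lra.
by have := pow2_ge_0 p; nra.
Qed.

Lemma cos_lip al q : Rabs (cos (al + q) - cos al) <= Rabs q.
Proof.
have [||w [_ ->]] := MVT_gen cos al (al + q) (fun x => - sin x).
- by move=> w _; exact: is_derive_cos.
- by move=> w _; exact: continuity_cos.
have -> : al + q - al = q by ring.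
rewrite Rabs_mult Rabs_Ropp; have : Rabs (sin w) <= 1 by apply/Rabs_le_between; exact: SIN_bound.
by have := Rabs_pos q; nra.
Qed.

Lemma sin_lip al q : Rabs (sin (al + q) - sin al) <= Rabs q.
Proof.
have [||w [_ ->]] := MVT_gen sin al (al + q) cos.
- by move=> w _; exact: is_derive_sin.
- by move=> w _; exact: continuity_sin.
have -> : al + q - al = q by ring.
rewrite Rabs_mult; have : Rabs (cos w) <= 1 by apply/Rabs_le_between; exact: COS_bound.
by have := Rabs_pos q; nra.
Qed.

Lemma cos_taylor_bound al q : Rabs (cos (al + q) - cos al + q * sin al) <= q ^ 2.
Proof.
pose f r := cos (al + r) + r * sin al.
have df r : is_derive f r (sin al - sin (al + r)).
  by rewrite /f; auto_derive => //; ring.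
have [||w [hw]] := MVT_gen f 0 q (fun r => sin al - sin (al + r)).
- by move=> w _; exact: df.
- move=> w _; apply continuity_pt_filterlim; apply: ex_derive_continuous; eexists; exact: df.
rewrite /f Rplus_0_r Rmult_0_l Rplus_0_r Rminus_0_r => e.
have -> : cos (al + q) - cos al + q * sin al = cos (al + q) + q * sin al - cos al by ring.
rewrite e Rabs_mult Rabs_minus_sym.
have := sin_lip al w.
have : Rabs w <= Rabs q.
  move: hw; rewrite /Rmin /Rmax; case: (Rle_dec 0 q) => h /= hw.
    by rewrite !Rabs_pos_eq; lra.
  by rewrite !Rabs_left1; lra.
have -> : q ^ 2 = Rabs q * Rabs q by rewrite -Rabs_mult Rabs_pos_eq; [ring|nra].
have := Rabs_pos q; have := Rabs_pos (sin (al + w) - sin al); nra.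
Qed.

Lemma exp_le x y : x <= y -> exp x <= exp y.
Proof. by case=> [h|->]; [left; exact: exp_increasing|right]. Qed.

(** Trades the loss $e^{\varepsilon|p|}$ for the neighbouring exponents $\xi\pm\varepsilon$, so that
    the dominating functions remain powers of $y$. *)
Lemma exp_abs_le eps p xi : 0 < eps ->
  exp (xi * p) * exp (eps * Rabs p) <= exp ((xi + eps) * p) + exp ((xi - eps) * p).
Proof.
move=> e0; have h1 := exp_pos ((xi + eps) * p); have h2 := exp_pos ((xi - eps) * p).
case: (Rle_dec 0 p) => hp.
  rewrite Rabs_pos_eq // -exp_plus; have -> : xi * p + eps * p = (xi + eps) * p by ring.
  lra.
rewrite Rabs_left; last lra.
rewrite -exp_plus; have -> : xi * p + eps * - p = (xi - eps) * p by ring.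
lra.
Qed.

Lemma sqr_le_exp eps p : 0 < eps -> p ^ 2 <= 16 / eps ^ 2 * exp (eps * Rabs p / 2).
Proof.
move=> e0; set x := eps * Rabs p / 2.
have x0 : 0 <= x by rewrite /x; have := Rabs_pos p; nra.
have h := exp_ineq1_le (x / 2).
have ee : exp x = exp (x / 2) * exp (x / 2) by rewrite -exp_plus; congr exp; field.
have : x ^ 2 <= 4 * exp x by rewrite ee; nra.
have -> : p ^ 2 = 4 / eps ^ 2 * x ^ 2.
  have -> : p ^ 2 = Rabs p ^ 2 by rewrite pow2_abs.
  by rewrite /x; field; lra.
have -> : 16 / eps ^ 2 * exp x = 4 / eps ^ 2 * (4 * exp x) by field; lra.
move=> hx; apply: Rmult_le_compat_l => //; left; apply: Rdiv_lt_0_compat; [lra|nra].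
Qed.

(** Multiplication by $i$ is the phase shift $\pi/2$, so the linear part is that of $h\,p\,e^{zp}$
    with $h=u+iv$. In the remainder, half of $e^{\varepsilon|p|}$ absorbs $p^2$ and the other half
    $e^{|up|}$, whence the condition on $u$. *)
Lemma ker_taylor eps th xi eta u v p : 0 < eps -> Rabs u <= eps / 2 ->
  Rabs (ker th (xi + u) (eta + v) p - ker th xi eta p
        - (u * (p * ker th xi eta p) + v * (p * ker (th + PI / 2) xi eta p)))
  <= 32 / eps ^ 2 * (u ^ 2 + v ^ 2) * (exp (xi * p) * exp (eps * Rabs p)).
Proof.
move=> e0 hu; rewrite /ker.
pose al := eta * p + th; pose q := v * p; pose r := u * p.
have -> : exp ((xi + u) * p) = exp (xi * p) * exp r by rewrite -exp_plus; congr exp; rewrite /r; ring.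
have -> : (eta + v) * p + th = al + q by rewrite /al /q; ring.
have -> : eta * p + (th + PI / 2) = PI / 2 + al by rewrite /al; ring.
have -> : cos (PI / 2 + al) = - sin al by rewrite -(Ropp_involutive (cos _)) -sin_cos.
rewrite -/al.
have -> : exp (xi * p) * exp r * cos (al + q) - exp (xi * p) * cos al -
  (u * (p * (exp (xi * p) * cos al)) + v * (p * (exp (xi * p) * - sin al))) =
  exp (xi * p) * ((exp r - 1 - r) * cos (al + q) + (cos (al + q) - cos al + q * sin al)
     + r * (cos (al + q) - cos al)) by rewrite /r /q; ring.
have ep := exp_pos (xi * p).
rewrite Rabs_mult (Rabs_pos_eq (exp (xi * p))); last lra.
have -> : 32 / eps ^ 2 * (u ^ 2 + v ^ 2) * (exp (xi * p) * exp (eps * Rabs p)) =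
  exp (xi * p) * (32 / eps ^ 2 * (u ^ 2 + v ^ 2) * exp (eps * Rabs p)) by ring.
apply: Rmult_le_compat_l; first lra.
have b1 : Rabs ((exp r - 1 - r) * cos (al + q)) <= r ^ 2 * exp (Rabs r).
  rewrite Rabs_mult; have : Rabs (cos (al + q)) <= 1 by apply/Rabs_le_between; exact: COS_bound.
  by have := exp_taylor_bound r; have := Rabs_pos (exp r - 1 - r); nra.
have b2 := cos_taylor_bound al q.
have b3 : Rabs (r * (cos (al + q) - cos al)) <= Rabs r * Rabs q.
  by rewrite Rabs_mult; apply: Rmult_le_compat_l; [exact: Rabs_pos|exact: cos_lip].
have er : 1 <= exp (Rabs r).
  by have := exp_ineq1_le (Rabs r); have := Rabs_pos r; lra.
have b4 : Rabs r * Rabs q <= r ^ 2 + q ^ 2.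
  by rewrite -(pow2_abs r) -(pow2_abs q); have := pow2_ge_0 (Rabs r - Rabs q); nra.
have tri := Rabs_triang ((exp r - 1 - r) * cos (al + q) + (cos (al + q) - cos al + q * sin al)) (r * (cos (al + q) - cos al)).
have tri2 := Rabs_triang ((exp r - 1 - r) * cos (al + q)) (cos (al + q) - cos al + q * sin al).
have b5 : exp (Rabs r) <= exp (eps * Rabs p / 2).
  by apply: exp_le; rewrite /r Rabs_mult; have := Rabs_pos p; nra.
have b6 := sqr_le_exp p e0.
have ee : exp (eps * Rabs p) = exp (eps * Rabs p / 2) * exp (eps * Rabs p / 2).
  by rewrite -exp_plus; congr exp; field.
set X := exp (eps * Rabs p / 2) in b5 b6 ee.
have X0 : 1 <= X by lra.
have r2 := pow2_ge_0 r; have q2 := pow2_ge_0 q.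
apply: (Rle_trans _ (2 * (r ^ 2 + q ^ 2) * X)).
  have : r ^ 2 * exp (Rabs r) <= r ^ 2 * X by apply: Rmult_le_compat_l.
  by nra.
rewrite ee.
have -> : r ^ 2 + q ^ 2 = (u ^ 2 + v ^ 2) * p ^ 2 by rewrite /r /q; ring.
have -> : 32 / eps ^ 2 * (u ^ 2 + v ^ 2) * (X * X) = 2 * ((u ^ 2 + v ^ 2) * (16 / eps ^ 2 * X)) * X by field; lra.
apply: Rmult_le_compat_r; first lra.
apply: Rmult_le_compat_l; first lra.
by apply: Rmult_le_compat_l => //; have := pow2_ge_0 u; have := pow2_ge_0 v; lra.
Qed.

Lemma ker_abs th xi eta p : Rabs (ker th xi eta p) <= exp (xi * p).
Proof.
rewrite /ker Rabs_mult (Rabs_pos_eq (exp _)); last exact: Rlt_le (exp_pos _).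
have : Rabs (cos (eta * p + th)) <= 1 by apply/Rabs_le_between; exact: COS_bound.
by have := exp_pos (xi * p); nra.
Qed.

End LaplaceKernel.

(** * Holomorphy of $z\mapsto\iint e^{z\varphi}A$ *)

Section LaplaceHolomorphy.
Import Coquelicot.
Local Open Scope R_scope.
Variables (L a : R).

Definition inS (t y : R) : Prop := (0 <= t /\ t <= L) /\ (0 < y /\ y <= a).

Definition LapR (phi A : R -> R -> R) (th xi eta : R) : R :=
  II L a (fun t y => ker th xi eta (phi t y) * A t y).

Definition Lap (phi A : R -> R -> R) (z : C) : C :=
  (LapR phi A 0 (fst z) (snd z), LapR phi A (- (PI / 2)) (fst z) (snd z)).

Lemma meas2_ker D phi A th xi eta : meas2 D phi -> meas2 D A ->
  meas2 D (fun t y => ker th xi eta (phi t y) * A t y).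
Proof.
move=> mp mA; apply: meas2_mul => //.
apply: (@meas2_continuity _ (fun p => ker th xi eta p)) mp => p.
apply continuity_pt_filterlim; apply: ex_derive_continuous.
by rewrite /ker; auto_derive.
Qed.

Lemma ker_weight_le eps th xi eta p A u : 0 < eps -> Rabs u <= eps / 2 ->
  Rabs (ker th (xi + u) eta p * A) <= Rabs A * (exp (xi * p) * exp (eps * Rabs p)).
Proof.
move=> e0 hu; rewrite Rabs_mult Rmult_comm; apply: Rmult_le_compat_l; first exact: Rabs_pos.
apply: Rle_trans (ker_abs _ _ _ _) _; rewrite -exp_plus; apply: exp_le.
have := Rle_abs (u * p); rewrite Rabs_mult; have := Rabs_pos p; nra.
Qed.

Lemma p_le_exp eps p : 0 < eps -> Rabs p <= / eps * exp (eps * Rabs p).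
Proof.
move=> e0; have := exp_ineq1_le (eps * Rabs p) => h.
have -> : Rabs p = / eps * (eps * Rabs p) by field; lra.
apply: Rmult_le_compat_l; first by left; apply: Rinv_0_lt_compat.
have -> : eps * (/ eps * (eps * Rabs p)) = eps * Rabs p by field; lra.
lra.
Qed.

Variables (phi A W : R -> R -> R) (eps xi : R).
Hypotheses (e0 : 0 < eps) (mp : meas2 (rstrip L a) phi) (mA : meas2 (rstrip L a) A).
Hypothesis iW : integ L a W.
(** [W] dominates the integrand for all real parts within [eps] of [xi]; this room also pays for the
    factors [phi] produced by differentiation in $z$. *)
Hypothesis hW : forall t y, inS t y -> Rabs (A t y) * (exp (xi * phi t y) * exp (eps * Rabs (phi t y))) <= W t y.

Lemma integ_ker th eta u : Rabs u <= eps / 2 ->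
  integ L a (fun t y => ker th (xi + u) eta (phi t y) * A t y).
Proof.
move=> hu; apply: integ_le iW _; first exact: meas2_ker.
move=> t y ht hy; apply: Rle_trans (hW _); last by split.
exact: ker_weight_le.
Qed.

Lemma integ_phi_ker th eta :
  integ L a (fun t y => ker th xi eta (phi t y) * (phi t y * A t y)).
Proof.
apply: (@integ_le _ _ _ (fun t y => / eps * W t y)).
- by apply: meas2_ker => //; exact: meas2_mul.
- exact: integ_scal.
move=> t y ht hy; apply: Rle_trans; last first.
  apply: Rmult_le_compat_l; last by apply: hW; split.
  by left; apply: Rinv_0_lt_compat.
rewrite (Rabs_mult (ker _ _ _ _)) (Rabs_mult (phi t y)).
have h1 := ker_abs th xi eta (phi t y); have h2 := p_le_exp (phi t y) e0.
have A0 := Rabs_pos (A t y).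
have -> : / eps * (Rabs (A t y) * (exp (xi * phi t y) * exp (eps * Rabs (phi t y)))) =
  exp (xi * phi t y) * ((/ eps * exp (eps * Rabs (phi t y))) * Rabs (A t y)) by ring.
have h3 := Rmult_le_compat_r _ _ _ A0 h2.
apply: (Rmult_le_compat _ _ _ _ _ _ h1 h3); first exact: Rabs_pos.
by apply: Rmult_le_pos => //; exact: Rabs_pos.
Qed.

Lemma LapR_taylor th eta u v : Rabs u <= eps / 2 ->
  Rabs (LapR phi A th (xi + u) (eta + v) - LapR phi A th xi eta
     - (u * LapR phi (fun t y => phi t y * A t y) th xi eta
        + v * LapR phi (fun t y => phi t y * A t y) (th + PI / 2) xi eta))
  <= 32 / eps ^ 2 * (u ^ 2 + v ^ 2) * II L a W.
Proof.
move=> hu; rewrite /LapR.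
have i1 := integ_ker th (eta + v) hu.
have h0 : Rabs 0 <= eps / 2 by rewrite Rabs_R0; lra.
have i2 := integ_ker th eta h0; rewrite Rplus_0_r in i2.
have i3 := integ_phi_ker th eta; have i4 := integ_phi_ker (th + PI / 2) eta.
set c := 32 / eps ^ 2 * (u ^ 2 + v ^ 2).
have c0 : 0 <= c.
  rewrite /c; apply: Rmult_le_pos; last by have := pow2_ge_0 u; have := pow2_ge_0 v; lra.
  by left; apply: Rdiv_lt_0_compat; [lra|nra].
have j2 := integ_scal (-1) i2; have j3 := integ_scal (- u) i3; have j4 := integ_scal (- v) i4.
have j34 := integ_add j3 j4; have j234 := integ_add j2 j34; have j := integ_add i1 j234.
rewrite -(II_scal c iW).
set lhs := _ - _ - _.
have -> : lhs = II L a (fun t y => ker th (xi + u) (eta + v) (phi t y) * A t y +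
   (-1 * (ker th xi eta (phi t y) * A t y) +
    (- u * (ker th xi eta (phi t y) * (phi t y * A t y)) +
     - v * (ker (th + PI / 2) xi eta (phi t y) * (phi t y * A t y))))).
  rewrite (II_add i1 j234) (II_add j2 j34) (II_add j3 j4) (II_scal _ i2) (II_scal _ i3) (II_scal _ i4).
  by rewrite /lhs; ring.
apply: II_le => //; first exact: integ_scal.
move=> t y ht hy; set p := phi t y.
have -> : ker th (xi + u) (eta + v) p * A t y + (-1 * (ker th xi eta p * A t y) +
    (- u * (ker th xi eta p * (p * A t y)) + - v * (ker (th + PI / 2) xi eta p * (p * A t y)))) =
  (ker th (xi + u) (eta + v) p - ker th xi eta p
        - (u * (p * ker th xi eta p) + v * (p * ker (th + PI / 2) xi eta p))) * A t y by ring.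
rewrite Rabs_mult.
apply: (Rle_trans _ (c * (exp (xi * p) * exp (eps * Rabs p)) * Rabs (A t y))).
  by apply: Rmult_le_compat_r; [exact: Rabs_pos|exact: ker_taylor].
have -> : c * (exp (xi * p) * exp (eps * Rabs p)) * Rabs (A t y) =
  c * (Rabs (A t y) * (exp (xi * p) * exp (eps * Rabs p))) by ring.
by apply: Rmult_le_compat_l => //; apply: hW; split.
Qed.

Lemma is_derive_Lap eta : @is_derive C_AbsRing C_NormedModule (Lap phi A) (xi, eta)
  (Lap phi (fun t y => phi t y * A t y) (xi, eta)).
Proof.
have h0 : Rabs 0 <= eps / 2 by rewrite Rabs_R0; lra.
set Bk := fun t y => phi t y * A t y.
(* The phases $\pi/2$ and $-\pi/2$ differ by a sign: this is the Cauchy-Riemann relation between the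
   two components. *)
have neg : LapR phi Bk (0 + PI / 2) xi eta = - LapR phi Bk (- (PI / 2)) xi eta.
  rewrite /LapR -[RHS]Rmult_1_l -Ropp_mult_distr_r Ropp_mult_distr_l -(II_scal _ (integ_phi_ker _ _)).
  apply: II_ext => t y _ _; rewrite /ker /Bk.
  have -> : eta * phi t y + (0 + PI / 2) = eta * phi t y + - (PI / 2) + PI by field.
  by rewrite neg_cos; ring.
set K := 32 / eps ^ 2 * II L a W.
apply: (@C_is_derive_quadratic _ _ _ (2 * K) (eps / 2)); first lra.
move=> [u v] hm.
have hu : Rabs u <= eps / 2.
  have := Rmax_Cmod (u, v) => /= hh; have := Rmax_l (Rabs u) (Rabs v); lra.
have t1 := LapR_taylor 0 eta v hu; have t2 := LapR_taylor (- (PI / 2)) eta v hu.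
have m2 : Cmod (u, v) ^ 2 = u ^ 2 + v ^ 2.
  rewrite /Cmod pow2_sqrt //=; have := pow2_ge_0 u; have := pow2_ge_0 v => /=; lra.
rewrite m2.
have -> : 2 * K * (u ^ 2 + v ^ 2) = 2 * (32 / eps ^ 2 * (u ^ 2 + v ^ 2) * II L a W) by rewrite /K; ring.
apply: Cmod_le_components.
  apply: Rle_trans t1; right; rewrite neg /Lap /=; congr Rabs.
  by rewrite -/Bk; ring.
apply: Rle_trans t2; right; rewrite /Lap /=; congr Rabs.
have -> : - (PI / 2) + PI / 2 = 0 by ring.
by rewrite -/Bk; ring.
Qed.

End LaplaceHolomorphy.

(** * Repeated integration by parts in the difference variable *)

Section Continuation.
Import Coquelicot.
Local Open Scope R_scope.
Variables (L a b : R) (l : R -> R -> R).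
Hypotheses (L0 : 0 < L) (a0 : 0 < a) (ab : a < b).

Definition ESi (f : R -> R -> R) : Prop := forall n, ES L b n f.

Hypothesis el : ESi l.

Definition phi (t y : R) : R := ln y + l t y.

Lemma inS_dom t y : inS L a t y -> dom L b t y.
Proof. by move=> [ht hy]; split=> //; rewrite Rabs_pos_eq; lra. Qed.

Lemma ESi_Dq f : ESi f -> ESi (Dq f).
Proof. by move=> ef n; have [_ []] := ef n.+1. Qed.

Lemma ESi_der f t y : ESi f -> dom L b t y -> is_derive (f t) y (y * Dq f t y).
Proof. by move=> ef; have [_ [h _]] := ef 1%nat; exact: h. Qed.

Lemma ESi_lipb f : ESi f -> lipb L b f.
Proof. by move=> ef; exact: ES_lipb (ef 0%nat). Qed.

Lemma ESi_mul f g : ESi f -> ESi g -> ESi (fun t y => f t y * g t y).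
Proof. by move=> ef eg n; exact: ES_mul. Qed.

Lemma meas2_lipb f : lipb L b f -> meas2 (rstrip L a) f.
Proof.
move=> [c [c0 [_ h2]]]; apply: (@meas2_lipschitz _ _ _ c) => // s t s' t' hs ht hs' ht'.
by apply: h2; apply: inS_dom.
Qed.

Lemma meas2_slice f : lipb L b f -> meas2 (rstrip L a) (fun t _ => f t a).
Proof.
move=> [c [c0 [_ h2]]]; apply: (@meas2_lipschitz _ _ _ c) => // s t s' t' hs ht hs' ht'.
have da r : 0 <= r <= L -> dom L b r a by move=> hr; apply: inS_dom; split=> //; lra.
apply: Rle_trans (h2 _ _ _ _ (da _ hs) (da _ hs')) _.
rewrite Rminus_diag Rabs_R0; have := Rabs_pos (t - t'); nra.
Qed.

Lemma meas2_ln_y D : meas2 D (fun _ y => ln y).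
Proof.
apply: meas2_ln; apply: (@meas2_2 _ (fun y => y)) => y.
exact: derivable_continuous_pt (derivable_pt_id y).
Qed.

Lemma meas2_pow D m : meas2 D (fun _ y => y ^ m).
Proof.
apply: (@meas2_2 _ (fun y => y ^ m)) => y.
exact: derivable_continuous_pt (derivable_pt_pow m y).
Qed.

Lemma meas2_phi : meas2 (rstrip L a) phi.
Proof. apply: meas2_add; [exact: meas2_ln_y|exact: meas2_lipb (ESi_lipb el)]. Qed.

Lemma pow_exp_ln y m : 0 < y -> y ^ m = exp (INR m * ln y).
Proof. by move=> y0; rewrite -Rpower_pow. Qed.

Lemma term_bound xi j f : lipb L b f -> exists c, 0 <= c /\ forall t y, inS L a t y ->
  exp (xi * phi t y) * Rabs (y ^ j * f t y) <= c * exp ((xi + INR j) * ln y).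
Proof.
move=> [cf [cf0 [hf _]]]; have [cl [cl0 [hl _]]] := ESi_lipb el.
exists (exp (Rabs xi * cl) * cf); split.
  by apply: Rmult_le_pos; [left; exact: exp_pos|lra].
move=> t y s; have d := inS_dom s; have [_ [y0 _]] := s.
have h1 := hf _ _ d; have h2 := hl _ _ d.
rewrite Rabs_mult Rabs_pos_eq; last by left; exact: pow_lt.
rewrite pow_exp_ln // /phi.
have -> : xi * (ln y + l t y) = xi * ln y + xi * l t y by ring.
have -> : (xi + INR j) * ln y = xi * ln y + INR j * ln y by ring.
rewrite !exp_plus.
have e1 : exp (xi * l t y) <= exp (Rabs xi * cl).
  apply: exp_le; apply: Rle_trans (Rle_abs _) _; rewrite Rabs_mult.
  by apply: Rmult_le_compat_l => //; exact: Rabs_pos.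
have e2 := exp_pos (xi * l t y); have e3 := exp_pos (xi * ln y); have e4 := exp_pos (INR j * ln y).
have -> : exp (xi * ln y) * exp (xi * l t y) * (exp (INR j * ln y) * Rabs (f t y)) =
  (exp (xi * ln y) * exp (INR j * ln y)) * (exp (xi * l t y) * Rabs (f t y)) by ring.
rewrite Rmult_comm; apply: Rmult_le_compat_r; first by left; exact: Rmult_lt_0_compat.
by apply: Rmult_le_compat => //; [lra|exact: Rabs_pos].
Qed.

Lemma laplace_hyp xi j f : lipb L b f -> -1 < xi + INR j -> exists eps W,
  [/\ 0 < eps, integ L a W & forall t y, inS L a t y ->
    Rabs (y ^ j * f t y) * (exp (xi * phi t y) * exp (eps * Rabs (phi t y))) <= W t y].
Proof.
(* Half the distance to the threshold of convergence, so that both exponents $\xi\pm\varepsilon+j$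
   still exceed $-1$. *)
move=> lf hxi; pose eps := (xi + INR j + 1) / 2; have e0 : 0 < eps by rewrite /eps; lra.
have [c1 [c10 h1]] := term_bound (xi + eps) j lf.
have [c2 [c20 h2]] := term_bound (xi - eps) j lf.
exists eps, (fun t y => c1 * exp ((xi + eps + INR j) * ln y) + c2 * exp ((xi - eps + INR j) * ln y)); split=> //.
  by apply: integ_add; apply: integ_scal; apply: integ_exp_ln => //; rewrite /eps; lra.
move=> t y s; have := h1 _ _ s; have := h2 _ _ s.
have := exp_abs_le (phi t y) xi e0; have := Rabs_pos (y ^ j * f t y).
nra.
Qed.

Lemma meas2_term j f : lipb L b f -> meas2 (rstrip L a) (fun t y => y ^ j * f t y).
Proof. by move=> lf; apply: meas2_mul; [exact: meas2_pow|exact: meas2_lipb]. Qed.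

Lemma integ_term th xi eta j f : lipb L b f -> -1 < xi + INR j ->
  integ L a (fun t y => ker th xi eta (phi t y) * (y ^ j * f t y)).
Proof.
move=> lf hxi; have [eps [W [e0 iW hW]]] := laplace_hyp lf hxi.
have h0 : Rabs 0 <= eps / 2 by rewrite Rabs_R0; lra.
have := integ_ker e0 meas2_phi (meas2_term j lf) iW hW th eta h0.
by rewrite Rplus_0_r.
Qed.

(* The double integral of [d^z y^(2j) f] where [d = e^phi = y e^l]. *)
Definition B0 (j : nat) (f : R -> R -> R) : C -> C := Lap L a phi (fun t y => y ^ (2 * j) * f t y).

Lemma ex_derive_B0 j f z : ESi f -> -1 < fst z + INR (2 * j) ->
  @ex_derive C_AbsRing C_NormedModule (B0 j f) z.
Proof.
move=> ef hz; have lf := ESi_lipb ef.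
have [eps [W [e0 iW hW]]] := laplace_hyp lf hz.
case: z hz eps W e0 iW hW => xi eta /= hz eps W e0 iW hW.
eexists; exact: (is_derive_Lap e0 meas2_phi (meas2_term (2 * j) lf) iW hW).
Qed.

(** The logarithm of the distance frozen at $y=a$. Boundary terms become integrals over the strip of
    functions constant in $y$, holomorphic by the same argument as the others; the factor [/ a] in
    [Bd] undoes the integration in $y$. *)
Definition phib (t y : R) : R := ln a + l t a.
Definition Bd (j : nat) (f : R -> R -> R) (z : C) : C :=
  (RtoC (/ a) * Lap L a phib (fun t _ => a ^ (2 * j + 1) * f t a)%R z)%C.

Lemma bd_hyp xi j f : lipb L b f -> exists W, integ L a W /\ forall t y, inS L a t y ->
    Rabs (a ^ j * f t a) * (exp (xi * phib t y) * exp (1 * Rabs (phib t y))) <= W t y.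
Proof.
move=> [cf [cf0 [hf _]]]; have [cl [cl0 [hl _]]] := ESi_lipb el.
pose P := Rabs (ln a) + cl.
(* A constant, written with the power $y^0$ so that [integ_exp_ln] applies. *)
exists (fun _ y => (a ^ j * cf * (exp (Rabs xi * P) * exp P)) * exp (0 * ln y)); split.
  by apply: integ_scal; apply: integ_exp_ln => //; lra.
move=> t y [ht _].
have d : dom L b t a by apply: inS_dom; split=> //; lra.
have hP : Rabs (phib t y) <= P.
  by rewrite /phib /P; have := Rabs_triang (ln a) (l t a); have := hl _ _ d; lra.
have aj : 0 < a ^ j by exact: pow_lt.
rewrite Rmult_0_l exp_0 Rmult_1_r Rmult_1_l.
have A0 := Rabs_pos (a ^ j * f t a).
apply: Rmult_le_compat => //.
- by apply: Rmult_le_pos; left; exact: exp_pos.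
- rewrite Rabs_mult (Rabs_pos_eq (a ^ j)); last lra.
  by apply: Rmult_le_compat_l; [lra|exact: hf].
apply: Rmult_le_compat; try (by left; exact: exp_pos); apply: exp_le => //.
apply: Rle_trans (Rle_abs _) _; rewrite Rabs_mult.
by apply: Rmult_le_compat_l => //; exact: Rabs_pos.
Qed.

Lemma meas2_phib : meas2 (rstrip L a) phib.
Proof. by apply: meas2_add; [exact: meas2_cst|exact: meas2_slice (ESi_lipb el)]. Qed.

Lemma meas2_bd j f : lipb L b f -> meas2 (rstrip L a) (fun t _ => a ^ j * f t a).
Proof. by move=> lf; apply: meas2_mul; [exact: meas2_cst|exact: meas2_slice]. Qed.

Lemma ex_derive_Bd j f z : ESi f -> @ex_derive C_AbsRing C_NormedModule (Bd j f) z.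
Proof.
move=> ef; have lf := ESi_lipb ef.
have [W [iW hW]] := bd_hyp (fst z) (2 * j + 1) lf.
apply: C_ex_derive_mult; first exact: C_ex_derive_cst.
case: z W iW hW => xi eta /= W iW hW.
eexists; exact: (is_derive_Lap Rlt_0_1 meas2_phib (meas2_bd (2 * j + 1) lf) iW hW).
Qed.

Lemma integ_bd th xi eta j f : lipb L b f ->
  integ L a (fun t y => ker th xi eta (phib t y) * (a ^ j * f t a)).
Proof.
move=> lf; have [W [iW hW]] := bd_hyp xi j lf.
have h0 : Rabs 0 <= 1 / 2 by rewrite Rabs_R0; lra.
have := integ_ker Rlt_0_1 meas2_phib (meas2_bd j lf) iW hW th eta h0.
by rewrite Rplus_0_r.
Qed.

Lemma is_derive_ker th xi eta p :
  is_derive (ker th xi eta) p (xi * ker th xi eta p + eta * ker (th + PI / 2) xi eta p).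
Proof.
rewrite /ker; auto_derive => //.
have -> : eta * p + (th + PI / 2) = PI / 2 + (eta * p + th) by ring.
have -> : cos (PI / 2 + (eta * p + th)) = - sin (eta * p + th).
  by rewrite -(Ropp_involutive (cos _)) -sin_cos.
ring.
Qed.

Lemma is_derive_phi t y : inS L a t y -> is_derive (phi t) y (/ y + y * Dq l t y).
Proof.
move=> s; have [_ [y0 _]] := s.
apply: (is_derive_plus (V := R_NormedModule)); last exact: ESi_der el (inS_dom s).
by auto_derive => //; field; lra.
Qed.

(** In complex form $(d^z y^{j+1}f)'=d^z y^j\bigl((z+j+1)f+y^2(z f\,g+k)\bigr)$ with $g$ = [Dq l]
    and $k$ = [Dq f], because $\varphi'=1/y+y\,g$. The summand with phase [th + PI / 2] carries the
    factor [eta]. *)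
Lemma is_derive_pow_term th xi eta j f t y : ESi f -> inS L a t y ->
  is_derive (fun y => ker th xi eta (phi t y) * (y ^ (j + 1) * f t y)) y
   (ker th xi eta (phi t y) * (y ^ j * ((xi + INR j + 1) * f t y
       + (y * y) * (xi * (f t y * Dq l t y) + Dq f t y))) +
    ker (th + PI / 2) xi eta (phi t y) * (y ^ j * (eta * (f t y + (y * y) * (f t y * Dq l t y))))).
Proof.
move=> ef s; have [_ [y0 _]] := s.
have d1 := is_derive_comp (ker th xi eta) (phi t) y _ _ (is_derive_ker _ _ _ _) (is_derive_phi s).
have d2 : is_derive (fun y => y ^ (j + 1)) y ((INR j + 1) * y ^ j).
  by auto_derive => //; rewrite addn1 S_INR Rmult_1_l.
have d3 := ESi_der ef (inS_dom s).
have H := is_derive_mult _ _ _ _ _ d1 (is_derive_mult _ _ _ _ _ d2 d3 Rmult_comm) Rmult_comm.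
apply: is_derive_conv H _; rewrite /plus /mult /scal /= /mult /=.
have -> : y ^ (j + 1) = y * y ^ j by rewrite addn1.
field; lra.
Qed.

Lemma continuous_term th xi eta j f t y : lipb L b f -> inS L a t y ->
  continuous (fun y => ker th xi eta (phi t y) * (y ^ j * f t y)) y.
Proof.
move=> lf s; apply: (continuous_mult (K := R_AbsRing)).
  apply: (continuous_comp (phi t) (ker th xi eta)).
    by apply: ex_derive_continuous; eexists; exact: is_derive_phi.
  by apply: ex_derive_continuous; eexists; exact: is_derive_ker.
apply: (continuous_mult (K := R_AbsRing)).
  by apply: ex_derive_continuous; auto_derive.
exact: lipb_continuous lf (inS_dom s).
Qed.

Lemma term_small th xi eta j f t e : lipb L b f -> -1 < xi + INR j -> 0 <= t <= L -> 0 < e ->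
  exists d, 0 < d /\ forall y, 0 < y -> y < d ->
    Rabs (ker th xi eta (phi t y) * (y ^ (j + 1) * f t y)) < e.
Proof.
move=> lf hxi tL e0; have [c [c0 hc]] := term_bound xi (j + 1) lf.
pose k := xi + INR (j + 1); have k0 : 0 < k by rewrite /k addn1 S_INR; lra.
(* [exp r] solves $y^k=e/(c+1)$; the added 1 covers the case $c=0$. *)
pose r := ln (e / (c + 1)) / k.
have ec : 0 < e / (c + 1) by apply: Rdiv_lt_0_compat; lra.
exists (Rmin a (exp r)); split; first by apply: Rmin_pos => //; exact: exp_pos.
move=> y y0 yd.
have ya : y < a := Rlt_le_trans _ _ _ yd (Rmin_l _ _).
have yr : y < exp r := Rlt_le_trans _ _ _ yd (Rmin_r _ _).
have s : inS L a t y by split=> //; lra.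
have h1 : Rabs (ker th xi eta (phi t y) * (y ^ (j + 1) * f t y)) <= c * exp (k * ln y).
  apply: Rle_trans (hc _ _ s); rewrite Rabs_mult.
  by apply: Rmult_le_compat_r; [exact: Rabs_pos|exact: ker_abs].
have h2 : exp (k * ln y) < e / (c + 1).
  rewrite -[X in _ < X](exp_ln _ ec); apply: exp_increasing.
  have : ln y < r by rewrite -(ln_exp r); exact: ln_increasing.
  have -> : ln (e / (c + 1)) = k * r by rewrite /r; field; lra.
  by nra.
have h3 : e = (c + 1) * (e / (c + 1)) by field; lra.
have := exp_pos (k * ln y); nra.
Qed.

(** The fundamental theorem applied to $d^z y^{2j+1}f$; the phase [th] makes one identity serve for
    the real and the imaginary part. The boundary term at $y=0$ vanishes because $\Re z+2j+1>0$. *)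
Lemma LapR_FTC th xi eta j f : ESi f -> -1 < xi + INR (2 * j) ->
  (xi + INR (2 * j) + 1) * LapR L a phi (fun t y => y ^ (2 * j) * f t y) th xi eta
  + eta * LapR L a phi (fun t y => y ^ (2 * j) * f t y) (th + PI / 2) xi eta
  + xi * LapR L a phi (fun t y => y ^ (2 * j.+1) * (f t y * Dq l t y)) th xi eta
  + eta * LapR L a phi (fun t y => y ^ (2 * j.+1) * (f t y * Dq l t y)) (th + PI / 2) xi eta
  + LapR L a phi (fun t y => y ^ (2 * j.+1) * Dq f t y) th xi eta
  = / a * LapR L a phib (fun t _ => a ^ (2 * j + 1) * f t a) th xi eta.
Proof.
move=> ef hxi; set m := (2 * j)%N in hxi *.
have em : (2 * j.+1 = m.+2)%N by rewrite /m !mul2n doubleS.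
have ed := ESi_Dq ef; have efl := ESi_mul ef (ESi_Dq el).
have e2 : ESi (fun _ y => y * y) by move=> n; exact: ES_sqr.
pose G1 t y := (xi + INR m + 1) * f t y + (y * y) * (xi * (f t y * Dq l t y) + Dq f t y).
pose G2 t y := eta * (f t y + (y * y) * (f t y * Dq l t y)).
have eG1 : ESi G1.
  move=> n; apply: ES_add; first exact: ES_scal.
  by apply: ES_mul => //; apply: ES_add => //; exact: ES_scal.
have eG2 : ESi G2.
  by move=> n; apply: ES_scal; apply: ES_add => //; exact: ES_mul.
pose h t y := ker th xi eta (phi t y) * (y ^ m * G1 t y) + ker (th + PI / 2) xi eta (phi t y) * (y ^ m * G2 t y).
pose g t y := ker th xi eta (phi t y) * (y ^ (m + 1) * f t y).
have lG1 := ESi_lipb eG1; have lG2 := ESi_lipb eG2; have lf := ESi_lipb ef.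
have i1 := integ_term th eta lG1 hxi; have i2 := integ_term (th + PI / 2) eta lG2 hxi.
have [c1 [c10 h1]] := term_bound xi m lG1; have [c2 [c20 h2]] := term_bound xi m lG2.
have key : a * II L a h = II L a (fun t _ => g t a).
  apply: (@II_FTC h g L a (xi + INR m) (c1 + c2)) => //.
  - exact: (integ_add i1 i2).
  - exact: (integ_bd th xi eta (m + 1) lf).
  - move=> t y ht hy; apply/is_derive_Reals; apply: is_derive_pow_term => //; by split.
  - move=> t y ht hy; apply continuity_pt_filterlim.
    by apply: (continuous_plus (V := R_NormedModule)); apply: continuous_term => //; split.
  - move=> t y ht hy; have s : inS L a t y by split.
    have := h1 _ _ s; have := h2 _ _ s; have := ker_abs th xi eta (phi t y); have := ker_abs (th + PI / 2) xi eta (phi t y).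
    have := Rabs_triang (ker th xi eta (phi t y) * (y ^ m * G1 t y)) (ker (th + PI / 2) xi eta (phi t y) * (y ^ m * G2 t y)).
    rewrite (Rabs_mult (ker th _ _ _)) (Rabs_mult (ker (th + _) _ _ _)) -/(h t y).
    have := Rabs_pos (y ^ m * G1 t y); have := Rabs_pos (y ^ m * G2 t y); nra.
  - by move=> t e ht e0; exact: term_small.
have hxi2 : -1 < xi + INR m.+2 by rewrite !S_INR; lra.
have ld := ESi_lipb ed; have lfl := ESi_lipb efl.
rewrite em /LapR -[X in _ = / a * X]key.
have -> : / a * (a * II L a h) = II L a h by field; lra.
rewrite (II_add i1 i2).
have split2 ph F1 F2 k1 k2 : lipb L b F1 -> lipb L b F2 ->
   II L a (fun t y => ker ph xi eta (phi t y) * (y ^ m * (k1 * F1 t y + (y * y) * (k2 * F2 t y)))) =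
   k1 * II L a (fun t y => ker ph xi eta (phi t y) * (y ^ m * F1 t y)) +
   k2 * II L a (fun t y => ker ph xi eta (phi t y) * (y ^ m.+2 * F2 t y)).
  move=> l1 l2; have j1 := integ_term ph eta l1 hxi; have j2 := integ_term ph eta l2 hxi2.
  rewrite -(II_scal _ j1) -(II_scal _ j2) -(II_add (integ_scal _ j1) (integ_scal _ j2)).
  by apply: II_ext => t y _ _ /=; ring.
have -> : II L a (fun t y => ker th xi eta (phi t y) * (y ^ m * G1 t y)) =
  (xi + INR m + 1) * II L a (fun t y => ker th xi eta (phi t y) * (y ^ m * f t y)) +
  (xi * II L a (fun t y => ker th xi eta (phi t y) * (y ^ m.+2 * (f t y * Dq l t y))) +
   II L a (fun t y => ker th xi eta (phi t y) * (y ^ m.+2 * Dq f t y))).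
  have j1 := integ_term th eta lfl hxi2; have j2 := integ_term th eta ld hxi2.
  rewrite -(II_scal _ j1) -(II_add (integ_scal _ j1) j2) -[X in _ = _ + X]Rmult_1_l.
  have lF2 : lipb L b (fun t y => xi * (f t y * Dq l t y) + Dq f t y).
    by apply: lipb_add => //; apply: lipb_mul => //; exact: lipb_cst.
  have := split2 th _ _ (xi + INR m + 1) 1 lf lF2.
  have -> : II L a (fun t y => ker th xi eta (phi t y) *
      (y ^ m * ((xi + INR m + 1) * f t y + y * y * (1 * (xi * (f t y * Dq l t y) + Dq f t y))))) =
     II L a (fun t y => ker th xi eta (phi t y) * (y ^ m * G1 t y)).
    by apply: II_ext => t y _ _; rewrite /G1; ring.
  move=> ->; congr (_ + 1 * _).
  by apply: II_ext => t y _ _; ring.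
have -> : II L a (fun t y => ker (th + PI / 2) xi eta (phi t y) * (y ^ m * G2 t y)) =
  eta * II L a (fun t y => ker (th + PI / 2) xi eta (phi t y) * (y ^ m * f t y)) +
  eta * II L a (fun t y => ker (th + PI / 2) xi eta (phi t y) * (y ^ m.+2 * (f t y * Dq l t y))).
  rewrite -(split2 _ _ _ _ _ lf lfl).
  by apply: II_ext => t y _ _; rewrite /G2; ring.
ring.
Qed.

Lemma LapR_opp psi A th xi eta : integ L a (fun t y => ker (th - PI) xi eta (psi t y) * A t y) ->
  LapR L a psi A th xi eta = - LapR L a psi A (th - PI) xi eta.
Proof.
move=> i; rewrite /LapR -[RHS]Rmult_1_l -Ropp_mult_distr_r Ropp_mult_distr_l -(II_scal _ i).
apply: II_ext => t y _ _; rewrite /ker.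
have -> : eta * psi t y + th = eta * psi t y + (th - PI) + PI by ring.
by rewrite neg_cos; ring.
Qed.

(** Both derivatives bring a factor $y$ besides the one gained by the primitive, so [j] rises to
    [j.+1]; dividing by $z+2j+1$ creates the pole at $-(2j+1)$. *)
Lemma B0_step j f z : ESi f -> -1 < fst z + INR (2 * j) ->
  ((z + RtoC (INR (2 * j) + 1)) * B0 j f z =
   Bd j f z - B0 j.+1 (Dq f) z - z * B0 j.+1 (fun t y => (f t y * Dq l t y)%R) z)%C.
Proof.
case: z => xi eta ef hz; rewrite /= in hz.
have ed := ESi_Dq ef; have efl := ESi_mul ef (ESi_Dq el).
have hz2 : -1 < xi + INR (2 * j.+1).
  by have -> : (2 * j.+1 = (2 * j).+2)%N; [rewrite !mul2n doubleS|rewrite !S_INR; lra].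
have e1 := LapR_FTC 0 eta ef hz; have e2 := LapR_FTC (- (PI / 2)) eta ef hz.
have pp : 0 + PI / 2 - PI = - (PI / 2) by field.
have pm : - (PI / 2) + PI / 2 = 0 by ring.
have o1 : LapR L a phi (fun t y => y ^ (2 * j) * f t y) (0 + PI / 2) xi eta =
   - LapR L a phi (fun t y => y ^ (2 * j) * f t y) (- (PI / 2)) xi eta.
  by rewrite LapR_opp ?pp //; apply: integ_term => //; exact: ESi_lipb.
have o2 : LapR L a phi (fun t y => y ^ (2 * j.+1) * (f t y * Dq l t y)) (0 + PI / 2) xi eta =
   - LapR L a phi (fun t y => y ^ (2 * j.+1) * (f t y * Dq l t y)) (- (PI / 2)) xi eta.
  by rewrite LapR_opp ?pp //; apply: (@integ_term _ _ _ _ (fun t y => f t y * Dq l t y)) => //; exact: ESi_lipb.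
rewrite o1 o2 in e1; rewrite pm in e2.
rewrite /B0 /Bd /Lap.
rewrite /B0 /Bd /Lap /fst /snd in e1 e2 *.
move: e1 e2; move: (LapR L a phi (fun t y => y ^ (2 * j.+1) * (f t y * Dq l t y))) => r1.
move: (LapR L a phi (fun t y => y ^ (2 * j.+1) * Dq f t y)) => r2.
move: (LapR L a phi (fun t y => y ^ (2 * j) * f t y)) => r3.
move: (LapR L a phib _) => r4; move: (INR (2 * j)) => c e1 e2.
apply: injective_projections => /=.
  by rewrite Rmult_0_l; lra.
by rewrite Rmult_0_l; lra.
Qed.

(* [B0] after [N] integrations by parts in [y]: all integrals left converge when
   [-1 < Re z + 2 (N + j)]. *)
Fixpoint Mc (N j : nat) (f : R -> R -> R) (z : C) : C :=
  match N with
  | O => B0 j f z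
  | S N => ((Bd j f z - Mc N j.+1 (Dq f) z - z * Mc N j.+1 (fun t y => (f t y * Dq l t y)%R) z)
            * / (z + RtoC (INR (2 * j) + 1)))%C
  end.

Lemma McS N j f z : Mc N.+1 j f z =
  ((Bd j f z - Mc N j.+1 (Dq f) z - z * Mc N j.+1 (fun t y => (f t y * Dq l t y)%R) z)
            * / (z + RtoC (INR (2 * j) + 1)))%C.
Proof. by []. Qed.

(** Only the innermost integrals change, and there one more step is [B0_step] divided by the nonzero
    $z+2j+1$. *)
Lemma Mc_succ N j f z : ESi f -> -1 < fst z + INR (2 * (N + j)) -> not_pole z ->
  Mc N.+1 j f z = Mc N j f z.
Proof.
move=> ef hz np; elim: N j f ef hz => [|N IH] j f ef hz.
  have nz : (z + RtoC (INR (2 * j) + 1) <> 0)%C.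
    move=> e; apply: (np j); case: z e {hz np} => x y [].
    rewrite mult_INR /= => e1 e2; congr pair; lra.
  change (((Bd j f z - B0 j.+1 (Dq f) z - z * B0 j.+1 (fun t y => (f t y * Dq l t y)%R) z)
    * / (z + RtoC (INR (2 * j) + 1)))%C = B0 j f z).
  rewrite add0n in hz; rewrite -B0_step //; move: nz; set c := RtoC _ => nz.
  by field.
have ed := ESi_Dq ef; have efl := ESi_mul ef (ESi_Dq el).
have hz' : -1 < fst z + INR (2 * (N + j.+1)) by rewrite addnS -addSn.
by rewrite [LHS]McS [RHS]McS (IH _ _ ed hz') (IH _ _ efl hz').
Qed.

Lemma Mc_add k N j f z : ESi f -> -1 < fst z + INR (2 * (N + j)) -> not_pole z ->
  Mc (k + N) j f z = Mc N j f z.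
Proof.
move=> ef hz np; elim: k => [|k IH] //; rewrite addSn Mc_succ //.
apply: Rlt_le_trans hz _; apply: Rplus_le_compat_l; apply: le_INR; apply/leP.
by rewrite leq_mul2l -addnA leq_addl.
Qed.

Lemma ex_derive_Mc N j f z : ESi f -> -1 < fst z + INR (2 * (N + j)) -> not_pole z ->
  @ex_derive C_AbsRing C_NormedModule (Mc N j f) z.
Proof.
move=> ef hz np; elim: N j f ef hz => [|N IH] j f ef hz; first exact: ex_derive_B0.
have ed := ESi_Dq ef; have efl := ESi_mul ef (ESi_Dq el).
have nz : (z + RtoC (INR (2 * j) + 1) <> 0)%C.
  move=> e; apply: (np j); case: z e {hz np IH} => x y [].
  rewrite mult_INR /= => e1 e2; congr pair; lra.
have hz' : -1 < fst z + INR (2 * (N + j.+1)) by rewrite addnS -addSn.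
apply: C_ex_derive_mult; last by eexists; exact: C_is_derive_inv.
apply: C_ex_derive_minus; last first.
  by apply: C_ex_derive_mult; [exact: C_ex_derive_id|exact: (IH j.+1 (fun t y => f t y * Dq l t y))].
by apply: C_ex_derive_minus; [exact: ex_derive_Bd|exact: IH].
Qed.

Definition depth (z : C) : nat := Z.to_nat (up (- fst z)).

Lemma depth_gt z : - INR (depth z) < fst z.
Proof.
have [h _] := archimed (- fst z); rewrite /depth INR_IZR_INZ.
have : IZR (up (- fst z)) <= IZR (Z.of_nat (Z.to_nat (up (- fst z)))) by apply: IZR_le; lia.
lra.
Qed.

(** The number of steps may depend on [z], since by [Mc_add] all sufficiently large numbers give the
    same value away from the poles. *)
Definition Bc (f : R -> R -> R) (z : C) : C := Mc (depth z) 0 f z.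

Lemma Bc_Mc N f z : ESi f -> -1 < fst z + INR (2 * N) -> not_pole z -> Bc f z = Mc N 0 f z.
Proof.
move=> ef hz np.
have hd : -1 < fst z + INR (2 * (depth z + 0)).
  by rewrite addn0 mult_INR /=; have := depth_gt z; have := pos_INR (depth z); lra.
have hN : -1 < fst z + INR (2 * (N + 0)) by rewrite addn0.
by rewrite /Bc -(Mc_add N ef hd np) -(Mc_add (depth z) ef hN np) addnC.
Qed.

Lemma finite_pos_min (g : nat -> R) : (forall k, 0 < g k) ->
  forall K, exists r, 0 < r /\ forall k, (k <= K)%coq_nat -> r <= g k.
Proof.
move=> gpos; elim=> [|K [r [r0 IH]]].
  exists (g 0%N); split; first exact: gpos.
  move=> k hk; have -> : k = 0%N by lia.
  exact: Rle_refl.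
exists (Rmin r (g K.+1)); split; first exact: Rmin_pos.
move=> k hk; case: (PeanoNat.Nat.eq_dec k K.+1) => [->|hne]; first exact: Rmin_r.
by apply: Rle_trans (Rmin_l _ _) _; apply: IH; lia.
Qed.

(** Poles of index above [depth z] lie at distance more than 1 from [z], so a minimum over finitely
    many poles suffices. *)
Lemma not_pole_isolated (z : C) : not_pole z -> exists r, 0 < r /\
  forall w : C, Cmod (w - z)%C < r -> not_pole w /\ fst z - 1 < fst w.
Proof.
move=> np; pose p k : C := (- (2 * INR k + 1), 0).
have gpos k : 0 < Cmod (p k - z)%C.
  apply/Cmod_gt_0 => e; apply: (np k); rewrite -/(p k).
  by have -> : z = (p k - (p k - z))%C; [ring|rewrite e; ring].
have [r [r0 hr]] := finite_pos_min gpos (depth z).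
have re (w : C) : Rabs (fst w - fst z) <= Cmod (w - z)%C.
  have := Rmax_Cmod (w - z)%C => h; have := Rmax_l (Rabs (fst (w - z)%C)) (Rabs (snd (w - z)%C)).
  by move=> h'; apply: Rle_trans h; apply: Rle_trans h'; right.
exists (Rmin r 1); split; first by apply: Rmin_pos => //; lra.
move=> w hw; have hw1 : Cmod (w - z)%C < r := Rlt_le_trans _ _ _ hw (Rmin_l _ _).
have hw2 : Cmod (w - z)%C < 1 := Rlt_le_trans _ _ _ hw (Rmin_r _ _).
have := re w => hre; split; last by have := Rabs_def2 _ _ (Rle_lt_trans _ _ _ hre hw2); lra.
move=> k ew; case: (le_gt_dec k (depth z)) => hk.
  by have := hr k hk; rewrite /p -ew; lra.
have := Rabs_def2 _ _ (Rle_lt_trans _ _ _ hre hw2); rewrite ew /= => -[h1 h2].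
have := depth_gt z; have := lt_INR _ _ hk; have := pos_INR (depth z); lra.
Qed.

Lemma ex_derive_Bc f z : ESi f -> not_pole z -> @ex_derive C_AbsRing C_NormedModule (Bc f) z.
Proof.
(* One step more than at [z] serves for all points whose real part exceeds $\Re z-1$, so a single
   formula holds near [z]. *)
move=> ef np; set N := (depth z).+1.
have hz (w : C) : fst z - 1 < fst w -> -1 < fst w + INR (2 * N).
  by move=> hw; rewrite mult_INR [INR N]S_INR /=; have := depth_gt z; have := pos_INR (depth z); lra.
have hzz : -1 < fst z + INR (2 * (N + 0)) by rewrite addn0; apply: hz; lra.
have [r [r0 hr]] := not_pole_isolated np.
apply: ex_derive_ext_loc (ex_derive_Mc ef hzz np).
exists (mkposreal r r0) => w hw; have [npw rew] := hr w hw.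
by rewrite (Bc_Mc ef (hz w rew) npw).
Qed.

Lemma Bc_B0 f z : ESi f -> -1 < fst z -> Bc f z = B0 0 f z.
Proof.
move=> ef hz; rewrite (@Bc_Mc 0 f z) //; first by rewrite muln0 /=; lra.
by move=> k e; rewrite e /= in hz; have := pos_INR k; lra.
Qed.

Lemma not_pole_m2 : not_pole (-2, 0).
Proof.
move=> k [e]; have e' : IZR 2 = IZR (2 * Z.of_nat k + 1).
  by rewrite plus_IZR mult_IZR -INR_IZR_INZ; lra.
have := eq_IZR _ _ e'; lia.
Qed.

Lemma Bc_m2 f : ESi f -> Bc f (-2, 0) = Mc 1 0 f (-2, 0).
Proof.
by move=> ef; apply: Bc_Mc => //=; [lra|exact: not_pole_m2].
Qed.

(** The two remaining double integrals are merged because $e^{-2l}(k-2fg)$, with $g$ = [Dq l] and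
    $k$ = [Dq f], is the derivative of $e^{-2l}f$ divided by $y$. *)
Lemma Mc1_m2_components f : ESi f ->
  let r th := / a * LapR L a phib (fun t _ => a ^ 1 * f t a) th (-2) 0
     - II L a (fun t y => exp (-2 * ln y) * cos th * (y ^ 2 * (exp (-2 * l t y) * (Dq f t y - 2 * (f t y * Dq l t y))))) in
  Mc 1 0 f (-2, 0) = ((r 0%R, r (- (PI / 2))%R) * / ((-2, 0) + RtoC (0 + 1)))%C.
Proof.
move=> ef r; have ed := ESi_Dq ef; have efl := ESi_mul ef (ESi_Dq el).
change (Mc 1 0 f (-2, 0)) with
  ((Bd 0 f (-2, 0) - B0 1 (Dq f) (-2, 0) - (-2, 0) * B0 1 (fun t y => (f t y * Dq l t y)%R) (-2, 0))
            * / ((-2, 0) + RtoC (0 + 1)))%C.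
congr Cmult.
have h2 : -1 < -2 + INR 2 by rewrite /=; lra.
have hr th : r th = / a * LapR L a phib (fun t _ => a ^ 1 * f t a) th (-2) 0
   - LapR L a phi (fun t y => y ^ 2 * Dq f t y) th (-2) 0
   + 2 * LapR L a phi (fun t y => y ^ 2 * (f t y * Dq l t y)) th (-2) 0.
  rewrite /r /LapR.
  have j1 := integ_term th 0 (ESi_lipb ed) h2; have j2 := integ_term th 0 (ESi_lipb efl) h2.
  have e : II L a (fun t y => exp (-2 * ln y) * cos th * (y ^ 2 * (exp (-2 * l t y) * (Dq f t y - 2 * (f t y * Dq l t y))))) =
     II L a (fun t y => ker th (-2) 0 (phi t y) * (y ^ 2 * Dq f t y)) +
     -2 * II L a (fun t y => ker th (-2) 0 (phi t y) * (y ^ 2 * (f t y * Dq l t y))).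
    rewrite -(II_scal _ j2) -(II_add j1 (integ_scal _ j2)); apply: II_ext => t y _ _.
    rewrite /ker /phi Rmult_0_l Rplus_0_l Rmult_plus_distr_l exp_plus; ring.
  by rewrite e; ring.
rewrite !hr /Bd /B0 /Lap.
change (2 * 1)%N with 2%N; change (2 * 0 + 1)%N with 1%N.
move: (LapR L a phi (fun t y => y ^ 2 * (f t y * Dq l t y))) => r1.
move: (LapR L a phi (fun t y => y ^ 2 * Dq f t y)) => r2.
move: (LapR L a phib _) => r3.
by apply: injective_projections => /=; ring.
Qed.

End Continuation.

(** * The value of the continuation at $-2$ *)

Section ValueAtMinusTwo.
Import Coquelicot.
Local Open Scope R_scope.

(* At -2 one integration by parts suffices, and what it produces depends on [l] and [f] only
   through [e^(-2l) f]. *)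
Lemma Bc_m2_eq (L a b : R) (l l' f f' : R -> R -> R) : 0 < L -> 0 < a -> a < b ->
  ESi L b l -> ESi L b l' -> ESi L b f -> ESi L b f' ->
  (forall t y, dom L b t y -> exp (-2 * l t y) * f t y = exp (-2 * l' t y) * f' t y)%R ->
  Bc L a l f (-2, 0) = Bc L a l' f' (-2, 0).
Proof.
move=> L0 a0 ab el el' ef ef' e.
have der l0 f0 t y : ESi L b l0 -> ESi L b f0 -> dom L b t y ->
    is_derive (fun y => exp (-2 * l0 t y) * f0 t y)%R y (y * (exp (-2 * l0 t y) * (Dq f0 t y - 2 * (f0 t y * Dq l0 t y))))%R.
  move=> h1 h2 d; have dl := ESi_der h1 d; have df := ESi_der h2 d.
  have d1 := is_derive_comp exp _ y _ _ (is_derive_exp (-2 * l0 t y)%R) (is_derive_scal _ _ (-2)%R _ dl).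
  apply: is_derive_conv (is_derive_mult _ _ _ _ _ d1 df Rmult_comm) _.
  by rewrite /plus /mult /scal /= /mult /=; ring.
have eqD t y : 0 <= t <= L -> 0 < y <= a ->
   (exp (-2 * l t y) * (Dq f t y - 2 * (f t y * Dq l t y)) =
    exp (-2 * l' t y) * (Dq f' t y - 2 * (f' t y * Dq l' t y)))%R.
  move=> ht hy; have d : dom L b t y by apply: (inS_dom ab); split.
  have d1 := is_derive_unique _ _ _ (der _ _ _ _ el ef d).
  have d2 := is_derive_unique _ _ _ (der _ _ _ _ el' ef' d).
  apply: (Rmult_eq_reg_l y); last by lra.
  rewrite -d1 -d2; apply: Derive_ext_loc.
  by apply: filter_imp (dom_open d) => z dz; exact: e.
rewrite (Bc_m2 L0 a0 ab el ef) (Bc_m2 L0 a0 ab el' ef').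
rewrite (Mc1_m2_components L0 a0 ab el ef) (Mc1_m2_components L0 a0 ab el' ef').
have c1 th : LapR L a (phib a l) (fun t _ => a ^ 1 * f t a)%R th (-2) 0 =
   LapR L a (phib a l') (fun t _ => a ^ 1 * f' t a)%R th (-2) 0.
  apply: II_ext => t y ht hy; rewrite /ker /phib !Rmult_0_l !Rmult_plus_distr_l !exp_plus.
  have d : dom L b t a by apply: (inS_dom ab); split=> //; lra.
  have := e _ _ d => ed.
  have -> : (exp (-2 * ln a) * exp (-2 * l t a) * cos (0 + th) * (a ^ 1 * f t a) =
    exp (-2 * ln a) * cos (0 + th) * a ^ 1 * (exp (-2 * l t a) * f t a))%R by ring.
  by rewrite ed; ring.
have c2 th : II L a (fun t y => exp (-2 * ln y) * cos th * (y ^ 2 * (exp (-2 * l t y) * (Dq f t y - 2 * (f t y * Dq l t y)))))%R =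
  II L a (fun t y => exp (-2 * ln y) * cos th * (y ^ 2 * (exp (-2 * l' t y) * (Dq f' t y - 2 * (f' t y * Dq l' t y)))))%R.
  by apply: II_ext => t y ht hy; rewrite eqD.
by rewrite !c1 !c2.
Qed.

End ValueAtMinusTwo.

(** * The Hermitian model of PU(2,1) *)

Section HermitianModel.
Import Coquelicot.
Local Open Scope R_scope.

Definition vec := (C * C * C)%type.

Definition vadd (u v : vec) : vec := ((u.1.1 + v.1.1)%C, (u.1.2 + v.1.2)%C, (u.2 + v.2)%C).
Definition vscal (k : C) (u : vec) : vec := ((k * u.1.1)%C, (k * u.1.2)%C, (k * u.2)%C).

(* The form of signature (2,1) whose null lines are the points of the sphere [H u {oo}]; on the
   lifts below its modulus is the square of the Koranyi distance. *)
Definition herm (u v : vec) : C :=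
  (Cconj u.2 * v.1.1 + Cconj u.1.1 * v.2 - 2 * (Cconj u.1.2 * v.1.2))%C.

(** The last coordinate is $|z|^2+4iu$, whose modulus is the square of the Korányi norm. *)
Definition lift (P : option pt) : vec :=
  match P with
  | Some p => (RtoC 1, (px p, py p), (px p ^ 2 + py p ^ 2, 4 * pu p))
  | None => (RtoC 0, RtoC 0, RtoC 1)
  end.

(** [T] is the projective action of [A]. A similitude of the form, rather than an isometry, leaves
    dilations without normalization. *)
Definition represents (T : option pt -> option pt) (A : vec -> vec) (s : R) : Prop :=
  [/\ 0 < s, forall u v, A (vadd u v) = vadd (A u) (A v), forall k u, A (vscal k u) = vscal k (A u),
      forall u v, herm (A u) (A v) = (RtoC s * herm u v)%C &
      forall P, exists k : C, k <> 0%C /\ A (lift P) = vscal k (lift (T P))].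

Lemma C_ext (z w : C) : fst z = fst w -> snd z = snd w -> z = w.
Proof. by case: z w => [a b] [c d] /= -> ->. Qed.

Ltac vec_ring := rewrite /vadd /vscal /herm /=;
  repeat (match goal with |- pair _ _ = pair _ _ => congr pair end);
  try (apply: C_ext => /=); try ring.

Lemma represents_dilation l : 0 < l -> represents (dilation l)
  (fun v => (v.1.1, (RtoC l * v.1.2)%C, (RtoC (l ^ 2) * v.2)%C)) (l ^ 2).
Proof.
move=> l0; split.
- by apply: pow_lt.
- by move=> [[[? ?] [? ?]] [? ?]] [[[? ?] [? ?]] [? ?]]; vec_ring.
- by move=> [? ?] [[[? ?] [? ?]] [? ?]]; vec_ring.
- by move=> [[[? ?] [? ?]] [? ?]] [[[? ?] [? ?]] [? ?]]; vec_ring.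
- move=> [[[x y] u]|].
    exists (RtoC 1); split; first by move=> [] /=; lra.
    by rewrite /dilation /lift /px /py /pu /=; vec_ring.
  exists (RtoC (l ^ 2)); split.
    by move=> [e]; have := pow_lt l 2 l0; rewrite /= in e *; lra.
  by rewrite /lift /=; vec_ring.
Qed.

(** The last row is the expansion $|z_0+z|^2+4i(u_0+u-\frac12\Im(z_0\bar z))=(|z_0|^2+4iu_0)+2\bar
    z_0z+(|z|^2+4iu)$, linear in the lift of $(z,u)$. *)
Lemma represents_translation p0 : represents (ltranslation p0)
  (fun v => (v.1.1, ((px p0, py p0) * v.1.1 + v.1.2)%C,
    ((px p0 ^ 2 + py p0 ^ 2, 4 * pu p0)%R * v.1.1 + 2 * Cconj (px p0, py p0) * v.1.2 + v.2)%C)) 1.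
Proof.
case: p0 => [[x0 y0] u0]; rewrite /px /py /pu /=; split.
- lra.
- by move=> [[[? ?] [? ?]] [? ?]] [[[? ?] [? ?]] [? ?]]; vec_ring.
- by move=> [? ?] [[[? ?] [? ?]] [? ?]]; vec_ring.
- by move=> [[[? ?] [? ?]] [? ?]] [[[? ?] [? ?]] [? ?]]; vec_ring.
- move=> P; exists (RtoC 1); split; first by move=> [] /=; lra.
  case: P => [[[x y] u]|]; last by vec_ring.
  rewrite /ltranslation /hmul /lift /px /py /pu /=; vec_ring.
  by field.
Qed.

Lemma represents_rotation th : exists c s : R, c ^ 2 + s ^ 2 = 1 /\
  represents (rotation th) (fun v => (v.1.1, ((c, s) * v.1.2)%C, v.2)) 1.
Proof.
have [c [s [cs rot]]] := rotationE th; exists c, s; split=> //; split.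
- lra.
- by move=> [[[? ?] [? ?]] [? ?]] [[[? ?] [? ?]] [? ?]]; vec_ring.
- by move=> [? ?] [[[? ?] [? ?]] [? ?]]; vec_ring.
- move=> [[[a1 a2] [b1 b2]] [c1 c2]] [[[a1' a2'] [b1' b2']] [c1' c2']].
  rewrite /herm /=; apply: C_ext => /=.
    transitivity (c1 * a1' + c2 * a2' + (a1 * c1' + a2 * c2') - 2 * (c ^ 2 + s ^ 2) * (b1 * b1' + b2 * b2')); first by ring.
    by rewrite cs; ring.
  transitivity (c1 * a2' - c2 * a1' + (a1 * c2' - a2 * c1') - 2 * (c ^ 2 + s ^ 2) * (b1 * b2' - b2 * b1')); first by ring.
  by rewrite cs; ring.
- move=> P; exists (RtoC 1); split; first by move=> [] /=; lra.
  case: P => [[[x y] u]|]; last by vec_ring.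
  rewrite rot /lift /px /py /pu /=.
  have -> : (c * x - s * y) * ((c * x - s * y) * 1) + (s * x + c * y) * ((s * x + c * y) * 1) =
    (c ^ 2 + s ^ 2) * (x ^ 2 + y ^ 2) by ring.
  by rewrite cs; vec_ring.
Qed.

(** For $w=|z|^2+4iu\neq0$ the exchange turns $(1,z,w)$ into $w\,(1,z/w,1/w)$, and
    $1/w=|z/w|^2-4iu/|w|^2$ is the last coordinate of the lift of $\iota(z,u)$. The case $w=0$ is
    the origin, sent to infinity. *)
Lemma represents_inversion : represents inversion (fun v => (v.2, v.1.2, v.1.1)) 1.
Proof.
split.
- lra.
- by move=> [[[? ?] [? ?]] [? ?]] [[[? ?] [? ?]] [? ?]]; vec_ring.
- by move=> [? ?] [[[? ?] [? ?]] [? ?]]; vec_ring.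
- by move=> [[[? ?] [? ?]] [? ?]] [[[? ?] [? ?]] [? ?]]; vec_ring.
- move=> [[[x y] u]|]; last first.
    exists (RtoC 1); split; first by move=> [] /=; lra.
    by rewrite /inversion /lift /px /py /pu /=; vec_ring.
  rewrite /inversion /px /py /pu /fst /snd.
  case: (Rstruct.Req_EM_T ((x ^ 2 + y ^ 2) ^ 2 + 16 * u ^ 2) 0) => hD; rewrite ?/is_left.
    have [h1 h2] : x ^ 2 + y ^ 2 = 0 /\ 4 * u = 0 by apply: pow2_sum_eq0; rewrite -[RHS]hD; ring.
    have [-> ->] := pow2_sum_eq0 h1; have -> : u = 0 by lra.
    exists (RtoC 1); split; first by move=> [] /=; lra.
    by rewrite /lift /px /py /pu /=; vec_ring.
  exists (x ^ 2 + y ^ 2, 4 * u); split.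
    move=> [e1 e2]; apply: hD; have e3 : u = 0 by lra.
    by rewrite e1 e3; ring.
  rewrite /lift /px /py /pu /fst /snd /vscal /=.
  by congr (_, _, _); apply: C_ext => /=; field; move=> e; apply: hD; rewrite -[RHS]e; ring.
Qed.

Lemma PU21_represents T : PU21 T -> exists A s, represents T A s.
Proof.
elim=> [l l0|p0|th||f g _ [A [s [s0 Aa Am Ah Al]]] _ [B [r [r0 Ba Bm Bh Bl]]]].
- by eexists; eexists; exact: represents_dilation.
- by eexists; eexists; exact: represents_translation.
- by have [c [s [_ h]]] := represents_rotation th; eexists; eexists; exact: h.
- by eexists; eexists; exact: represents_inversion.
exists (fun v => A (B v)), (s * r); split.
- exact: Rmult_lt_0_compat.
- by move=> u v; rewrite Ba Aa.
- by move=> k u; rewrite Bm Am.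
- by move=> u v; rewrite Ah Bh RtoC_mult; ring.
- move=> P; have [k [k0 ek]] := Bl P; have [k' [k0' ek']] := Al (g P).
  exists (k * k')%C; split; first exact: Cmult_neq_0.
  by rewrite ek Am ek' /vscal /= !Cmult_assoc.
Qed.

Lemma herm_lift p q : herm (lift (Some p)) (lift (Some q)) =
  ((px q - px p) ^ 2 + (py q - py p) ^ 2, 4 * (pu q - pu p + / 2 * (py p * px q - px p * py q)))%R :> C.
Proof. by rewrite /herm /lift; apply: C_ext => /=; field. Qed.

Definition nrm2 (z : C) : R := fst z ^ 2 + snd z ^ 2.

Lemma nrm2_mult z w : nrm2 (z * w)%C = nrm2 z * nrm2 w.
Proof. by rewrite /nrm2 /=; ring. Qed.

Lemma nrm2_gt0 (z : C) : z <> 0%C -> 0 < nrm2 z.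
Proof.
move=> nz; have h1 := pow2_ge_0 (fst z); have h2 := pow2_ge_0 (snd z).
have : 0 <= nrm2 z by rewrite /nrm2; lra.
by case=> // /esym/pow2_sum_eq0 [e1 e2]; case: nz; apply: C_ext.
Qed.

Lemma herm_scal k k' u v : herm (vscal k u) (vscal k' v) = (Cconj k * k' * herm u v)%C.
Proof.
case: k k' u v => [? ?] [? ?] [[[? ?] [? ?]] [? ?]] [[[? ?] [? ?]] [? ?]].
by rewrite /herm /vscal; apply: C_ext => /=; ring.
Qed.

(* The vanishing of [herm V V] and [herm V V'] makes the numerator of the quotient rule
   for the horizontal projection [B / lam] of [V = (lam, B, c)] collapse to [herm V' V']. *)
Lemma wronskian_herm (V W : vec) (s k : R) :
  herm V V = 0%C -> herm V W = 0%C -> herm W W = RtoC (- 2 * s * k) ->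
  nrm2 (W.1.2 * V.1.1 - V.1.2 * W.1.1)%C = s * k * nrm2 V.1.1.
Proof.
case: V W => [[[l1 l2] [b1 b2]] [c1 c2]] [[[l1' l2'] [b1' b2']] [c1' c2']].
rewrite /herm /nrm2 /= => -[e1 _] [e2 e3] [e4 _].
have h1 : b1 ^ 2 + b2 ^ 2 = c1 * l1 + c2 * l2 by lra.
have h2 : b1' ^ 2 + b2' ^ 2 = c1' * l1' + c2' * l2' + s * k by lra.
have h3 : 2 * (b1 * b1' + b2 * b2') = c1 * l1' + c2 * l2' + (l1 * c1' + l2 * c2') by lra.
have h4 : 2 * (b1 * b2' - b2 * b1') = c1 * l2' - c2 * l1' + (l1 * c2' - l2 * c1') by lra.
transitivity ((b1' ^ 2 + b2' ^ 2) * (l1 ^ 2 + l2 ^ 2) + (b1 ^ 2 + b2 ^ 2) * (l1' ^ 2 + l2' ^ 2)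
  - (2 * (b1 * b1' + b2 * b2')) * (l1 * l1' + l2 * l2')
  - (2 * (b1 * b2' - b2 * b1')) * (l1 * l2' - l2 * l1')); first by ring.
by rewrite h1 h2 h3 h4; ring.
Qed.

(** The real part of the quotient rule for $b/\lambda$, where $n_1+in_2=b'\lambda-b\lambda'$; the
    imaginary part is obtained from $-ib=(b_2,-b_1)$. *)
Lemma is_derive_quotient (b1 b2 l1 l2 : R -> R) (t db1 db2 dl1 dl2 : R) :
  is_derive b1 t db1 -> is_derive b2 t db2 -> is_derive l1 t dl1 -> is_derive l2 t dl2 ->
  l1 t ^ 2 + l2 t ^ 2 <> 0 ->
  is_derive (fun t => (b1 t * l1 t + b2 t * l2 t) / (l1 t ^ 2 + l2 t ^ 2)) t
    (let n1 := db1 * l1 t - db2 * l2 t - (b1 t * dl1 - b2 t * dl2) in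
     let n2 := db1 * l2 t + db2 * l1 t - (b1 t * dl2 + b2 t * dl1) in
     (n1 * (l1 t ^ 2 - l2 t ^ 2) + n2 * (2 * l1 t * l2 t)) / (l1 t ^ 2 + l2 t ^ 2) ^ 2).
Proof.
move=> d1 d2 d3 d4 nz; auto_derive.
  by repeat split; try (eexists; eassumption).
rewrite (is_derive_unique _ _ _ d1) (is_derive_unique _ _ _ d2) (is_derive_unique _ _ _ d3) (is_derive_unique _ _ _ d4).
by cbv zeta; field.
Qed.

End HermitianModel.

(** * The conformal factor of a Möbius map along the knot *)

Section ConformalFactor.
Import Coquelicot.
Local Open Scope R_scope.
Variables (gamma : R -> pt) (L : R).
Hypothesis leg : legendrian_knot gamma L.

Let x t := px (gamma t).
Let y t := py (gamma t).
Let u t := pu (gamma t).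
Let sx : smooth x. Proof. by case: leg => _ [_ [_ [h _]]]. Qed.
Let sy : smooth y. Proof. by case: leg => _ [_ [_ [_ [h _]]]]. Qed.
Let su : smooth u. Proof. by case: leg => _ [_ [_ [_ [_ [h _]]]]]. Qed.
Let hor t : Derive u t = / 2 * (x t * Derive y t - y t * Derive x t).
Proof. by case: leg => _ [_ [_ [_ [_ [_ [_ h]]]]]]; exact: h. Qed.

(** The real part of $\alpha+\beta z+\delta(|z|^2+4iu)$ along the curve: the shape of every
    coordinate of the image of a lift under a linear map. Imaginary parts come from multiplying the
    coefficients by $-i$. *)
Definition chain (al be be' de de' : R) (t : R) : R :=
  al + (x t * be - y t * be') + ((x t * x t + y t * y t) * de - 4 * u t * de').

Lemma smooth_chain al be be' de de' : smooth (chain al be be' de de').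
Proof.
apply: smooth_add.
  apply: smooth_add; first exact: smooth_cst.
  by apply: smooth_sub; apply: smooth_mul => //; exact: smooth_cst.
apply: smooth_sub.
  apply: smooth_mul; last exact: smooth_cst.
  by apply: smooth_add; exact: smooth_mul.
by apply: smooth_mul; [apply: smooth_mul => //|]; exact: smooth_cst.
Qed.

Lemma is_derive_chain al be be' de de' t : is_derive (chain al be be' de de') t
  ((Derive x t * be - Derive y t * be') + ((2 * (x t * Derive x t + y t * Derive y t)) * de - (4 * Derive u t) * de')).
Proof.
have aux (f g k : R -> R) df dg dk : is_derive f t df -> is_derive g t dg -> is_derive k t dk ->
    is_derive (fun t => al + (f t * be - g t * be') + ((f t * f t + g t * g t) * de - 4 * k t * de')) t
      ((df * be - dg * be') + ((2 * (f t * df + g t * dg)) * de - (4 * dk) * de')).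
  move=> d1 d2 d3; auto_derive.
    by repeat split; try (eexists; eassumption).
  by rewrite (is_derive_unique _ _ _ d1) (is_derive_unique _ _ _ d2) (is_derive_unique _ _ _ d3); ring.
by apply: (aux x y u); exact: smooth_is_derive.
Qed.

Lemma quotient_norm n1 n2 l1 l2 s k D1 D2 : 0 < s -> 0 < l1 ^ 2 + l2 ^ 2 ->
  n1 ^ 2 + n2 ^ 2 = s * k * (l1 ^ 2 + l2 ^ 2) ->
  D1 = (n1 * (l1 ^ 2 - l2 ^ 2) + n2 * (2 * l1 * l2)) / (l1 ^ 2 + l2 ^ 2) ^ 2 ->
  D2 = (n2 * (l1 ^ 2 - l2 ^ 2) - n1 * (2 * l1 * l2)) / (l1 ^ 2 + l2 ^ 2) ^ 2 ->
  D1 ^ 2 + D2 ^ 2 = k / (/ s * (l1 * l1 + l2 * l2)).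
Proof.
move=> s0 l0 e -> ->.
transitivity ((n1 ^ 2 + n2 ^ 2) / (l1 ^ 2 + l2 ^ 2) ^ 2); first by field; lra.
by rewrite e; field; lra.
Qed.

(** With $\lambda$ the first coordinate of the image $V$ of the lift, $V/\lambda$ is the lift of
    [gammaT], and the factor is $h=|\lambda|^2/s$. Distances follow by sesquilinearity, speeds by
    differentiating the middle coordinate of $V/\lambda$. *)
Lemma PU21_conformal_factor T gammaT : PU21 T ->
  (forall t, T (Some (gamma t)) = Some (gammaT t)) ->
  exists h : R -> R, [/\ smooth h, forall t, 0 < h t,
    forall s t, N4 (gammaT s) (gammaT t) * (h s * h t) = N4 (gamma s) (gamma t) &
    forall t, speed gammaT t = speed gamma t / sqrt (h t)].
Proof.
move=> /PU21_represents [A [s [s0 Aa Am Ah Al]]] HT.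
pose V t := A (lift (Some (gamma t))).
pose lam t := (V t).1.1.
have VE t : V t = vscal (lam t) (lift (Some (gammaT t))).
  have [k [k0 e]] := Al (Some (gamma t)); rewrite HT in e.
  have -> // : lam t = k by rewrite /lam /V e /vscal /=; ring.
have lam0 t : lam t <> 0%C.
  have [k [k0 e]] := Al (Some (gamma t)).
  by rewrite /lam /V e HT /vscal /= => e0; apply: k0; rewrite -e0; ring.
pose e1 : vec := (RtoC 1, RtoC 0, RtoC 0); pose e2 : vec := (RtoC 0, RtoC 1, RtoC 0).
pose e3 : vec := (RtoC 0, RtoC 0, RtoC 1).
(* [W] is the derivative of [V]: the linear map [A] applied to the derivative of the lift. *)
pose W t := A (RtoC 0, (Derive x t, Derive y t),
   (2 * (x t * Derive x t + y t * Derive y t), 4 * Derive u t)).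
have VA t : V t = vadd (A e1) (vadd (vscal (x t, y t) (A e2)) (vscal (x t * x t + y t * y t, 4 * u t) (A e3))).
  rewrite /V -!Am -!Aa; congr A; rewrite /vadd /vscal /lift /=.
  by congr (_, _, _); apply: C_ext => /=; rewrite -/(x t) -/(y t) -/(u t); ring.
have WA t : W t = vadd (vscal (Derive x t, Derive y t) (A e2))
    (vscal (2 * (x t * Derive x t + y t * Derive y t), 4 * Derive u t) (A e3)).
  rewrite /W -!Am -!Aa; congr A; rewrite /vadd /vscal /=.
  by congr (_, _, _); apply: C_ext => /=; ring.
move: VA WA; case: (A e1) => [[[p1 p2] [q1 q2]] r1]; case: (A e2) => [[[p1' p2'] [q1' q2']] r1'].
case: (A e3) => [[[p1'' p2''] [q1'' q2'']] r1''] VA WA.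
pose l1 := chain p1 p1' p2' p1'' p2''; pose l2 := chain p2 p2' (- p1') p2'' (- p1'').
pose b1 := chain q1 q1' q2' q1'' q2''; pose b2 := chain q2 q2' (- q1') q2'' (- q1'').
have lamE t : lam t = (l1 t, l2 t).
  by rewrite /lam VA /= /l1 /l2 /chain; apply: C_ext => /=; ring.
have bE t : (V t).1.2 = (b1 t, b2 t) :> C.
  by rewrite VA /= /b1 /b2 /chain; apply: C_ext => /=; ring.
have n0 t : 0 < l1 t ^ 2 + l2 t ^ 2.
  by have := nrm2_gt0 (lam0 t); rewrite lamE.
pose h t := / s * (l1 t * l1 t + l2 t * l2 t).
have hE t : h t = / s * nrm2 (lam t) by rewrite /h lamE /nrm2 /=; ring.
have dl1 t := is_derive_chain p1 p1' p2' p1'' p2'' t.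
have dl2 t := is_derive_chain p2 p2' (- p1') p2'' (- p1'') t.
have db1 t := is_derive_chain q1 q1' q2' q1'' q2'' t.
have db2 t := is_derive_chain q2 q2' (- q1') q2'' (- q1'') t.
have xyT t : px (gammaT t) = (b1 t * l1 t + b2 t * l2 t) / (l1 t ^ 2 + l2 t ^ 2) /\
    py (gammaT t) = (b2 t * l1 t + (- b1 t) * l2 t) / (l1 t ^ 2 + l2 t ^ 2).
  have := bE t; rewrite VE lamE /vscal /= => -[<- <-].
  have := n0 t; split; field; nra.
have hpos t : 0 < h t.
  by rewrite hE; apply: Rmult_lt_0_compat; [exact: Rinv_0_lt_compat|exact: nrm2_gt0].
exists h; split=> //.
- apply: smooth_mul; first exact: smooth_cst.
  by apply: smooth_add; apply: smooth_mul; exact: smooth_chain.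
- move=> r t.
  have N4E p q : N4 p q = nrm2 (herm (lift (Some p)) (lift (Some q))).
    by rewrite herm_lift /N4 /nrm2 /=; ring.
  have e : herm (V r) (V t) = (RtoC s * herm (lift (Some (gamma r))) (lift (Some (gamma t))))%C by exact: Ah.
  rewrite !VE herm_scal in e.
  have := f_equal nrm2 e; rewrite !nrm2_mult -!N4E !hE.
  have -> : nrm2 (Cconj (lam r)) = nrm2 (lam r) by rewrite /nrm2 /=; ring.
  have -> : nrm2 (RtoC s) = s * s by rewrite /nrm2 /=; ring.
  move=> e'; apply: (Rmult_eq_reg_l (s * s)); last by nra.
  by rewrite -e'; field; lra.
- move=> t.
  have hVV : herm (V t) (V t) = 0%C.
    by rewrite Ah herm_lift; apply: C_ext => /=; field.
  (* Horizontality is the orthogonality of the lift to its derivative. *)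
  have hVW : herm (V t) (W t) = 0%C.
    rewrite Ah /herm /lift; apply: C_ext => /=; rewrite -/(x t) -/(y t) -/(u t); first by ring.
    by rewrite hor; field.
  have hWW : herm (W t) (W t) = RtoC (- 2 * s * (Derive x t ^ 2 + Derive y t ^ 2)).
    by rewrite Ah /herm; apply: C_ext => /=; ring.
  have wr := wronskian_herm hVV hVW hWW.
  rewrite -/(lam t) lamE bE WA /= /nrm2 /= in wr.
  have nz : l1 t ^ 2 + l2 t ^ 2 <> 0 by have := n0 t; lra.
  have dx := is_derive_quotient (db1 t) (db2 t) (dl1 t) (dl2 t) nz.
  have dy := is_derive_quotient (db2 t) (is_derive_opp _ _ _ (db1 t)) (dl1 t) (dl2 t) nz.
  rewrite /speed -sqrt_div_alt //; congr sqrt.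
  have -> : Derive (fun s => px (gammaT s)) t = _ := eq_trans (Derive_ext _ _ t (fun r => proj1 (xyT r))) (is_derive_unique _ _ _ dx).
  have -> : Derive (fun s => py (gammaT s)) t = _ := eq_trans (Derive_ext _ _ t (fun r => proj2 (xyT r))) (is_derive_unique _ _ _ dy).
  rewrite -/x -/y.
  move: wr; move: (Derive u t) (Derive x t) (Derive y t) => u' x' y'.
  rewrite /opp /= -/l1 -/l2 -/b1 -/b2 /h.
  set B1 := x' * q1' - y' * q2' + _; set B2 := x' * q2' - y' * - q1' + _.
  set L1 := x' * p1' - y' * p2' + _; set L2 := x' * p2' - y' * - p1' + _.
  move=> wr.
  apply: (@quotient_norm (B1 * l1 t - B2 * l2 t - (b1 t * L1 - b2 t * L2))
    (B1 * l2 t + B2 * l1 t - (b1 t * L2 + b2 t * L1)) (l1 t) (l2 t) s) => //.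
  - move: wr; rewrite /B1 /B2 /L1 /L2 => wr; transitivity (s * (x' ^ 2 + y' ^ 2) * (l1 t * (l1 t * 1) + l2 t * (l2 t * 1))).
      by rewrite -wr; ring.
    by ring.
  - by congr (_ / _); ring.
Qed.

End ConformalFactor.

(** * Invariance of the energy *)

Section WeightedKernel.
Import Coquelicot.
Local Open Scope R_scope.
Variables (gamma : R -> pt) (L : R).
Hypothesis leg : legendrian_knot gamma L.

Let x t := px (gamma t).
Let y t := py (gamma t).
Let u t := pu (gamma t).
Let L0 : 0 < L. Proof. by case: leg. Qed.
Let sx : smooth x. Proof. by case: leg => _ [_ [_ [h _]]]. Qed.
Let sy : smooth y. Proof. by case: leg => _ [_ [_ [_ [h _]]]]. Qed.
Let su : smooth u. Proof. by case: leg => _ [_ [_ [_ [_ [h _]]]]]. Qed.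
Let reg t : 0 < Derive x t ^ 2 + Derive y t ^ 2.
Proof. by case: leg => _ [_ [_ [_ [_ [_ [h _]]]]]]; exact: h. Qed.

(* Any [b] in ]L/2, L[ would do: parameters at distance less than [L] give distinct points,
   up to the diagonal. *)
Let b := 3 * L / 4.
Let a := L / 2.
Let a0 : 0 < a. Proof. rewrite /a; lra. Qed.
Let ab : a < b. Proof. rewrite /a /b; lra. Qed.

Definition v2 (t : R) : R := Derive x t * Derive x t + Derive y t * Derive y t.

Lemma smooth_v2 : smooth v2.
Proof. by apply: smooth_add; apply: smooth_mul; exact: smooth_Derive. Qed.

Lemma v2_gt0 t : 0 < v2 t.
Proof. by rewrite /v2; have := reg t; nra. Qed.

Lemma speed_v2 t : speed gamma t = sqrt (v2 t).
Proof. by rewrite /speed /v2 /x /y; congr sqrt; ring. Qed.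

(** The logarithm needs a uniform lower bound, obtained by compactness of $|s|\le b$ inside the
    larger domain $|s|<L$. *)
Lemma ESi_ln f : (forall b' n, ES L b' n f) -> (forall t s, 0 <= t <= L -> Rabs s < L -> 0 < f t s) ->
  ESi L b (fun t s => ln (f t s)).
Proof.
move=> ef fpos n.
have bL : b < L by rewrite /b; lra.
have [|m [m0 hm]] := lipb_pos_min (ES_lipb (ef L 0%N)) bL.
  move=> t s ht hs; apply: fpos => //.
  by apply: Rle_lt_trans bL; apply/Rabs_le_between.
exact: ES_ln m0 hm (ef b n).
Qed.

Lemma ESi_ln_pair h : smooth h -> (forall t, 0 < h t) ->
  ESi L b (fun t s => ln (h (t + s / 2) * h (t - s / 2))).
Proof.
move=> sh hpos; apply: (ESi_ln (f := fun t s => h (t + s / 2) * h (t - s / 2))).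
  by move=> b' n; exact: ES_pair.
by move=> t s _ _; exact: Rmult_lt_0_compat.
Qed.

Lemma ESi_lnQ : ESi L b (fun t s => ln (Qf gamma t s)).
Proof.
apply: ESi_ln => [b' n|t s ht hs]; [exact: (ES_Qf leg)|exact: (Qf_pos leg)].
Qed.

Variables (delta : R -> pt) (h : R -> R).
Hypotheses (sh : smooth h) (hpos : forall t, 0 < h t).
Hypothesis dper : forall t, delta (t + L) = delta t.
Hypothesis dN4 : forall s t, N4 (delta s) (delta t) * (h s * h t) = N4 (gamma s) (gamma t).
Hypothesis dspeed : forall t, speed delta t = speed gamma t / sqrt (h t).

(** [lw] is $\ln(d/s)$ for the distance $d$ along [delta], and [fw] the product of its two speeds.
    Writing them by logarithms and exponentials of paired products keeps both visibly even in
    $s$. *)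
Definition lw (t s : R) : R := / 4 * (ln (Qf gamma t s) - ln (h (t + s / 2) * h (t - s / 2))).
Definition fw (t s : R) : R :=
  exp (/ 2 * (ln (v2 (t + s / 2) * v2 (t - s / 2)) - ln (h (t + s / 2) * h (t - s / 2)))).

Lemma ESi_lw : ESi L b lw.
Proof.
by move=> n; apply: ES_scal; apply: ES_sub; [exact: ESi_lnQ|exact: ESi_ln_pair].
Qed.

Lemma ESi_fw : ESi L b fw.
Proof.
move=> n; apply: ES_exp; apply: ES_scal; apply: ES_sub; apply: ESi_ln_pair => //.
- exact: smooth_v2.
- exact: v2_gt0.
Qed.

(** The right-hand side is free of [h]: this is the pointwise invariance of $d^{-2}\,dp\,dq$. *)
Lemma fw_m2 t s : exp (-2 * lw t s) * fw t s =
  exp (- / 2 * ln (Qf gamma t s) + / 2 * ln (v2 (t + s / 2) * v2 (t - s / 2))).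
Proof. by rewrite -exp_plus; congr exp; rewrite /lw; field. Qed.

Lemma ln_sqrt r : 0 < r -> ln (sqrt r) = / 2 * ln r.
Proof.
move=> r0; have s0 := sqrt_lt_R0 _ r0.
by rewrite -{2}(sqrt_sqrt r); [rewrite ln_mult //; field|lra].
Qed.

Lemma sqrt_exp_ln r : 0 < r -> sqrt r = exp (/ 2 * ln r).
Proof. by move=> r0; rewrite -ln_sqrt // exp_ln //; exact: sqrt_lt_R0. Qed.

Lemma kdist_strip t s : inS L a t s -> 0 < kdist (delta (t + s / 2)) (delta (t - s / 2)) /\
  ln (kdist (delta (t + s / 2)) (delta (t - s / 2))) = phi lw t s.
Proof.
move=> [ht hs]; set H := h (t + s / 2) * h (t - s / 2).
have H0 : 0 < H by exact: Rmult_lt_0_compat.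
have Q0 : 0 < Qf gamma t s by apply: (Qf_pos leg) => //; rewrite Rabs_pos_eq; rewrite /a in hs; lra.
have s4 : 0 < s ^ 4 by apply: pow_lt; lra.
have NE : N4 (delta (t + s / 2)) (delta (t - s / 2)) = s ^ 4 * Qf gamma t s * / H.
  by rewrite -(N4_Qf leg) // -dN4 -/H; field; lra.
have N0 : 0 < N4 (delta (t + s / 2)) (delta (t - s / 2)).
  rewrite NE; apply: Rmult_lt_0_compat; first exact: Rmult_lt_0_compat.
  exact: Rinv_0_lt_compat.
have r0 := sqrt_lt_R0 _ N0.
rewrite kdistE; split; first exact: sqrt_lt_R0.
rewrite ln_sqrt // ln_sqrt // NE ln_mult; [|exact: Rmult_lt_0_compat|exact: Rinv_0_lt_compat].
rewrite ln_mult // ln_Rinv // /phi /lw -/H.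
have -> : ln (s ^ 4) = 4 * ln s.
  by rewrite pow_exp_ln ?ln_exp; [rewrite /=; ring|lra].
by field.
Qed.

Lemma speed_strip t s : speed delta (t + s / 2) * speed delta (t - s / 2) = fw t s.
Proof.
rewrite !dspeed !speed_v2 /fw.
have V0 : 0 < v2 (t + s / 2) * v2 (t - s / 2) by apply: Rmult_lt_0_compat; exact: v2_gt0.
have H0 : 0 < h (t + s / 2) * h (t - s / 2) by exact: Rmult_lt_0_compat.
have -> : / 2 * (ln (v2 (t + s / 2) * v2 (t - s / 2)) - ln (h (t + s / 2) * h (t - s / 2))) =
  / 2 * ln (v2 (t + s / 2) * v2 (t - s / 2)) + - (/ 2 * ln (h (t + s / 2) * h (t - s / 2))) by ring.
rewrite exp_plus exp_Ropp -!sqrt_exp_ln //.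
rewrite !sqrt_mult; try (left; exact: v2_gt0); try (left; exact: hpos).
have h1 := sqrt_lt_R0 _ (hpos (t + s / 2)); have h2 := sqrt_lt_R0 _ (hpos (t - s / 2)).
by field; lra.
Qed.

Lemma speed_periodic t : speed delta (t + L) = speed delta t.
Proof.
have per f : (forall r, f (r + L) = f r) -> Derive f (t + L) = Derive f t.
  move=> fper; rewrite /Derive; congr real; apply: Lim_ext => r.
  by rewrite -(fper (t + r)) -(fper t); congr ((f _ - _) / _); ring.
by rewrite /speed !per // => r; rewrite dper.
Qed.

Lemma continuity_speed t : continuity_pt (speed delta) t.
Proof.
apply: (continuity_pt_ext (fun t => sqrt (v2 t) * / sqrt (h t))).
  by move=> r; rewrite dspeed speed_v2.
apply continuity_pt_filterlim.
have cs f : smooth f -> (forall r, 0 < f r) -> continuous (fun t => sqrt (f t)) t.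
  move=> sf fpos; apply: (continuous_comp f sqrt); first exact: smooth_continuous.
  apply continuity_pt_filterlim; apply: continuity_pt_sqrt; left; exact: fpos.
apply: (continuous_mult (K := R_AbsRing) (fun t => sqrt (v2 t)) (fun t => / sqrt (h t))).
  by apply: cs; [exact: smooth_v2|exact: v2_gt0].
apply: (continuous_comp (fun t => sqrt (h t)) Rinv); first exact: cs.
apply: continuous_Rinv; apply: Rgt_not_eq; exact: sqrt_lt_R0.
Qed.

Lemma smooth_continuity_pt f t : smooth f -> continuity_pt f t.
Proof. by move=> sf; apply continuity_pt_filterlim; exact: smooth_continuous. Qed.

(** The distances along [delta] are read off from those of the smooth curve [gamma] through [h]. *)
Lemma meas2_N4 : meas2 plane (fun s t => N4 (delta s) (delta t)).
Proof.
have ch r : continuity_pt (fun t => / h t) r.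
  apply: continuity_pt_inv; first exact: smooth_continuity_pt.
  by apply: Rgt_not_eq; exact: hpos.
have m1 f : smooth f -> meas2 plane (fun s _ => f s).
  by move=> sf; apply: meas2_1 => r; exact: smooth_continuity_pt.
have m2 f : smooth f -> meas2 plane (fun _ t => f t).
  by move=> sf; apply: meas2_2 => r; exact: smooth_continuity_pt.
have msq f : meas2 plane f -> meas2 plane (fun s t => f s t ^ 2).
  move=> mf; apply: (@meas2_continuity _ (fun r => r ^ 2)) mf => r.
  exact: derivable_continuous_pt (derivable_pt_pow 2 r).
have -> : (fun s t => N4 (delta s) (delta t)) = (fun s t =>
   (((x t - x s) ^ 2 + (y t - y s) ^ 2) ^ 2 +
    16 * (u t - u s + / 2 * (y s * x t - x s * y t)) ^ 2) * (/ h s * / h t)).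
  apply: functional_extensionality => s; apply: functional_extensionality => t.
  have h1 := hpos s; have h2 := hpos t.
  transitivity (N4 (gamma s) (gamma t) * (/ h s * / h t)); last by [].
  by rewrite -dN4; field; lra.
apply: meas2_mul; last first.
  by apply: meas2_mul; [exact: (@meas2_1 _ (fun t => / h t))|exact: (@meas2_2 _ (fun t => / h t))].
apply: meas2_add.
  by apply: (msq); apply: meas2_add; apply: (msq); apply: meas2_sub; [exact: m2|exact: m1|exact: m2|exact: m1].
apply: meas2_mul; first exact: meas2_cst.
apply: (msq); apply: meas2_add.
  by apply: meas2_sub; [exact: m2|exact: m1].
apply: meas2_mul; first exact: meas2_cst.
by apply: meas2_sub; apply: meas2_mul; [exact: m1|exact: m2|exact: m1|exact: m2].
Qed.

Lemma cpow_ker d (z : C) : 0 < d ->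
  cpow d z = (ker 0 (fst z) (snd z) (ln d), ker (- (PI / 2)) (fst z) (snd z) (ln d)).
Proof.
move=> d0; rewrite cpow_pos // /ker Rplus_0_r; congr pair; congr Rmult.
by rewrite -cos_shift -cos_neg; congr cos; ring.
Qed.

Lemma meas2_kernel (pr : C -> R) th (z : C) : pr (0, 0) = 0 ->
  (forall d, 0 < d -> pr (cpow d z) = ker th (fst z) (snd z) (ln d)) ->
  meas2 plane (fun s t => pr (cpow (kdist (delta s) (delta t)) z) * speed delta s * speed delta t).
Proof.
move=> pr0 prp; apply: meas2_mul; last by apply: meas2_2 => r; exact: continuity_speed.
apply: meas2_mul; last by apply: meas2_1 => r; exact: continuity_speed.
apply: (@meas2_if_pos (fun s t => N4 (delta s) (delta t))
  (fun s t => ker th (fst z) (snd z) (/ 4 * ln (N4 (delta s) (delta t))))).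
- exact: meas2_N4.
- apply: (@meas2_continuity _ (fun p => ker th (fst z) (snd z) (/ 4 * p))).
    move=> r; apply: derivable_continuous_pt; apply: ex_derive_Reals_0.
    by rewrite /ker; auto_derive.
  exact: meas2_ln meas2_N4.
- move=> s t N0; have r0 := sqrt_lt_R0 _ N0.
  rewrite kdistE prp; last exact: sqrt_lt_R0.
  by rewrite ln_sqrt // ln_sqrt //; congr ker; field.
- move=> s t N0; rewrite kdistE cpow_npos //.
  have e : N4 (delta s) (delta t) = 0 by have := N4_ge0 (delta s) (delta t); lra.
  by rewrite e !sqrt_0; lra.
Qed.

Lemma beta_B0 (z : C) : -1 < fst z -> beta delta L z = (RtoC 2 * B0 L a lw 0 fw z)%C.
Proof.
move=> hz; have hz0 : -1 < fst z + INR 0 by rewrite /=; lra.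
have kp d : 0 < d -> fst (cpow d z) = ker 0 (fst z) (snd z) (ln d) by move=> d0; rewrite cpow_ker.
have kq d : 0 < d -> snd (cpow d z) = ker (- (PI / 2)) (fst z) (snd z) (ln d) by move=> d0; rewrite cpow_ker.
have strip (pr : C -> R) th : (forall d, 0 < d -> pr (cpow d z) = ker th (fst z) (snd z) (ln d)) ->
    forall t s, 0 <= t <= L -> 0 < s <= a ->
    ker th (fst z) (snd z) (phi lw t s) * (s ^ 0 * fw t s) =
    pr (cpow (kdist (delta (t + s / 2)) (delta (t - s / 2))) z) * speed delta (t + s / 2) * speed delta (t - s / 2).
  move=> prp t s ht hs; have [d0 dl] : _ := kdist_strip (conj ht hs).
  by rewrite prp // dl Rmult_assoc speed_strip /= Rmult_1_l.
have it th : integ L a (fun t s => ker th (fst z) (snd z) (phi lw t s) * (s ^ 0 * fw t s)).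
  exact: (integ_term L0 a0 ab ESi_lw th (snd z) (ESi_lipb ESi_fw) hz0).
rewrite (@beta_symmetric delta L z
  (fun s t => fst (cpow (kdist (delta s) (delta t)) z) * speed delta s * speed delta t)
  (fun s t => snd (cpow (kdist (delta s) (delta t)) z) * speed delta s * speed delta t)) //.
- rewrite -(@II_ext L a _ _ (strip _ _ kp)) -(@II_ext L a _ _ (strip _ _ kq)).
  rewrite /B0 /Lap /LapR.
  by apply: injective_projections; rewrite /=; ring.
- exact: (meas2_kernel (pr := fst) (th := 0)).
- exact: (meas2_kernel (pr := snd) (th := - (PI / 2))).
- by move=> s t; rewrite dper speed_periodic.
- by move=> s t; rewrite dper speed_periodic.
- by move=> s t; rewrite !kdistE N4_sym; ring.
- by move=> s t; rewrite !kdistE N4_sym; ring.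
- by apply: integ_ext (it 0) => t s ht hs; exact: (strip _ _ kp).
- by apply: integ_ext (it (- (PI / 2))) => t s ht hs; exact: (strip _ _ kq).
Qed.

End WeightedKernel.

(** * Equality of the two energies *)

Section ConformalEnergy.
Import Coquelicot.
Local Open Scope R_scope.

(* Adding the difference of the two explicit continuations, which vanishes at -2, turns a
   continuation of one beta function into a continuation of the other: the two predicates
   [is_energy] coincide, and so do their [epsilon]s. *)
Lemma energy_conformal (gamma delta : R -> pt) (L : R) (h : R -> R) :
  legendrian_knot gamma L -> smooth h -> (forall t, 0 < h t) ->
  (forall t, delta (t + L) = delta t) ->
  (forall s t, N4 (delta s) (delta t) * (h s * h t) = N4 (gamma s) (gamma t)) ->
  (forall t, speed delta t = speed gamma t / sqrt (h t)) ->
  energy gamma L = energy delta L.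
Proof.
move=> leg sh hpos dper hN hspeed; have L0 : 0 < L by case: leg.
have gper t : gamma (t + L) = gamma t by case: leg => _ [+ _]; exact.
(* With the constant factor 1 the knot itself takes the place of [delta], so the same construction
   yields both continuations. *)
have s1 : smooth (fun _ => 1) by exact: smooth_cst.
have p1 : R -> 0 < 1 by move=> _; exact: Rlt_0_1.
have n1 s t : N4 (gamma s) (gamma t) * (1 * 1) = N4 (gamma s) (gamma t) by ring.
have v1 t : speed gamma t = speed gamma t / sqrt 1 by rewrite sqrt_1; field.
have a0 : 0 < L / 2 by lra.
have ab : L / 2 < 3 * L / 4 by lra.
pose F1 z := (RtoC 2 * Bc L (L / 2) (lw gamma (fun _ => 1)) (fw gamma (fun _ => 1)) z)%C.
pose F2 z := (RtoC 2 * Bc L (L / 2) (lw gamma h) (fw gamma h) z)%C.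
have el1 := ESi_lw leg s1 p1; have ef1 := ESi_fw leg s1 p1.
have el2 := ESi_lw leg sh hpos; have ef2 := ESi_fw leg sh hpos.
have d1 z : not_pole z -> @ex_derive C_AbsRing C_NormedModule F1 z.
  move=> np; apply: C_ex_derive_mult; first exact: C_ex_derive_cst.
  exact: (ex_derive_Bc L0 a0 ab el1 ef1 np).
have d2 z : not_pole z -> @ex_derive C_AbsRing C_NormedModule F2 z.
  move=> np; apply: C_ex_derive_mult; first exact: C_ex_derive_cst.
  exact: (ex_derive_Bc L0 a0 ab el2 ef2 np).
have b1 (z : C) : -1 < fst z -> F1 z = beta gamma L z.
  by move=> hz; rewrite (beta_B0 leg s1 p1 gper n1 v1 hz) /F1 (Bc_B0 L0 a0 ab el1 ef1 hz).
have b2 (z : C) : -1 < fst z -> F2 z = beta delta L z.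
  by move=> hz; rewrite (beta_B0 leg sh hpos dper hN hspeed hz) /F2 (Bc_B0 L0 a0 ab el2 ef2 hz).
have e12 : F1 (-2, 0) = F2 (-2, 0).
  congr Cmult; apply: (Bc_m2_eq L0 a0 ab el1 el2 ef1 ef2) => t s _.
  by rewrite !fw_m2.
rewrite /energy; congr epsilon; apply: functional_extensionality => e.
apply: propositional_extensionality; split=> -[F [dF [bF eF]]].
  exists (fun z => F z - (F1 z - F2 z))%C; split; [|split].
  - move=> z np; apply: C_ex_derive_minus; first exact: dF.
    by apply: C_ex_derive_minus; [exact: d1|exact: d2].
  - by move=> z hz; rewrite bF // b1 // b2 //; ring.
  - by rewrite eF e12; ring.
exists (fun z => F z - (F2 z - F1 z))%C; split; [|split].
- move=> z np; apply: C_ex_derive_minus; first exact: dF.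
  by apply: C_ex_derive_minus; [exact: d2|exact: d1].
- by move=> z hz; rewrite bF // b1 // b2 //; ring.
- by rewrite eF e12; ring.
Qed.

End ConformalEnergy.

(* K is parametrized by gamma (period L); T(K) by gammaT, where T(gamma t) = gammaT t,
   so the hypothesis also encodes T(K) \subset H. *)
Theorem theorem3p1 (gamma : R -> pt) (L : R)
  (T : option pt -> option pt) (gammaT : R -> pt) :
  legendrian_knot gamma L ->
  PU21 T ->
  (forall t : R, T (Some (gamma t)) = Some (gammaT t)) ->
  energy gamma L = energy gammaT L.
Proof.
move=> leg HT hT.
have [h [sh hpos hN hspeed]] := PU21_conformal_factor leg HT hT.
apply: (energy_conformal leg sh hpos _ hN hspeed) => t.
case: leg => _ [gper _]; have := hT t.
by rewrite -gper hT => -[].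
Qed.
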